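(* Let $1\le p<+\infty$ and let $\Omega\subset\mathbb{R}^n$ be open and bounded. (i) Let $\{Y_k\}_{k\in\mathbb{N}}\subset L^p(\Omega;\mathbb{R}^{n\times n})$ and $\{Y_k^{-1}\}_{k\in\mathbb{N}}\subset L^p(\Omega;\mathbb{R}^{n\times n})$ both be bounded sequences and suppose that for every $k\in\mathbb{N}$, $\det Y_k>0$ almost everywhere in $\Omega$. Then there is a subsequence of $\{Y_k\}_{k\in\mathbb{N}}$ (not relabeled) and $\nu=\{\nu_x\}_{x\in\Omega}\in\mathcal{Y}^{p,-p}_+(\Omega;\mathbb{R}^{n\times n})$ such that for every $g\in L^\infty(\Omega)$ and every $v\in C_{p,-p}(\mathbb{R}^{n\times n}_{\rm inv})$ $$\lim_{k\to\infty}\int_\Omega v(Y_k(x))g(x)\,\mathrm{d}x=\int_\Omega\int_{\mathbb{R}^{n\times n}_{\rm inv}} v(s)\,\nu_x(\mathrm{d}s)\,g(x)\,\mathrm{d}x .\qquad( * )$$ (ii) Conversely, if $\nu\in\mathcal{Y}^{p,-p}_+(\Omega;\mathbb{R}^{n\times n})$, then there is a bounded sequence $\{Y_k\}_{k\in\mathbb{N}}\subset L^p(\Omega;\mathbb{R}^{n\times n})$ such that $\{Y_k^{-1}\}_{k\in\mathbb{N}}\subset L^p(\Omega;\mathbb{R}^{n\times n})$ is also bounded, for every $k\in\mathbb{N}$ $\det Y_k>0$ almost everywhere in $\Omega$, and $( * )$ holds for all $g\in L^\infty(\Omega)$ and all $v\in C_{p,-p}(\mathbb{R}^{n\times n}_{\rm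 inv})$.
   Context: $|A|$ is the Frobenius norm on $\mathbb{R}^{n\times n}$. $\mathbb{R}^{n\times n}_{\rm inv}$ is the set of invertible matrices in $\mathbb{R}^{n\times n}$, and $\mathbb{R}^{n\times n}_{\rm inv+}$ the set of matrices with positive determinant. $Y_k^{-1}$ denotes the pointwise matrix inverse $x\mapsto (Y_k(x))^{-1}$ (so $Y_k(x)$ is invertible for a.a. $x$). Young measures: $\mathrm{rca}(\mathbb{R}^{n\times n})\cong C_0(\mathbb{R}^{n\times n})^*$ is the space of Radon measures. A Young measure is a family $\nu=\{\nu_x\}_{x\in\Omega}$ of probability measures in $\mathrm{rca}(\mathbb{R}^{n\times n})$ such that $x\mapsto\int v\,\mathrm{d}\nu_x$ is measurable for every $v\in C_0(\mathbb{R}^{n\times n})$; the set of these is $\mathcal{Y}(\Omega;\mathbb{R}^{n\times n})$. Let $C_p(\mathbb{R}^{n\times n})=\{v\in C(\mathbb{R}^{n\times n}):\lim_{|s|\to\infty}v(s)/|s|^p=0\}$. A sequence $\{Y_k\}$ generates $\nu$ if for every $v\in C_p(\mathbb{R}^{n\times n})$, $v\circ Y_k\rightharpoonup \int v(s)\nu_x(\mathrm{d}s)$ weakly in $L^1(\Omega)$. $\mathcal{Y}^p(\Omega;\mathbb{R}^{n\times n})$ is the set of Young measures generated in this sense by some bounded sequence in $L^p(\Omega;\mathbb{R}^{n\times n})$. $\mathcal{Y}^{p,-p}(\Omega;\mathbb{R}^{n\times n})$ is the set of $\nu\in\mathcal{Y}^p(\Omega;\mathbb{R}^{n\times n})$ with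 $\int_\Omega\int_{\mathbb{R}^{n\times n}_{\rm inv}}(|s|^p+|s^{-1}|^p)\,\nu_x(\mathrm{d}s)\,\mathrm{d}x<+\infty$ and $\nu_x(\mathbb{R}^{n\times n}_{\rm inv})=1$ for a.a. $x\in\Omega$. $\mathcal{Y}^{p,-p}_+(\Omega;\mathbb{R}^{n\times n})$ is the set of $\nu\in\mathcal{Y}^{p,-p}(\Omega;\mathbb{R}^{n\times n})$ with $\nu_x(\mathbb{R}^{n\times n}_{\rm inv+})=1$ for a.a. $x\in\Omega$. $C_{p,-p}(\mathbb{R}^{n\times n}_{\rm inv})=\{v\in C(\mathbb{R}^{n\times n}_{\rm inv}):\lim_{|s|+|s^{-1}|\to\infty}\frac{v(s)}{|s|^p+|s^{-1}|^p}=0\}$. *)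

(* Defs.v *)
From HB Require Import structures.
From mathcomp Require Import all_boot all_order all_algebra.
From mathcomp Require Import all_classical all_reals all_analysis.
From mathcomp Require Import measurable_realfun.
Set Implicit Arguments.
Unset Strict Implicit.
Unset Printing Implicit Defensive.
Import Order.TTheory GRing.Theory Num.Theory.
Import numFieldNormedType.Exports.
Local Open Scope classical_set_scope.
Local Open Scope ring_scope.

(* The Borel sigma-algebra of the space of m x n real matrices. *)
HB.instance Definition _ (R : realType) (m n : nat) :=
  @isMeasurable.Build (sigma_display (@open 'M[R]_(m, n))) 'M[R]_(m, n)
    <<s @open 'M[R]_(m, n) >>
    (@sigma_algebra0 _ setT (@open 'M[R]_(m, n)))
    (@sigma_algebraC _ (@open 'M[R]_(m, n)))
    (@sigma_algebra_bigcup _ setT (@open 'M[R]_(m, n))).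

Section borel_matrix.
Context {R : realType} {m n : nat}.

Lemma open_measurable_mx (U : set 'M[R]_(m, n)) : open U -> measurable U.
Proof. exact: sub_sigma_algebra. Qed.

Lemma continuous_measurable_mx (f : 'M[R]_(m, n) -> R) :
  continuous f -> measurable_fun [set: 'M[R]_(m, n)] f.
Proof.
move=> /continuousP cf.
apply: (measurability _ (RGenOpens.measurableE R)) => _ [_ [a [b ->]] <-].
by rewrite setTI; apply: open_measurable_mx; apply: cf; exact: interval_open.
Qed.

Lemma ball_mxE (c : 'M[R]_(m, n)) (e : R) : 0 < e ->
  ball c e = \bigcap_i \bigcap_j [set A : 'M[R]_(m, n) | ball (c i j) e (A i j)].
Proof.
move=> e0; apply/seteqP; split => [A [_ cA] i _ j _|A cA]; first exact: cA.
by split=> // i j; exact: cA.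
Qed.

Lemma open_mx_bigcup (U : set 'M[R]_(m, n)) : open U ->
  U = \bigcup_(q in [set q : 'M[rat]_(m, n) * nat |
        ball (map_mx ratr q.1 : 'M[R]_(m, n)) q.2.+1%:R^-1 `<=` U])
      ball (map_mx ratr q.1 : 'M[R]_(m, n)) q.2.+1%:R^-1.
Proof.
move=> oU; apply/seteqP; split => [A UA|A [q /= qU qA]]; last exact: qU.
have /nbhs_ballP[e /= e0 eU] : nbhs A U by exact: open_nbhs_nbhs.
have [k ke] : exists k : nat, k.+1%:R^-1 < e / 2 :> R.
  have [k _ /(_ k (leqnn k))] : \forall k \near \oo, k.+1%:R^-1 < e / 2 :> R.
    by apply: near_infty_natSinv_lt (PosNum (divr_gt0 e0 (ltr0Sn R 1))).
  by exists k.
have q_ i j : exists q : rat, `|A i j - ratr q| < k.+1%:R^-1.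
  have /rat_in_itvoo[q] : A i j - k.+1%:R^-1 < A i j + k.+1%:R^-1.
    by rewrite ltrBlDr -addrA ltrDl addr_gt0// invr_gt0 ltr0n.
  rewrite in_itv/= => qP; exists q.
  by rewrite distrC ltr_distl.
pose Q : 'M[rat]_(m, n) := \matrix_(i, j) xchoose (q_ i j).
have QA : ball (map_mx ratr Q : 'M[R]_(m, n)) k.+1%:R^-1 A.
  split=> [|i j]; first by rewrite invr_gt0.
  rewrite !mxE; apply: ball_sym.
  exact: (xchooseP (q_ i j)).
exists (Q, k) => //= B QB; apply: eU.
have := ball_triangle (ball_sym QA) QB.
by apply: le_ball; rewrite (splitr e) lerD// ltW.
Qed.

Lemma measurable_fun_mxP d (T : measurableType d) (D : set T)
    (f : T -> 'M[R]_(m, n)) : measurable D ->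
  measurable_fun D f <-> forall i j, measurable_fun D (fun x => f x i j).
Proof.
move=> mD; split => [mf i j|mf].
  apply: (@measurable_comp _ _ _ _ _ _ setT (fun A : 'M[R]_(m, n) => A i j)) => //.
  by apply: continuous_measurable_mx; exact: coord_continuous.
apply: (@measurability _ _ _ _ D f (@open 'M[R]_(m, n))) => // _ [U oU <-].
rewrite (open_mx_bigcup oU) preimage_bigcup setI_bigcupr bigcup_mkcond.
apply: countable_bigcupT_measurable => [|[Q k]]; first exact: countableP.
case: ifPn => // _; rewrite ball_mxE ?invr_gt0//=.
set C : 'M[R]_(m, n) := map_mx ratr Q.
have -> : D `&` f @^-1` (\bigcap_i \bigcap_j [set A : 'M[R]_(m, n) |
      ball (C i j) k.+1%:R^-1 (A i j)]) =
    D `&` \bigcap_i \bigcap_j (D `&` (fun x => f x i j) @^-1`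
      ball (C i j) k.+1%:R^-1).
  apply/seteqP; split => x [Dx fx]; split=> // i _ j _.
    by split => //; exact: fx.
  by have [] := fx i I j I.
apply: measurableI => //; apply: fin_bigcap_measurable => // i _.
apply: fin_bigcap_measurable => // j _.
by apply: mf => //; apply: open_measurable; exact: ball_open.
Qed.

End borel_matrix.

(* Lebesgue measure on the Borel sets of R^n, as an n-fold product measure; R^0
   is a point of mass 1 and R^(n+1) = R x R^n through [cons_rV]. *)
Definition cons_rV (R : realType) (n : nat) (p : R * 'rV[R]_n) : 'rV[R]_n.+1 :=
  row_mx (p.1%:M : 'rV[R]_1) p.2.

Definition lebesgue_cons (R : realType) (n : nat)
    (mu : {sigma_finite_measure set 'rV[R]_n -> \bar R}) :
    set 'rV[R]_n.+1 -> \bar R :=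
  pushforward (@lebesgue_measure R \x mu)%E (@cons_rV R n).

Section lebesgue_cons.
Context (R : realType) (n : nat).
Variable mu : {sigma_finite_measure set 'rV[R]_n -> \bar R}.

Lemma measurable_cons_rV : measurable_fun setT (@cons_rV R n).
Proof.
apply/measurable_fun_mxP => // i j; rewrite /cons_rV.
rewrite (_ : (fun _ => _) = if fintype.split (j : 'I_(1 + n)) is inr k then
    (fun p : R * 'rV[R]_n => p.2 i k) else fst); last first.
  apply/funext => p; rewrite mxE; case: splitP => k _ //.
  by rewrite !ord1 mxE eqxx mulr1n.
case: (fintype.split _) => k.
exact: measurable_fst.
apply: (@measurableT_comp _ _ _ _ _ _ (fun v : 'rV[R]_n => v i k) _ snd) => //.
by have /measurable_fun_mxP := @measurable_id _ 'rV[R]_n setT; apply.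
Qed.

Let uncons_rV (v : 'rV[R]_n.+1) : R * 'rV[R]_n :=
  (v 0 0, rsubmx (v : 'rV[R]_(1 + n))).

Let measurable_uncons_rV : measurable_fun setT uncons_rV.
Proof.
have mid := measurable_fun_mxP (idfun : 'rV[R]_n.+1 -> _) (measurableT).
have mc i j : measurable_fun setT (fun v : 'rV[R]_n.+1 => v i j).
  by apply mid; exact: measurable_id.
apply/measurable_fun_pairP; split; first exact: mc.
apply/measurable_fun_mxP => // i j.
rewrite (_ : (fun _ => _) = (fun v : 'rV[R]_n.+1 => v i (rshift 1 j))); last first.
  by apply/funext => v; rewrite /= mxE.
exact: mc.
Qed.

Let cons_rVK : cancel (@cons_rV R n) uncons_rV.
Proof.
move=> [x v]; rewrite /uncons_rV /cons_rV row_mxKr; congr pair.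
rewrite mxE; case: splitP => // k _.
by rewrite !ord1 mxE eqxx mulr1n.
Qed.

Let lebesgue_cons0 : lebesgue_cons mu set0 = 0%E.
Proof. by rewrite /lebesgue_cons /pushforward preimage_set0 measure0. Qed.

Let lebesgue_cons_ge0 A : (0 <= lebesgue_cons mu A)%E.
Proof. exact: (measure_ge0 (@lebesgue_measure R \x mu)%E). Qed.

Let lebesgue_cons_sigma_additive : semi_sigma_additive (lebesgue_cons mu).
Proof.
have [m mE] : exists m : {measure set 'rV[R]_n.+1 -> \bar R},
    m = lebesgue_cons mu :> (set _ -> _).
  by exists (measure_function_pushforward__canonical__measure_function_Measure
    (@lebesgue_measure R \x mu)%E measurable_cons_rV).
by rewrite -mE; exact: measure_semi_sigma_additive.
Qed.

HB.instance Definition _ := isMeasure.Build _ _ _ (lebesgue_cons mu)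
  lebesgue_cons0 lebesgue_cons_ge0 lebesgue_cons_sigma_additive.

Let lebesgue_cons_sigma_finite : sigma_finite setT (lebesgue_cons mu).
Proof.
have [F [FT ndF Foo]] :=
  (sigma_finiteP _ _).1 (sigma_finiteT (@lebesgue_measure R)).
have [G [GT ndG Goo]] := (sigma_finiteP _ _).1 (sigma_finiteT mu).
exists (fun k => uncons_rV @^-1` (F k `*` G k)).
  rewrite -preimage_bigcup; apply/esym/seteqP; split=> // v _ /=.
  have [k _ Fk] : (\bigcup_k F k) (uncons_rV v).1 by rewrite -FT.
  have [l _ Gl] : (\bigcup_k G k) (uncons_rV v).2 by rewrite -GT.
  exists (maxn k l) => //; split.
    by move: Fk; exact/subsetPset/ndF/leq_maxl.
  by move: Gl; exact/subsetPset/ndG/leq_maxr.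
move=> k; have [mF Fk] := Foo k; have [mG Gk] := Goo k; split.
  rewrite -[X in measurable X]setTI; apply: measurable_uncons_rV => //.
  exact: measurableX.
rewrite /lebesgue_cons /pushforward -comp_preimage.
rewrite (_ : uncons_rV \o _ = id); last by apply/funext => x /=; rewrite cons_rVK.
by rewrite preimage_id product_measure1E// lte_mul_pinfty// ge0_fin_numE.
Qed.

HB.instance Definition _ := Measure_isSigmaFinite.Build _ _ _ (lebesgue_cons mu)
  lebesgue_cons_sigma_finite.

End lebesgue_cons.

Fixpoint borel_lebesgue (R : realType) (n : nat) :
    {sigma_finite_measure set 'rV[R]_n -> \bar R} :=
  match n with
  | 0 => dirac (0 : 'rV[R]_0)
  | n'.+1 => lebesgue_cons (borel_lebesgue R n')
  end.

(* R^n with the sigma-algebra of the Lebesgue (Caratheodory) measurable sets; the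
   underlying type is 'rV[R]_n. *)
Notation lebesgueType R n := (caratheodory_type ((borel_lebesgue R n)^*)%mu).

Definition lebesgue (R : realType) (n : nat) :
    {measure set (lebesgueType R n) -> \bar R} :=
  @completed_measure_extension _ _ _ (borel_lebesgue R n).

Lemma borel_lebesgue_measurable (R : realType) (n : nat) (A : set 'rV[R]_n) :
  measurable A -> measurable (A : set (lebesgueType R n)).
Proof. by move=> mA; apply: sub_caratheodory; exact: sub_sigma_algebra. Qed.

Lemma lebesgueE (R : realType) (n : nat) (A : set 'rV[R]_n) :
  measurable A -> lebesgue R n A = borel_lebesgue R n A.
Proof. by move=> mA; exact: measurable_mu_extE. Qed.

Definition frobenius (R : realType) (n : nat) (s : 'M[R]_n) : R :=
  Num.sqrt (\sum_i \sum_j s i j ^+ 2).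

Definition inv_mx (R : realType) (n : nat) : set 'M[R]_n :=
  [set s | s \in unitmx].

Definition invpos_mx (R : realType) (n : nat) : set 'M[R]_n :=
  [set s | 0 < \det s].

(* The filter "s in D and h s -> +oo". *)
Definition at_infinity (T : Type) (R : realType) (D : set T) (h : T -> R) :
    set_system T :=
  filter_from [set: R] (fun M => [set s | D s /\ M < h s]).

Section function_classes.
Context {R : realType} {n : nat}.
Implicit Types (p : R) (v : 'M[R]_n -> R).

Definition C0 v : Prop :=
  continuous v /\ v s @[s --> at_infinity setT (@frobenius R n)] --> 0.

Definition Cp p v : Prop :=
  continuous v /\
  v s / frobenius s `^ p @[s --> at_infinity setT (@frobenius R n)] --> 0.

(* C_{p,-p}(R^{n x n}_inv); a function on the invertible matrices is represented
   by a total [v] whose values at singular matrices are irrelevant. *)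
Definition Cpp p v : Prop :=
  {within @inv_mx R n, continuous v} /\
  v s / (frobenius s `^ p + frobenius (invmx s) `^ p)
    @[s --> at_infinity (@inv_mx R n)
              (fun s => frobenius s + frobenius (invmx s))] --> 0.

End function_classes.

Section young_measures.
Context {R : realType} {n : nat}.
Implicit Types (p : R) (Omega : set 'rV[R]_n) (g : 'rV[R]_n -> R).
Implicit Types (Y : 'rV[R]_n -> 'M[R]_n) (nu : 'rV[R]_n -> probability 'M[R]_n R).
Local Notation mu := (lebesgue R n).

Definition Linfty Omega g : Prop :=
  measurable_fun (Omega : set (lebesgueType R n)) g /\
  ('N[mu]_+oo[(EFin \o g) \_ Omega] < +oo)%E.

Definition Lp_norm p Omega Y : \bar R :=
  'N[mu]_(p%:E)[(fun x => (frobenius (Y x))%:E) \_ Omega].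

Definition Lp p Omega Y : Prop :=
  measurable_fun (Omega : set (lebesgueType R n)) Y /\
  (Lp_norm p Omega Y < +oo)%E.

Definition bounded_in_Lp p Omega (Y : nat -> 'rV[R]_n -> 'M[R]_n) : Prop :=
  (forall k, Lp p Omega (Y k)) /\
  exists C : R, forall k, (Lp_norm p Omega (Y k) <= C%:E)%E.

Definition weak_L1_cvg Omega (f : nat -> 'rV[R]_n -> \bar R)
    (h : 'rV[R]_n -> \bar R) : Prop :=
  [/\ forall k, mu.-integrable Omega (f k),
      mu.-integrable Omega h &
      forall g, Linfty Omega g ->
        (\int[mu]_(x in Omega) (f k x * (g x)%:E) @[k --> \oo] -->
         \int[mu]_(x in Omega) (h x * (g x)%:E))%E].

(* A family (nu_x) indexed by Omega is represented by a function on R^n, whose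
   values outside Omega are irrelevant. A Borel probability measure on a
   Euclidean space is a Radon measure. *)
Definition young_measure Omega nu : Prop :=
  forall v, C0 v ->
    measurable_fun (Omega : set (lebesgueType R n))
      (fun x => (\int[nu x]_s (v s)%:E)%E : \bar R).

Definition generates p Omega (Y : nat -> 'rV[R]_n -> 'M[R]_n) nu : Prop :=
  forall v, Cp p v ->
    weak_L1_cvg Omega (fun k x => (v (Y k x))%:E)
      (fun x => \int[nu x]_s (v s)%:E)%E.

Definition Yp p Omega nu : Prop :=
  young_measure Omega nu /\
  exists Y : nat -> 'rV[R]_n -> 'M[R]_n,
    bounded_in_Lp p Omega Y /\ generates p Omega Y nu.

(* [Ypp] and [Ypp_plus] are Y^{p,-p} and Y^{p,-p}_+. *)
Definition Ypp p Omega nu : Prop :=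
  [/\ Yp p Omega nu,
      (\int[mu]_(x in Omega) \int[nu x]_(s in @inv_mx R n)
         (frobenius s `^ p + frobenius (invmx s) `^ p)%:E < +oo)%E &
      {ae mu, forall x, Omega x -> nu x (@inv_mx R n) = 1%E}].

Definition Ypp_plus p Omega nu : Prop :=
  Ypp p Omega nu /\
  {ae mu, forall x, Omega x -> nu x (@invpos_mx R n) = 1%E}.

Definition det_pos_ae Omega Y : Prop :=
  {ae mu, forall x, Omega x -> 0 < \det (Y x)}.

Definition limit_formula p Omega (Y : nat -> 'rV[R]_n -> 'M[R]_n) nu : Prop :=
  forall g v, Linfty Omega g -> Cpp p v ->
    (\int[mu]_(x in Omega) (v (Y k x) * g x)%:E @[k --> \oo] -->
     \int[mu]_(x in Omega)
       ((\int[nu x]_(s in @inv_mx R n) (v s)%:E) * (g x)%:E))%E.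

End young_measures.

(* Main.v *)
(* Call a function on matrices a test function if it is continuous where
   det > 0 and vanishes unless det > 0 and |s| + |s^-1| <= m, for some m. Its
   support is compact, because det is bounded below there. Every v in C_{p,-p}
   is, up to e * (|s|^p + |s^-1|^p), a test function on {det > 0}; hence, under
   the L^p bounds, convergence for test functions implies convergence
   for all of C_{p,-p}, and a fortiori for all of C_p.

   Compactness for test functions is obtained without representation theorems
   for dual spaces. The matrices are coded by recording their membership in the
   first j balls of a countable base; a test function is uniformly close to one
   depending only on the j-th code. Along a subsequence the indicator functions
   of the sets {x | Y_k(x) has code u} converge weakly to densities f_u
   (ultrafilter limits, Radon-Nikodym, and a diagonal extraction on a countable
   pi-system). For a.e. x the weights f_u(x) are consistent, and subdividing
   [0, 1[ into intervals of length f_u(x) produces a random matrix whose law is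
   nu_x. The L^p bounds prevent loss of mass at infinity or at singular matrices,
   so nu_x is carried by {det > 0}.

   For the converse, nu is generated by some Y_k whose inverses are not
   controlled. Replacing Y_k by the identity where a cutoff at level m is below
   1/2, with k = k(m) large, keeps both norms bounded; the modification takes
   place on sets whose measure tends to 0, since nu_x is carried by {det > 0}. *)
Require Import Defs.
From HB Require Import structures.
From mathcomp Require Import all_boot all_order all_algebra.
From mathcomp Require Import all_classical all_reals all_analysis.
From mathcomp Require Import measurable_realfun ess_sup_inf.
From mathcomp Require Import ring lra.
Set Implicit Arguments.
Unset Strict Implicit.
Unset Printing Implicit Defensive.
Import Order.TTheory GRing.Theory Num.Theory.
Import numFieldNormedType.Exports.
Local Open Scope classical_set_scope.
Local Open Scope ring_scope.

(** A subsequence can be extracted for countably many requirements only, while additivity of the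
    limits is wanted on all measurable sets. The ultrafilter resolves this: its limits exist on
    every measurable set at once, are additive and dominated by Lebesgue measure, hence countably
    additive. The subsequence only has to reproduce these known limits on the pi-system, and
    domination propagates the convergence to all measurable sets.

    Mass that escapes to infinity is parked at the zero matrix, which is singular for n > 0, so that
    test functions vanish there. Every nu_x is thus a probability measure from the start, and
    tightness only has to show that {det > 0} has full measure.

    Test functions, extended by zero, are continuous on all matrices and belong to C_p; this is how
    a generating sequence enters the converse. There the threshold 1/2 lets integrals of test
    functions control both the norms and the size of the modified set, so that k(m) is subject to
    finitely many conditions and serves all test functions together. *)

(** * Continuity of the determinant and of inversion *)

Lemma continuous_at_mx (R : realType) (T : topologicalType) (m n : nat)
    (f : T -> 'M[R]_(m, n)) (x : T) :
  (forall i j, f y i j @[y --> x] --> f x i j) -> f y @[y --> x] --> f x.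
Proof.
move=> cf; apply/cvg_ballP => e e0.
have : \forall y \near x, forall ij : 'I_m * 'I_n,
    ball (f x ij.1 ij.2) e (f y ij.1 ij.2).
  apply: filter_forall => -[i j] /=.
  by have /cvg_ballP /(_ e e0) := cf i j.
by apply: filterS => y xy; split=> // i j; exact: (xy (i, j)).
Qed.

Lemma continuous_at_det (R : realType) (T : topologicalType) (n : nat)
    (f : T -> 'M[R]_n) (x : T) :
  (forall i j, f y i j @[y --> x] --> f x i j) ->
  \det (f y) @[y --> x] --> \det (f x).
Proof.
move=> cf; rewrite /determinant.
apply: cvg_big => [|s _]; first exact: add_continuous.
apply: cvgM; first exact: cvg_cst.
apply: cvg_big => [|i _]; first exact: mul_continuous.
exact: cf.
Qed.

Lemma det_continuous (R : realType) (n : nat) :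
  continuous (fun s : 'M[R]_n => \det s).
Proof. by move=> s; apply: continuous_at_det => i j; exact: coord_continuous. Qed.

(** Near an invertible matrix the inverse is [(\det t)^-1 *: \adj t], and the entries of the
    adjugate are, up to sign, determinants of submatrices. *)
Lemma invmx_continuous_at (R : realType) (n : nat) (s : 'M[R]_n) :
  s \in unitmx -> invmx t @[t --> s] --> invmx s.
Proof.
rewrite unitmxE unitfE => s0.
have near_unit : \forall t \near s, t \in unitmx.
  have : nbhs (\det s) [set y : R | y != 0].
    by apply: open_nbhs_nbhs; split => //; exact: open_neq.
  move=> /(@det_continuous R n s); apply: (@filterS _ (nbhs s)) => t /= t0.
  by rewrite unitmxE unitfE.
have E : invmx s = (\det s)^-1 *: \adj s by rewrite /invmx unitmxE unitfE s0.
rewrite E.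
have invE : {near s, (fun t : 'M[R]_n => (\det t)^-1 *: \adj t) =1 @invmx R n}.
  by apply: filterS near_unit => t t0; rewrite /invmx t0.
apply: cvg_trans (near_eq_cvg invE) _.
apply: cvgZ; first by apply: cvgV => //; exact: det_continuous.
apply: (@continuous_at_mx R _ n n (fun t : 'M[R]_n => \adj t)) => i j.
under eq_fun do rewrite /adjugate mxE /cofactor.
rewrite /adjugate mxE /cofactor.
apply: (@cvgM _ _ (nbhs s) _ (fun=> (-1) ^+ (j + i)%N)
  (fun t : 'M[R]_n => \det (row' j (col' i t))) _ _ (cvg_cst _)).
apply: (@continuous_at_det R _ n.-1 (fun t : 'M[R]_n => row' j (col' i t))) => k l /=.
under eq_fun do rewrite !mxE.
by rewrite !mxE; exact: coord_continuous.
Qed.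

(** * The Frobenius norm and compactness of balls of matrices *)

Section frobenius.
Context {R : realType} {n : nat}.
Implicit Types s : 'M[R]_n.

Lemma frobenius_ge0 s : 0 <= frobenius s.
Proof. exact: sqrtr_ge0. Qed.

Lemma ler_coord_frobenius s i j : `|s i j| <= frobenius s.
Proof.
rewrite -sqrtr_sqr ler_wsqrtr// (bigD1 i)//= (bigD1 j)//= -addrA lerDl.
by rewrite addr_ge0// !sumr_ge0// => k _; rewrite ?sqr_ge0// sumr_ge0// => l _;
  rewrite sqr_ge0.
Qed.

(** The norm on the left is the largest modulus of an entry. Compactness and the rational balls
    refer to it, the growth conditions to [frobenius]; this inequality turns bounds on the second
    into bounds on the first. *)
Lemma ler_norm_frobenius s : `|s| <= frobenius s.
Proof.
rewrite [leLHS]/Num.Def.normr /= mx_normrE; apply/bigmax_leP.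
by split => [|[i j] _]; [exact: frobenius_ge0|exact: ler_coord_frobenius].
Qed.

Lemma frobenius_continuous : continuous (@frobenius R n).
Proof.
move=> s; suff : frobenius t @[t --> s] --> frobenius s by [].
rewrite /frobenius.
have sq : \sum_i \sum_j t i j ^+ 2 @[t --> s] --> \sum_i \sum_j s i j ^+ 2.
  apply: (@cvg_big _ _ _ _ _ (@add_continuous _) 'M[R]_n (nbhs s)) => i _.
  apply: (@cvg_big _ _ _ _ _ (@add_continuous _) 'M[R]_n (nbhs s)) => j _.
  have st : t i j @[t --> s] --> s i j by exact: coord_continuous.
  by rewrite expr2; under eq_fun do rewrite expr2; exact: cvgM.
exact: cvg_comp sq (@sqrt_continuous R _).
Qed.
Lemma frobenius_gt0 s : s != 0 -> 0 < frobenius s.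
Proof. by rewrite -normr_gt0 => /lt_le_trans; apply; exact: ler_norm_frobenius. Qed.

Lemma unitmx_neq0 (m : nat) (s : 'M[R]_m) : (0 < m)%N -> s \in unitmx -> s != 0.
Proof.
case: m s => // m s _; apply: contraTneq => ->.
by rewrite unitmxE det0 unitr0.
Qed.

(** The ball is a closed subset of the image under [vec_mx] of a box of row vectors, which is
    compact as a product of segments. *)
Lemma closed_ball_mx_compact (r : R) : compact [set s : 'M[R]_n | `|s| <= r].
Proof.
pose A := [set v : 'rV[R]_(n * n) | forall i, v ord0 i \in `[- r, r]].
have cA : compact A.
  apply: (@rV_compact _ _ (fun=> `[- r, r]%classic)) => _.
  exact: segment_compact.
have cvec : continuous (@vec_mx R n n).
  move=> v; apply: continuous_at_mx => i j.
  under eq_fun do rewrite mxE.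
  by rewrite mxE; exact: coord_continuous.
apply: (subclosed_compact _ (continuous_compact _ cA) _) => /=.
- rewrite (_ : mkset _ = Num.norm @^-1` [set x : R | x <= r]).
    by apply: closed_comp => [s _|]; [exact: norm_continuous|exact: closed_le].
  by [].
- by apply: continuous_subspaceT; exact: cvec.
- move=> s sr; exists (mxvec s) => [i|]; last exact: mxvecK.
  case/mxvec_indexP: i => i j; rewrite mxvecE in_itv /= -ler_norml.
  apply: le_trans sr; rewrite [leRHS]/Num.Def.normr /= mx_normrE.
  by apply/bigmax_geP; right; exists (i, j).
Qed.

(** Bolzano-Weierstrass without extracting a subsequence: only infinitely many terms have to lie in
    the ball, and the terms close to the cluster point can be taken among them. *)
Lemma cluster_mx (u : nat -> 'M[R]_n) (r : R) :
  (forall J, exists2 j, (J <= j)%N & `|u j| <= r) ->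
  exists2 s : 'M[R]_n, `|s| <= r &
  forall U J, nbhs s U -> exists j, [/\ (J <= j)%N, `|u j| <= r & U (u j)].
Proof.
move=> ur.
pose D J := [set j | (J <= j)%N /\ `|u j| <= r].
pose F := filter_from [set: nat] (fun J => u @` D J).
have FF : ProperFilter F.
  apply: filter_from_proper => [|J _]; last first.
    by have [j Jj uj] := ur J; exists (u j), j.
  apply: filter_from_filter; first by exists 0%N.
  move=> i j _ _; exists (maxn i j) => // _ [k [ijk uk] <-].
  by move: ijk; rewrite geq_max => /andP[ik jk]; split; exists k.
have [] := @closed_ball_mx_compact r _ FF.
  by exists 0%N => // _ [j [_ uj] <-].
move=> s [sr cs]; exists s => // U J sU.
have FJ : F (u @` D J) by exists J.
by have [_ [[j [Jj uj] <-] Uj]] := cs _ _ FJ sU; exists j.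
Qed.

End frobenius.

Lemma powR_cvg (R : realType) (p x : R) : 0 < x -> y `^ p @[y --> x] --> x `^ p.
Proof.
move=> x0.
have E : {near x, (fun y => expR (p * ln y)) =1 (fun y => y `^ p)}.
  near=> y; rewrite /powR gt_eqF//; near: y; exact: lt_nbhsr.
apply: cvg_trans (near_eq_cvg E) _; rewrite [x `^ p]/powR gt_eqF//.
have plx : p * ln y @[y --> x] --> p * ln x.
  exact: cvgM (cvg_cst _) (continuous_ln x0).
exact: cvg_comp plx (@continuous_expR R _).
Unshelve. all: by end_near. Qed.

Lemma ler_add1_powR (R : realType) (p x : R) : 1 <= p -> 0 <= x -> x <= 1 + x `^ p.
Proof.
move=> p1 x0; have [x1|x1] := leP 1 x; last first.
  by rewrite (le_trans (ltW x1))// lerDl powR_ge0.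
by rewrite (le_trans _ (_ : x `^ p <= _)) ?lerDr// -[leLHS]powRr1// ler_powR.
Qed.

(** * Test functions *)

Section growth.
Context {R : realType} {n : nat}.
Implicit Types (s : 'M[R]_n) (p m : R).

(** Since [invmx s] is [s] itself for singular [s], the quantities [inv_size] and [growth] have
    their intended meaning on invertible matrices only; statements that use the inverse assume
    [0 < \det s] or [s \in unitmx]. *)
Definition inv_size s : R := frobenius s + frobenius (invmx s).

Definition growth p s : R := frobenius s `^ p + frobenius (invmx s) `^ p.

Lemma posdet_unitmx s : 0 < \det s -> s \in unitmx.
Proof. by move=> s0; rewrite unitmxE unitfE gt_eqF. Qed.

Lemma ler_norm_inv_size s : `|s| <= inv_size s.
Proof. by rewrite (le_trans (ler_norm_frobenius s))// lerDl frobenius_ge0. Qed.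

Lemma growth_ge0 p s : 0 <= growth p s.
Proof. by rewrite addr_ge0// powR_ge0. Qed.

Lemma growth_gt0 p s : (0 < n)%N -> s \in unitmx -> 0 < growth p s.
Proof.
move=> n0 /(unitmx_neq0 n0) s0.
by rewrite ltr_wpDr ?powR_ge0// powR_gt0// frobenius_gt0.
Qed.

Lemma inv_size_le_growth p s : 1 <= p -> inv_size s <= 2 + growth p s.
Proof.
move=> p1.
have := lerD (ler_add1_powR p1 (frobenius_ge0 s))
             (ler_add1_powR p1 (frobenius_ge0 (invmx s))).
by rewrite /inv_size /growth; lra.
Qed.

Lemma inv_size_cvg s : 0 < \det s -> inv_size t @[t --> s] --> inv_size s.
Proof.
move=> /posdet_unitmx s0; apply: (cvgD (@frobenius_continuous R n s)).
exact: cvg_comp (invmx_continuous_at s0) (@frobenius_continuous R n _).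
Qed.

Lemma growth_cvg p s : (0 < n)%N -> s \in unitmx ->
  growth p t @[t --> s] --> growth p s.
Proof.
move=> n0 s0.
have f0 : 0 < frobenius s by exact/frobenius_gt0/unitmx_neq0.
have g0 : 0 < frobenius (invmx s).
  by apply/frobenius_gt0/unitmx_neq0; rewrite ?unitmx_inv.
have fi : frobenius (invmx t) @[t --> s] --> frobenius (invmx s).
  exact: cvg_comp (invmx_continuous_at s0) (@frobenius_continuous R n _).
have c1 : frobenius t `^ p @[t --> s] --> frobenius s `^ p.
  exact: (@cvg_comp _ _ _ (@frobenius R n) (fun y => y `^ p) _ _ _
    (@frobenius_continuous R n s) (powR_cvg (p:=p) f0)).
have c2 : frobenius (invmx t) `^ p @[t --> s] --> frobenius (invmx s) `^ p.
  exact: (@cvg_comp _ _ _ _ (fun y => y `^ p) _ _ _ fi (powR_cvg (p:=p) g0)).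
exact: cvgD c1 c2.
Qed.

(* [det s * det s^-1 = 1] and [det] is bounded on bounded sets, so the inverse
   blows up at singular matrices. *)
Lemma det_ge_inv_size m : exists2 d : R, 0 < d &
  forall s, 0 < \det s -> inv_size s <= m -> d <= \det s.
Proof.
have cB := @closed_ball_mx_compact R n m.
have [D [Dr DB]] : bounded_set ((fun s : 'M[R]_n => \det s) @` [set s | `|s| <= m]).
  apply/compact_bounded/continuous_compact => //.
  by apply: continuous_subspaceT; exact: det_continuous.
pose C := `|D| + 1.
have C0 : 0 < C by rewrite ltr_wpDl.
exists C^-1 => [|s s0 sm]; first by rewrite invr_gt0.
have : `|\det (invmx s)| <= C.
  apply: DB; first by rewrite /C; have := ler_norm D; lra.
  exists (invmx s) => //=.
  by rewrite (le_trans (ler_norm_frobenius _))// (le_trans _ sm)// lerDr frobenius_ge0.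
rewrite det_inv ger0_norm ?invr_ge0 ?(ltW s0)// => sC.
by rewrite -(invrK (\det s)) lef_pV2 ?posrE ?invr_gt0.
Qed.

(** As m grows these functions increase to the indicator function of {det > 0}, and each of them is
    a test function. *)
Definition cutoff m s : R :=
  if 0 < \det s then Num.max 0 (Num.min 1 (m + 1 - inv_size s)) else 0.

Lemma cutoff_ge0 m s : 0 <= cutoff m s.
Proof. by rewrite /cutoff; case: ifP => // _; rewrite le_max lexx. Qed.

Lemma cutoff_le1 m s : cutoff m s <= 1.
Proof. by rewrite /cutoff; case: ifP => // _; rewrite ge_max ler01 ge_min lexx. Qed.

Lemma cutoff_eq1 m s : 0 < \det s -> inv_size s <= m -> cutoff m s = 1.
Proof.
move=> s0 sm; rewrite /cutoff s0 min_l; last lra.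
by rewrite max_r.
Qed.

Lemma cutoff_neq0 m s : cutoff m s != 0 -> 0 < \det s /\ inv_size s <= m + 1.
Proof.
rewrite /cutoff; case: ifPn => [s0|]; last by rewrite eqxx.
case: (leP (inv_size s) (m + 1)) => // sm; rewrite max_l ?eqxx//.
by rewrite ge_min; apply/orP; right; lra.
Qed.

Lemma cutoff_nd m m' s : m <= m' -> cutoff m s <= cutoff m' s.
Proof.
move=> mm; rewrite /cutoff; case: ifP => // _.
rewrite ge_max !le_max lexx/= le_min !ge_min lexx/=.
by apply/orP; right; apply/orP; right; lra.
Qed.

Lemma cutoff_cvg m s : 0 < \det s -> cutoff m t @[t --> s] --> cutoff m s.
Proof.
move=> s0.
have E : {near s, (fun t : 'M[R]_n => Num.max 0 (Num.min 1 (m + 1 - inv_size t)))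
    =1 cutoff m}.
  have : nbhs (\det s) [set y : R | 0 < y].
    by apply: open_nbhs_nbhs; split => //; exact: open_gt.
  move=> /(@det_continuous R n s); apply: (@filterS _ (nbhs s)) => t /= t0.
  by rewrite /cutoff t0.
apply: cvg_trans (near_eq_cvg E) _; rewrite /cutoff s0.
apply: (@continuous_max R _ (cst 0) (fun t => Num.min 1 (m + 1 - inv_size t)) s).
  exact: (@cst_continuous _ _ 0 s).
apply: (@continuous_min R _ (cst 1) (fun t => m + 1 - inv_size t) s).
  exact: cst_continuous.
have H : m + 1 - inv_size t @[t --> s] --> m + 1 - inv_size s.
  exact: (@cvgB _ _ _ (nbhs s) _ _ _ _ _ (cvg_cst (m + 1)) (inv_size_cvg s0)).
exact: H.
Qed.

Definition test_fun (w : 'M[R]_n -> R) : Prop :=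
  (forall s, 0 < \det s -> w t @[t --> s] --> w s) /\
  exists m : R, forall s, w s != 0 -> 0 < \det s /\ inv_size s <= m.

Lemma cutoff_test_fun m (v : 'M[R]_n -> R) :
  (forall s, 0 < \det s -> v t @[t --> s] --> v s) ->
  test_fun (fun s => cutoff m s * v s).
Proof.
move=> cv; split=> [s s0|]; first exact:
  (@cvgM _ _ (nbhs s) _ _ _ _ _ (cutoff_cvg s0) (cv s s0)).
exists (m + 1) => s; rewrite mulf_eq0 negb_or => /andP[+ _].
exact: cutoff_neq0.
Qed.

(** On the support the determinant is at least some d > 0, so w vanishes in a neighbourhood of every
    matrix with det <= 0. *)
Lemma test_fun_continuous w : test_fun w -> continuous w.
Proof.
move=> [cw [m wm]] s; have [/cw//|s0] := ltP 0 (\det s).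
have [d d0 dm] := det_ge_inv_size m.
have near0 : nbhs s [set t | w t = 0].
  have : nbhs (\det s) [set y : R | y < d].
    by apply: open_nbhs_nbhs; split; [exact: open_lt|rewrite /= (le_lt_trans s0)].
  move=> /(@det_continuous R n s); apply: (@filterS _ (nbhs s)) => t /= td.
  by apply/eqP/negPn/negP => /wm[t0 /(dm _ t0)]; rewrite leNgt td.
have ws : w s = 0 := nbhs_singleton near0.
have E : {near s, cst 0 =1 w} by apply: filterS near0 => t ->.
suff : w t @[t --> s] --> w s by [].
by apply: cvg_trans (near_eq_cvg E) _; rewrite ws; exact: cvg_cst.
Qed.

Lemma test_fun_supp w : test_fun w -> exists m : R, forall s, w s != 0 -> `|s| <= m.
Proof.
move=> [_ [m wm]]; exists m => s /wm[_]; apply: le_trans.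
exact: ler_norm_inv_size.
Qed.

Lemma test_fun_bounded w : test_fun w -> exists2 C : R, 0 < C & forall s, `|w s| <= C.
Proof.
move=> tw; have [m wm] := test_fun_supp tw.
have [D [Dr DB]] : bounded_set (w @` [set s | `|s| <= m]).
  apply/compact_bounded/continuous_compact; last exact: closed_ball_mx_compact.
  by apply: continuous_subspaceT; exact: test_fun_continuous.
exists (`|D| + 1) => [|s]; first by rewrite ltr_wpDl.
have [->|/wm sm] := eqVneq (w s) 0; first by rewrite normr0 addr_ge0.
apply: (DB (`|D| + 1)); last by exists s.
by have := ler_norm D; lra.
Qed.

(** The zero matrix will be the value given to limits that do not exist, because no test function
    sees it. *)
Lemma test_fun0 w : (0 < n)%N -> test_fun w -> w 0 = 0.
Proof.
move=> n0 [_ [m wm]]; apply/eqP/negPn/negP => /wm[].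
have -> : \det (0 : 'M[R]_n) = 0 by move: n0; case: (n) => // k _; rewrite det0.
by rewrite ltxx.
Qed.

Lemma measurable_test_fun w : test_fun w -> measurable_fun [set: 'M[R]_n] w.
Proof. by move=> /test_fun_continuous; exact: continuous_measurable_mx. Qed.

Lemma open_continuous_measurable_mx (U : set 'M[R]_n) (v : 'M[R]_n -> R) :
  open U -> (forall s, U s -> v t @[t --> s] --> v s) -> measurable_fun U v.
Proof.
move=> oU cv; apply: (measurability _ (RGenOpens.measurableE R)).
move=> _ [_ [a [b ->]] <-]; suff : open (U `&` v @^-1` `]a, b[%classic).
  exact: open_measurable_mx.
rewrite openE => s [Us vs]; apply: filterI; first exact: open_nbhs_nbhs.
by apply: (cv s Us); apply: open_nbhs_nbhs; split => //; exact: interval_open.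
Qed.

Lemma open_posdet : open [set s : 'M[R]_n | 0 < \det s].
Proof.
rewrite (_ : mkset _ = (fun s : 'M[R]_n => \det s) @^-1` [set x : R | 0 < x])//.
by apply: open_comp => [s _|]; [exact: det_continuous|exact: open_gt].
Qed.

(** Extension by zero from {det > 0}: in general discontinuous, but Borel on the space of all
    matrices, so that integrals need no restricted domain. *)
Definition posdet_part (v : 'M[R]_n -> R) s : R := if 0 < \det s then v s else 0.

Lemma measurable_posdet_part (v : 'M[R]_n -> R) :
  (forall s, 0 < \det s -> v t @[t --> s] --> v s) ->
  measurable_fun [set: 'M[R]_n] (posdet_part v).
Proof.
move=> cv; apply: measurable_fun_if => //.
  apply: (measurable_fun_bool true); rewrite setTI.
  by apply: open_measurable_mx; exact: open_posdet.
rewrite setTI; apply: open_continuous_measurable_mx; last exact: cv.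
exact: open_posdet.
Qed.

End growth.

Lemma cvg_at_infinityP (R : realType) (T : Type) (D : set T) (h f : T -> R) :
  f s @[s --> at_infinity D h] --> (0 : R) <->
  (forall e, 0 < e -> exists M, forall s, D s -> M < h s -> `|f s| < e).
Proof.
split=> [f0 e e0|f0 A /nbhs_ballP[e /= e0 eA]].
  have [M _ MD] := f0 _ (nbhsx_ballx (0 : R) e e0).
  by exists M => s Ds Ms; have := MD s (conj Ds Ms); rewrite -ball_normE /= sub0r normrN.
have [M MD] := f0 e e0; exists M => // s [Ds Ms]; apply: eA.
by rewrite -ball_normE /= sub0r normrN; exact: MD.
Qed.

(** * The function classes C_p and C_{p,-p} *)

Section classes.
Context {R : realType} {n : nat}.
Implicit Types (s : 'M[R]_n) (p m : R) (v w : 'M[R]_n -> R).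

Lemma open_unitmx : open [set s : 'M[R]_n | s \in unitmx].
Proof.
rewrite (_ : mkset _ = (fun s : 'M[R]_n => \det s) @^-1` [set x : R | x != 0]).
  by apply: open_comp => [s _|]; [exact: det_continuous|exact: open_neq].
by apply/seteqP; split => s /=; rewrite unitmxE unitfE.
Qed.

Lemma Cpp_cvg p v : Cpp p v -> forall s, 0 < \det s -> v t @[t --> s] --> v s.
Proof.
move=> [+ _] s s0; rewrite continuous_open_subspace; last exact: open_unitmx.
by apply; rewrite inE; exact: posdet_unitmx.
Qed.

Lemma Cpp_small p v : (0 < n)%N -> Cpp p v -> forall e, 0 < e ->
  exists M, forall s, 0 < \det s -> M < inv_size s -> `|v s| <= e * growth p s.
Proof.
move=> n0 [_ /cvg_at_infinityP v0] e /v0[M Me]; exists M => s s0.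
move=> /(Me s) => /(_ (posdet_unitmx s0)).
have g0 : 0 < growth p s by apply/growth_gt0/posdet_unitmx.
rewrite normrM normfV -/(growth p s) (ger0_norm (ltW g0)).
by rewrite ltr_pdivrMr// => /ltW.
Qed.

Lemma norm_le_bounded v m : continuous v ->
  exists2 C, 0 <= C & forall s, `|s| <= m -> `|v s| <= C.
Proof.
move=> cv.
have [D [Dr DB]] : bounded_set (v @` [set s | `|s| <= m]).
  apply/compact_bounded/continuous_compact; last exact: closed_ball_mx_compact.
  exact: continuous_subspaceT.
exists (`|D| + 1) => [|s sm]; first by rewrite addr_ge0.
apply: (DB (`|D| + 1)); last by exists s.
by have := ler_norm D; lra.
Qed.

(** Where |s| is large, the growth dominates |s|^p; where |s| stays bounded, v is bounded and the
    inverse has to be large. *)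
Lemma Cp_Cpp p v : (0 < n)%N -> 1 <= p -> Cp p v -> Cpp p v.
Proof.
move=> n0 p1 [cv /cvg_at_infinityP v0]; split.
  exact: continuous_subspaceT.
apply/cvg_at_infinityP => e e0.
have [M Me] := v0 e e0.
have [C C0 CM] := norm_le_bounded (`|M|) cv.
(* For |s| <= |M| this leaves |s^-1| > C / e + 1, hence |s^-1|^p > C / e. *)
exists (`|M| + C / e + 1 + `|M|) => s sU sM.
have g0 : 0 < growth p s by exact: growth_gt0.
rewrite normrM normfV -/(growth p s) (ger0_norm (ltW g0)) ltr_pdivrMr//.
have fs0 := frobenius_ge0 s; have fi0 := frobenius_ge0 (invmx s).
have [Ms|sM'] := ltP (`|M|) (frobenius s).
  have fp0 : 0 < frobenius s `^ p by apply: powR_gt0; apply: le_lt_trans Ms.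
  have := Me s I (le_lt_trans (ler_norm M) Ms).
  rewrite normrM normfV (ger0_norm (ltW fp0)) ltr_pdivrMr// => /lt_le_trans; apply.
  by rewrite ler_pM2l// lerDl powR_ge0.
have vC : `|v s| <= C by apply: CM; rewrite (le_trans (ler_norm_frobenius s)).
apply: (le_lt_trans vC); rewrite mulrC -ltr_pdivrMr//.
have Ce0 : 0 <= C / e by rewrite divr_ge0// ltW.
have := inv_size_le_growth s p1; have := ler_add1_powR p1 fi0.
have := powR_ge0 (frobenius s) p; have := normr_ge0 M.
by move: sM; rewrite /growth /=; lra.
Qed.

(** This is how a sequence that generates nu in the sense of C_p is brought to bear on test
    functions. *)
Lemma test_fun_Cp p w : 1 <= p -> test_fun w -> Cp p w.
Proof.
move=> p1 tw; split; first exact: test_fun_continuous.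
have [_ [m wm]] := tw; apply/cvg_at_infinityP => e e0; exists m => s _ ms.
suff -> : w s = 0 by rewrite mul0r normr0.
apply/eqP/negPn/negP => /wm[_ sm].
by have := frobenius_ge0 (invmx s); move: sm ms; rewrite /inv_size; lra.
Qed.

End classes.

(** * Coding matrices by rational balls *)

Section bcode.
Context {T : Type} (B : nat -> set T).

(* The most recent digit comes first. *)
Fixpoint bcode (j : nat) (x : T) : seq bool :=
  if j is i.+1 then `[< B i x >] :: bcode i x else [::].

(** The cells with codes of length j are the atoms, some possibly empty, of the algebra generated by
    the first j sets. *)
Definition bcell (u : seq bool) : set T := [set x | bcode (size u) x = u].

Lemma size_code j x : size (bcode j x) = j.
Proof. by elim: j => //= j ->. Qed.

Lemma cell_code j x : bcell (bcode j x) x.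
Proof. by rewrite /bcell /= size_code. Qed.

Lemma cell_cons b u :
  bcell (b :: u) = bcell u `&` (if b then B (size u) else ~` B (size u)).
Proof.
apply/seteqP; split => [x [+ xu]|x [xu Bx]]; rewrite /bcell /=.
  by case: asboolP => Bx <-.
by rewrite xu; congr cons; case: b Bx => Bx; [apply/asboolP|apply/asboolPn].
Qed.

Lemma code_le i j x y : (i <= j)%N -> bcode j x = bcode j y -> bcode i x = bcode i y.
Proof.
elim: j => [|j ih]; first by rewrite leqn0 => /eqP ->.
by rewrite leq_eqVlt => /predU1P[->//|ij] /= [_]; exact: ih.
Qed.

Lemma code_mem i j x y : (i < j)%N -> bcode j x = bcode j y -> B i x <-> B i y.
Proof.
move=> ij /(code_le ij) /= [xy _].
by rewrite (rwP (asboolP (B i x))) xy -(rwP (asboolP (B i y))).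
Qed.

End bcode.

Lemma measurable_cell d (T : measurableType d) (B : nat -> set T) u :
  (forall i, measurable (B i)) -> measurable (bcell B u).
Proof.
move=> mB; elim: u => [|b u ih].
  suff -> : bcell B [::] = setT by [].
  by apply/seteqP; split => // x _; exact: erefl.
by rewrite cell_cons; apply: measurableI => //; case: b => //; exact: measurableC.
Qed.

Section rational_balls.
Context {R : realType} {m n : nat}.

(** An index that codes no pair of a centre and a radius yields the empty set, so every natural
    number can serve as a digit position. *)
Definition rational_ball (i : nat) : set 'M[R]_(m, n) :=
  if unpickle i is Some q then
    ball (map_mx ratr (q : 'M[rat]_(m, n) * nat).1 : 'M[R]_(m, n)) q.2.+1%:R^-1
  else set0.

Lemma open_rational_ball i : open (rational_ball i).
Proof.
rewrite /rational_ball; case: unpickle => [q|]; last exact: open0.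
by apply: ball_open; rewrite invr_gt0.
Qed.

Lemma measurable_rational_ball i : measurable (rational_ball i).
Proof. by apply: open_measurable_mx; exact: open_rational_ball. Qed.

Lemma open_rational_balls (U : set 'M[R]_(m, n)) : open U ->
  U = \bigcup_(i in [set i | rational_ball i `<=` U]) rational_ball i.
Proof.
move=> oU; apply/seteqP; split => [s|s [i /= iU]]; last exact: iU.
rewrite [in X in X -> _](open_mx_bigcup oU) => -[q /= qU qs].
by exists (pickle q); rewrite /= /rational_ball pickleK.
Qed.

Lemma nbhs_rational_ball (s : 'M[R]_(m, n)) U : nbhs s U ->
  exists i, rational_ball i s /\ rational_ball i `<=` U.
Proof.
rewrite nbhsE => -[V [oV]]; rewrite [in X in X -> _](open_rational_balls oV).
move=> [i /= iV si] VU.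
by exists i; split => // t /iV/VU.
Qed.

End rational_balls.

Section code_matrix.
Context {R : realType} {n : nat}.
Local Notation mcode := (bcode (@rational_ball R n n)).
Local Notation mcell := (bcell (@rational_ball R n n)).
Implicit Types (w : 'M[R]_n -> R) (S : nat -> 'M[R]_n).

(** Otherwise each j admits two matrices with the same j-th code at which w differs by more than e,
    one of them in the bounded support. These accumulate at some s0. A ball of the base around s0,
    on which w stays within e / 2 of w(s0), contains a late one of them, and with it its partner,
    since the codes agree on that ball. *)
Lemma code_test_fun w (e : R) : test_fun w -> 0 < e ->
  exists J, forall s t, mcode J s = mcode J t -> `|w s - w t| <= e.
Proof.
move=> tw e0; have [m wm] := test_fun_supp tw; have cw := test_fun_continuous tw.
apply: contrapT => /forallNP nJ.
have nJ' J : exists st : 'M[R]_n * 'M[R]_n,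
    [/\ mcode J st.1 = mcode J st.2, e < `|w st.1 - w st.2| & `|st.1| <= m].
  have /existsNP[s /existsNP[t /not_implyP[st /negP]]] := nJ J.
  rewrite -ltNge => wst.
  have [ws0|ws] := eqVneq (w s) 0; last by exists (s, t); split => //=; exact: wm.
  (* The pair is swapped so that its first member lies in the support; boundedness is needed for
     that member only. *)
  exists (t, s); split => //=; first by rewrite distrC.
  apply: wm; apply/eqP => wt0.
  by move: wst; rewrite ws0 wt0 subr0 normr0 ltNge (ltW e0).
have [st stP] := choice nJ'.
have [|s0 _ cs0] := @cluster_mx R n (fst \o st) m.
  by move=> J; exists J => //; have [] := stP J.
have U0 : nbhs s0 [set t | `|w s0 - w t| < e / 2].
  by have /cvgr_dist_lt := cw s0; apply; rewrite divr_gt0.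
have [i [si iU]] := nbhs_rational_ball U0.
have [j [ij _ iuj]] := cs0 _ i.+1 (open_nbhs_nbhs (conj (@open_rational_ball R n n i) si)).
have [codej + _] := stP j; have := iU _ ((code_mem ij codej).1 iuj).
have := iU _ iuj; rewrite /= => w1 w2; apply/negP; rewrite -leNgt.
have -> : w (st j).1 - w (st j).2 = (w s0 - w (st j).2) - (w s0 - w (st j).1) by ring.
by rewrite (le_trans (ler_normB _ _))//; lra.
Qed.

(* A sequence with compatible codes converges in the one-point compactification
   of the space of matrices; meeting one of the balls excludes the point at
   infinity. *)
Lemma code_cvg S i : (forall i j, (i <= j)%N -> mcode i (S j) = mcode i (S i)) ->
  rational_ball i (S i.+1) -> cvgn S.
Proof.
move=> Sc Si.
(* Beyond stage k the digit recording ball k is frozen: a ball that contains one later term contains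
   all of them. *)
have Sball k j : (k < j)%N -> rational_ball k (S j) ->
    forall l, (k < l)%N -> rational_ball k (S l).
  move=> kj kSj l kl.
  apply: (code_mem (ltnSn k) (Sc _ _ kl)).2.
  exact: (code_mem (ltnSn k) (Sc _ _ kj)).1.
have [r Sr] : exists r, forall j, (i < j)%N -> `|S j| <= r.
  move: (Sball i i.+1 (ltnSn i) Si); rewrite /rational_ball.
  case: unpickle => [q qS|qS]; last by exists 0 => j /qS.
  exists (`|map_mx ratr q.1 : 'M[R]_n| + q.2.+1%:R^-1) => j /qS.
  rewrite -ball_normE /= => /ltW; rewrite -lerBlDl; apply: le_trans.
  by rewrite distrC; exact: lerB_dist.
have [|s _ cs] := @cluster_mx R n S r.
  by move=> J; exists (maxn J i.+1); [exact: leq_maxl|apply: Sr; exact: leq_maxr].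
apply/cvg_ex; exists s => U /nbhs_rational_ball[k [ks kU]].
have [j [kj _ kSj]] := cs _ k.+1 (open_nbhs_nbhs (conj (@open_rational_ball R n n k) ks)).
by exists k.+1 => // l /= kl; apply/kU/(Sball _ _ kj).
Qed.

(** The sequence avoids each ball from some stage on, so it accumulates nowhere. If |w (S J)|
    exceeded e, then w would not vanish at the later terms, which share the code of length J; they
    would stay in the bounded support of w and accumulate. *)
Lemma code_not_cvg S w (e : R) J :
  (forall i j, (i <= j)%N -> mcode i (S j) = mcode i (S i)) ->
  (forall i, ~ rational_ball i (S i.+1)) -> test_fun w -> 0 < e ->
  (forall s t, mcode J s = mcode J t -> `|w s - w t| <= e) ->
  `|w (S J)| <= e.
Proof.
move=> Sc nS tw e0 osc; have [m wm] := test_fun_supp tw.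
rewrite leNgt; apply/negP => wSJ.
have Sm j : (J <= j)%N -> `|S j| <= m.
  move=> Jj; apply: wm; apply/eqP => wSj.
  by have := osc _ _ (Sc _ _ Jj); rewrite wSj sub0r normrN leNgt wSJ.
have [|s _ cs] := @cluster_mx R n S m.
  by move=> K; exists (maxn K J); [exact: leq_maxl|apply: Sm; exact: leq_maxr].
have [k [ks _]] := nbhs_rational_ball (@filterT _ (nbhs s) _).
have [j [kj _ kSj]] := cs _ k.+1 (open_nbhs_nbhs (conj (@open_rational_ball R n n k) ks)).
by apply: (nS k); exact: (code_mem (ltnSn k) (Sc _ _ kj)).1.
Qed.

End code_matrix.

(** * Real-valued integrals *)

Section Rintegral_ae.
Context {d : measure_display} {T : measurableType d} {R : realType}.
Variables (mu : {measure set T -> \bar R}) (D : set T).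
Hypothesis mD : measurable D.
Implicit Types f g h : T -> R.

Lemma integrable_measurable_fun f : mu.-integrable D (EFin \o f) -> measurable_fun D f.
Proof. by move=> /measurable_int /measurable_EFinP. Qed.

Lemma ae_le_integrable f h : measurable_fun D f -> mu.-integrable D (EFin \o h) ->
  {ae mu, forall x, D x -> `|f x| <= h x} -> mu.-integrable D (EFin \o f).
Proof.
move=> mf ih fh; have mh := integrable_measurable_fun ih.
apply/integrableP; split; first exact/measurable_EFinP.
have /integrableP[_] := ih; apply: le_lt_trans.
apply: ae_ge0_le_integral => //.
- by apply: measurableT_comp => //; exact/measurable_EFinP.
- by apply: measurableT_comp => //; exact/measurable_EFinP.
- apply: filterS fh => x fh Dx /=; rewrite lee_fin.
  by rewrite (le_trans (fh Dx))// ler_norm.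
Qed.

Lemma ae_le_Rintegral f g : mu.-integrable D (EFin \o f) ->
  mu.-integrable D (EFin \o g) -> {ae mu, forall x, D x -> f x <= g x} ->
  \int[mu]_(x in D) f x <= \int[mu]_(x in D) g x.
Proof.
move=> jf jg fg; rewrite -subr_ge0 -RintegralB//.
have jgf : mu.-integrable D (EFin \o (fun x => g x - f x)).
  by rewrite (_ : _ \o _ = (EFin \o g) \- (EFin \o f))%E//; exact: integrableB.
have jabs : mu.-integrable D (EFin \o (fun x => `|g x - f x|)).
  exact: integrable_norm jgf.
suff -> : \int[mu]_(x in D) (g x - f x) = \int[mu]_(x in D) `|g x - f x|.
  exact: Rintegral_ge0.
congr fine; apply: ae_eq_integral => //.
- exact: measurable_int jgf.
- exact: measurable_int jabs.
- by apply: filterS fg => x fg Dx; rewrite ger0_norm// subr_ge0 fg.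
Qed.

Lemma dist_Rintegral_le f g h : mu.-integrable D (EFin \o f) ->
  mu.-integrable D (EFin \o g) -> mu.-integrable D (EFin \o h) ->
  {ae mu, forall x, D x -> `|f x - g x| <= h x} ->
  `|\int[mu]_(x in D) f x - \int[mu]_(x in D) g x| <= \int[mu]_(x in D) h x.
Proof.
move=> jf jg jh fgh; rewrite -RintegralB//.
have jfg : mu.-integrable D (EFin \o (fun x => f x - g x)).
  by rewrite (_ : _ \o _ = (EFin \o f) \- (EFin \o g))%E//; exact: integrableB.
apply: le_trans (le_normr_Rintegral mD jfg) _.
by apply: ae_le_Rintegral => //; exact: integrable_norm jfg.
Qed.

Lemma bounded_integrable f (C : R) : (mu D < +oo)%E -> measurable_fun D f ->
  (forall x, D x -> `|f x| <= C) -> mu.-integrable D (EFin \o f).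
Proof.
move=> muD mf fC; apply: measurable_bounded_integrable => //.
exists C; split; first exact: num_real.
by move=> M CM x Dx; apply: le_trans (fC x Dx) _; exact: ltW.
Qed.

Lemma Rintegral_cstM (c : R) f : mu.-integrable D (EFin \o f) ->
  \int[mu]_(x in D) (c * f x) = c * \int[mu]_(x in D) f x.
Proof. exact: RintegralZl. Qed.

Lemma integrable_cstM (c : R) f : mu.-integrable D (EFin \o f) ->
  mu.-integrable D (EFin \o (fun x => c * f x)).
Proof. by move=> jf; exact: (integrableZl mD c jf). Qed.

Lemma integrable_addr f g : mu.-integrable D (EFin \o f) ->
  mu.-integrable D (EFin \o g) -> mu.-integrable D (EFin \o (fun x => f x + g x)).
Proof. by move=> jf jg; exact: (integrableD mD jf jg). Qed.

Lemma Rintegral_sum (I : Type) (r : seq I) (F : I -> T -> R) :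
  (forall i, mu.-integrable D (EFin \o F i)) ->
  \int[mu]_(x in D) (\sum_(i <- r) F i x) = \sum_(i <- r) \int[mu]_(x in D) F i x.
Proof.
move=> jF; rewrite /Rintegral.
under eq_integral do rewrite -sumEFin.
rewrite integral_sum//.
rewrite (eq_bigr (fun i => (fine (\int[mu]_(x in D) (F i x)%:E))%:E)); last first.
  by move=> i _; rewrite fineK//; apply: (integrable_fin_num mD); exact: jF.
by rewrite sumEFin.
Qed.

End Rintegral_ae.

Lemma ae_forall_count (d : measure_display) (T : measurableType d) (R : realType)
    (mu : {measure set T -> \bar R}) (I : countType) (Q : I -> T -> Prop) :
  (forall i, {ae mu, forall x, Q i x}) -> {ae mu, forall x, forall i, Q i x}.
Proof.
move=> aeQ; pose Q' k x := if unpickle k is Some i then Q i x else True.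
have : {ae mu, forall x, forall k, Q' k x}.
  apply: ae_foralln => k; rewrite /Q'; case: unpickle => [i|]; first exact: aeQ.
  exact: aeW.
by apply: filterS => x Qx i; have := Qx (pickle i); rewrite /Q' pickleK.
Qed.

Lemma Rintegral_prob_cst (d : measure_display) (T : measurableType d) (R : realType)
    (P : probability T R) (c : R) : \int[P]_x c = c.
Proof.
rewrite Rintegral_cst// -[RHS]mulr1; congr (_ * _).
by transitivity (fine (1%E : \bar R)) => //; congr fine; exact: probability_setT.
Qed.

Lemma probability_lty (d : measure_display) (T : measurableType d) (R : realType)
    (P : probability T R) : (P setT < +oo)%E.
Proof. by rewrite probability_setT ltry. Qed.

(** * Probability measures with prescribed cell weights *)

Definition unit_interval_prob (R : realType) : probability (measurableTypeR R) R :=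
  uniform_prob (@ltr01 R).

Lemma unit_interval_probE (R : realType) (a b : R) : 0 <= a -> a <= b -> b <= 1 ->
  unit_interval_prob R `[a, b[%classic = (b - a)%:E.
Proof.
move=> a0 ab b1; rewrite /unit_interval_prob /= /uniform_prob.
rewrite (eq_integral (cst 1%E)) => [|x]; last first.
  rewrite inE /= in_itv /= => /andP[ax xb].
  by rewrite /uniform_pdf (le_trans a0 ax) (le_trans (ltW xb) b1) subr0 invr1.
rewrite integral_cst//= mul1e lebesgue_measure_itv /= lte_fin.
case: ltP => [_|ba]; first by rewrite EFinB.
by rewrite (@le_anti _ _ b a) ?subrr// ba ab.
Qed.

Section code_measure.
Context {R : realType} {n : nat}.
Local Notation mcode := (bcode (@rational_ball R n n)).
Local Notation mcell := (bcell (@rational_ball R n n)).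

(** The default 0 occurs at empty cells, which carry no weight. *)
Definition cell_point (u : seq bool) : 'M[R]_n := xget 0 (mcell u).

Lemma cell_pointP u : mcell u !=set0 -> mcell u (cell_point u).
Proof. by move=> [x ux]; exact: (xgetPex 0 (ex_intro _ x ux)). Qed.

Lemma code_cell_point j s : mcode j (cell_point (mcode j s)) = mcode j s.
Proof.
have := @cell_pointP (mcode j s) (ex_intro _ s (cell_code _ j s)).
by rewrite /bcell /= size_code.
Qed.

(** A finitely additive probability on the algebra generated by the balls. It need not be countably
    additive: mass may sit at infinity. *)
Definition cell_weights (p : seq bool -> R) : Prop :=
  [/\ p [::] = 1, forall u, 0 <= p u, forall u, p u = p (true :: u) + p (false :: u) &
      forall u, mcell u = set0 -> p u = 0].

Variable p : seq bool -> R.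
Hypothesis wp : cell_weights p.

(* [ [left_end u, left_end u + p u[ ] is the interval of parameters coded by [u]. *)
Fixpoint left_end (u : seq bool) : R :=
  if u is b :: u' then left_end u' + (if b then p (false :: u') else 0) else 0.

(** Sampling by inversion: every interval is divided in two, the digit [false] taking the left part,
    and t is followed down the binary tree. The code is meaningful for t in [0, 1[. *)
Fixpoint path_code (j : nat) (t : R) : seq bool :=
  if j is i.+1 then
    let u := path_code i t in (left_end u + p (false :: u) <= t) :: u
  else [::].

Lemma size_path_code j t : size (path_code j t) = j.
Proof. by elim: j => //= j ->. Qed.

Lemma left_end_bounds u : 0 <= left_end u /\ left_end u + p u <= 1.
Proof.
have [p1 p0 pD _] := wp; elim: u => [|b u [l0 l1]] /=; first by rewrite p1 add0r.
have := p0 (true :: u); have := p0 (false :: u); move: (pD u) => E.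
by case: b; split; lra.
Qed.

Lemma path_code_itv j t : 0 <= t < 1 ->
  left_end (path_code j t) <= t < left_end (path_code j t) + p (path_code j t).
Proof.
have [p1 p0 pD _] := wp; move=> t01; elim: j => [|j /andP[lt tl]] /=.
  by rewrite add0r p1.
have E := pD (path_code j t).
case: (leP (left_end (path_code j t) + p (false :: path_code j t)) t) => /= ?;
  by apply/andP; split; lra.
Qed.

Lemma path_code_uniq u t : left_end u <= t < left_end u + p u -> path_code (size u) t = u.
Proof.
have [p1 p0 pD _] := wp; elim: u => //= b u ih /andP[lt tl].
have E := pD u; have pt := p0 (true :: u); have pf := p0 (false :: u).
have ut : path_code (size u) t = u.
  by apply: ih; move: lt tl; case: b => /= ? ?; apply/andP; split; lra.
rewrite ut; congr cons; move: lt tl; case: b => /= ? ?; first by apply/idP; lra.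
by apply/negbTE; rewrite -ltNge; lra.
Qed.

Local Notation P := (unit_interval_prob R).

Lemma measurable_path_code j u :
  measurable ([set t | path_code j t = u] : set (measurableTypeR R)).
Proof.
elim: j u => [|j ih] u /=.
  case: u => [|b u]; last by rewrite (_ : mkset _ = set0)//; apply/seteqP; split.
  by rewrite (_ : mkset _ = setT)//; apply/seteqP; split.
case: u => [|b u]; first by rewrite (_ : mkset _ = set0)//; apply/seteqP; split.
rewrite (_ : mkset _ = [set t | path_code j t = u] `&`
    [set t | (left_end u + p (false :: u) <= t) = b]).
  apply: measurableI => //; case: b.
    rewrite (_ : mkset _ = `[left_end u + p (false :: u), +oo[%classic)//.
    by apply/seteqP; split => t /=; rewrite in_itv/= andbT.
  rewrite (_ : mkset _ = `]-oo, left_end u + p (false :: u)[%classic)//.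
  apply/seteqP; split => t /=; rewrite in_itv/= ltNge.
    by move=> ->.
  by move/negbTE.
by apply/seteqP; split => [t [<- <-]|t /= [-> ->]].
Qed.

Lemma path_code_prob u : P [set t | path_code (size u) t = u] = (p u)%:E.
Proof.
have [l0 l1] := left_end_bounds u; have [p1 p0 _ _] := wp.
have P01 : P `[0, 1[%classic = 1%E by rewrite unit_interval_probE ?subr0.
have mpu := measurable_path_code (size u) u.
have m01 : measurable (`[0, 1[%classic : set (measurableTypeR R)) by [].
(* The complement of [0, 1[ is a null set for [P]; inside [0, 1[ the parameters with code [u] form
   exactly the interval of [u]. *)
transitivity (P ([set t | path_code (size u) t = u] `&` `[0, 1[%classic)).
  apply/eqP; rewrite eq_le; apply/andP; split; last first.
    by apply: le_measure; rewrite ?inE//; exact: measurableI.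
  rewrite [leLHS](measureDI P mpu m01)// [X in (X + _)%E](_ : _ = 0%E) ?add0e//.
  apply/eqP; rewrite -measure_le0 -(_ : P (~` `[0, 1[%classic) = 0%E).
    apply: le_measure; rewrite ?inE ?setDE//; last exact: measurableC.
    by apply: measurableI => //; exact: measurableC.
  by rewrite probability_setC// P01 subee.
rewrite (_ : _ `&` _ = `[left_end u, left_end u + p u[%classic).
  by rewrite unit_interval_probE ?lerDl// addrC addKr.
apply/seteqP; split => [t [/= tu]|t]; rewrite /= !in_itv/= => t01.
  by have := path_code_itv (size u) t01; rewrite tu.
split; first exact: path_code_uniq.
by move: t01 => /andP[? ?]; apply/andP; split; lra.
Qed.

End code_measure.

Section code_measure_limit.
Context {R : realType} {n : nat}.
Local Notation mcode := (bcode (@rational_ball R n n)).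
Local Notation mcell := (bcell (@rational_ball R n n)).
Variable p : seq bool -> R.
Hypothesis wp : @cell_weights R n p.
Local Notation P := (unit_interval_prob R).
Local Notation TR := (measurableTypeR R).

Definition path_point (j : nat) (t : TR) : 'M[R]_n := cell_point (path_code p j t).

(** No prefix of the path names an empty cell, so that [path_point] realises each prefix by an
    actual matrix. *)
Definition path_good : set TR :=
  [set t | forall u, mcell u = set0 -> path_code p (size u) t <> u].

(** A digit [true] records the entry into a ball; a path without one escapes to infinity. *)
Definition path_bounded : set TR :=
  [set t | exists u, path_code p (size u).+1 t = true :: u].

Lemma measurable_path_good : measurable path_good.
Proof.
rewrite (_ : path_good = ~` \bigcup_(u in [set u | mcell u = set0])
    [set t | path_code p (size u) t = u]).
  apply: measurableC; rewrite bigcup_mkcond.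
  apply: countable_bigcupT_measurable => [|u]; first exact: countableP.
  by case: ifPn => // _; exact: measurable_path_code.
apply/seteqP; split => [t tg [u u0] tu|t tn u u0 tu]; first exact: (tg u u0).
by apply: tn; exists u.
Qed.

Lemma measurable_path_bounded : measurable path_bounded.
Proof.
rewrite (_ : path_bounded = \bigcup_u [set t | path_code p (size u).+1 t = true :: u]).
  apply: countable_bigcupT_measurable => [|u]; first exact: countableP.
  exact: measurable_path_code.
by apply/seteqP; split => [t [u tu]|t [u _ tu]]; exists u.
Qed.

Lemma path_good_ae : {ae P, forall t, path_good t}.
Proof.
apply: ae_forall_count => u; have [u0|u0] := pselect (mcell u = set0); last first.
  by apply: aeW => t /u0.
exists [set t | path_code p (size u) t = u]; split.
- exact: measurable_path_code.
- by have [_ _ _ pE] := wp; exact: etrans (path_code_prob wp u) (congr1 EFin (pE u u0)).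
- by move=> t /not_implyP[_ /contrapT].
Qed.

Lemma measurable_path_point j : measurable_fun setT (path_point j).
Proof.
move=> _ U mU; rewrite setTI (_ : _ @^-1` _ =
    \bigcup_(u in [set u | U (cell_point u)]) [set t | path_code p j t = u]).
  rewrite bigcup_mkcond; apply: countable_bigcupT_measurable => [|u].
    exact: countableP.
  by case: ifPn => // _; exact: measurable_path_code.
apply/seteqP; split => [t Ut|t [u Uu /= tu]]; first by exists (path_code p j t).
by rewrite /= /path_point tu.
Qed.

Lemma bcode_path_point i j t : path_good t -> (i <= j)%N ->
  mcode i (path_point j t) = path_code p i t.
Proof.
move=> tg ij; have : mcode j (path_point j t) = path_code p j t.
  have : mcell (path_code p j t) !=set0.
    apply/set0P/eqP => /tg; rewrite size_path_code; exact.
  by move=> /cell_pointP; rewrite /bcell /= size_path_code.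
move: (path_point j t) => x; elim: j ij => [|j ih]; first by rewrite leqn0 => /eqP ->.
by rewrite leq_eqVlt => /predU1P[->//|ij] [_]; exact: ih.
Qed.

(** The constant 0 off the set of convergent paths makes the limit exist for every t, so that
    [path_limit] is measurable as a pointwise limit. *)
Definition path_approx (j : nat) (t : TR) : 'M[R]_n :=
  if t \in path_good `&` path_bounded then path_point j t else 0.

Definition path_limit (t : TR) : 'M[R]_n := limn (path_approx ^~ t).

Lemma path_approx_cvg t : cvgn (path_approx ^~ t).
Proof.
rewrite /path_approx; have [|_] := boolP (t \in path_good `&` path_bounded);
  last exact: is_cvg_cst.
rewrite inE => -[tg [u tu]]; apply: (@code_cvg _ _ _ (size u)).
  move=> i j ij; rewrite (bcode_path_point tg ij).
  by rewrite (bcode_path_point tg (leqnn i)).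
have := @bcode_path_point (size u).+1 _ t tg (leqnn _).
by rewrite tu => -[] /asboolP.
Qed.

Lemma measurable_path_limit : measurable_fun setT path_limit.
Proof.
apply/measurable_fun_mxP => // i j.
apply: (@measurable_fun_cvg _ _ _ _ (fun k t => path_approx k t i j)) => [k|t _].
  have : measurable_fun setT (path_approx k).
    apply: measurable_fun_if => //.
    - apply: (measurable_fun_bool true).
      rewrite setTI (_ : _ @^-1` _ = path_good `&` path_bounded).
        by apply: measurableI; [exact: measurable_path_good|exact: measurable_path_bounded].
      by apply/seteqP; split => t; [move/set_mem|exact: mem_set].
    - by apply: measurable_funTS; exact: measurable_path_point.
  by move=> /measurable_fun_mxP; apply.
have := @path_approx_cvg t; rewrite /path_limit => tl.
exact: (cvg_comp _ _ tl (@coord_continuous _ _ _ i j _)).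
Qed.

Lemma path_limit_test_fun w e J t : (0 < n)%N -> test_fun w -> 0 < e ->
  (forall r s, mcode J r = mcode J s -> `|w r - w s| <= e) -> path_good t ->
  `|w (path_limit t) - w (path_point J t)| <= e.
Proof.
move=> n0 tw e0 osc tg.
have Sc i j : (i <= j)%N -> mcode i (path_point j t) = mcode i (path_point i t).
  by move=> ij; rewrite (bcode_path_point tg ij) (bcode_path_point tg (leqnn i)).
have [tb|tb] := pselect (path_bounded t); last first.
  (* An escaping path has the limit 0 by convention, where w vanishes; along it, w is already at
     most e in modulus at stage J. *)
  rewrite (_ : path_limit t = 0) ?test_fun0// ?sub0r ?normrN.
    apply: (@code_not_cvg _ _ (path_point ^~ t)) => // i iS; apply: tb.
    exists (path_code p i t); rewrite size_path_code.
    rewrite -(bcode_path_point tg (leqnn _)) /= (bcode_path_point tg (leqnSn _)).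
    by congr cons; apply/asboolP.
  rewrite /path_limit (_ : path_approx ^~ t = cst 0) ?lim_cst//.
  apply/funext => k; rewrite /path_approx; case: ifPn => //.
  by move=> /set_mem[_ /tb].
have cw := test_fun_continuous tw.
have wl : w (path_approx k t) @[k --> \oo] --> w (path_limit t).
  exact: (cvg_comp _ _ (@path_approx_cvg t) (cw _)).
have wd : `|w (path_approx k t) - w (path_point J t)| @[k --> \oo] -->
    `|w (path_limit t) - w (path_point J t)|.
  by apply: cvg_norm; apply: cvgB => //; exact: cvg_cst.
rewrite -(cvg_lim (@Rhausdorff R) wd); apply: limr_le.
  by apply/cvg_ex; eexists; exact: wd.
exists J => // k /= Jk; rewrite /path_approx mem_set//.
by apply: osc; exact: Sc.
Qed.

Lemma Rintegral_path_point w J : \int[P]_t w (path_point J t) =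
  \sum_(u : J.-tuple bool) w (cell_point u) * p u.
Proof.
have mI (u : J.-tuple bool) := measurable_path_code p J u.
transitivity (\int[P]_t (\sum_(u : J.-tuple bool)
    w (cell_point u) * \1_([set r | path_code p J r = u] : set TR) t)).
  congr fine; apply: eq_integral => t _; congr EFin.
  have sz : size (path_code p J t) == J by rewrite size_path_code.
  rewrite (bigD1 (Tuple sz))//= indicE mem_set//= mulr1 big1 ?addr0// => u ut.
  rewrite indicE memNset ?mulr0// => /= tu; move/eqP: ut; apply.
  exact/val_inj.
have jI (u : J.-tuple bool) :
    P.-integrable setT (EFin \o \1_[set t | path_code p J t = u]).
  exact: integrable_indic.
rewrite Rintegral_sum// => [|u]; last exact: integrable_cstM.
apply: eq_bigr => u _; rewrite Rintegral_cstM//; congr (_ * _).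
rewrite /Rintegral integral_indic// setIT.
have := path_code_prob wp u; rewrite size_tuple => E.
by transitivity (fine (p u)%:E) => //; congr fine; exact: E.
Qed.

End code_measure_limit.

(** The measure is the law of [path_limit]. Weight lost at infinity reappears as mass at the zero
    matrix, invisible to test functions; this is why the comparison is made with test functions
    only. *)
Lemma code_measure (R : realType) (n : nat) (p : seq bool -> R) :
  (0 < n)%N -> @cell_weights R n p ->
  exists nu : probability 'M[R]_n R, forall (w : 'M[R]_n -> R) (e : R) (J : nat),
    test_fun w -> 0 < e ->
    (forall r s, bcode (@rational_ball R n n) J r = bcode (@rational_ball R n n) J s ->
       `|w r - w s| <= e) ->
    `|\int[nu]_s w s - \sum_(u : J.-tuple bool) w (cell_point u) * p u| <= e.
Proof.
move=> n0 wp; have mZ := @measurable_path_limit R n p.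
pose Z : {mfun measurableTypeR R >-> 'M[R]_n} :=
  HB.pack (@path_limit R n p) (isMeasurableFun.Build _ _ _ _ _ mZ).
exists (distribution (unit_interval_prob R) Z) => w e J tw e0 osc.
have mw := measurable_test_fun tw; have [C C0 wC] := test_fun_bounded tw.
have P1 : (unit_interval_prob R setT < +oo)%E by rewrite probability_setT ltry.
have jZ : (unit_interval_prob R).-integrable setT (EFin \o (w \o path_limit p)).
  have mwZ := measurableT_comp mw mZ.
  by apply: (bounded_integrable measurableT (C := C)) => [//||x _]; [exact: mwZ|exact: wC].
have jS : (unit_interval_prob R).-integrable setT (EFin \o (w \o path_point p J)).
  have mwS := measurableT_comp mw (@measurable_path_point R n p J).
  by apply: (bounded_integrable measurableT (C := C)) => [//||x _]; [exact: mwS|exact: wC].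
rewrite -(Rintegral_path_point wp).
have -> : \int[distribution (unit_interval_prob R) Z]_s w s =
    \int[unit_interval_prob R]_t (w (path_limit p t)).
  congr fine; rewrite /distribution integral_pushforward//.
  exact/measurable_EFinP.
rewrite [leRHS](_ : e = \int[unit_interval_prob R]_t e); last first.
  exact/esym/Rintegral_prob_cst.
apply: dist_Rintegral_le => //.
  exact: finite_measure_integrable_cst.
by apply: filterS (path_good_ae wp) => t tg _; exact: path_limit_test_fun.
Qed.

(** * Weak limits of sequences of sets *)

Section dominated_additive.
Context {d : measure_display} {T : measurableType d} {R : realType}.
Variables (mu : {finite_measure set T -> \bar R}).
Variables (la : {sigma_finite_measure set T -> \bar R}) (L : set T -> R).
Hypothesis mula : mu `<< la.
Hypothesis L_le : forall A, measurable A -> 0 <= L A /\ ((L A)%:E <= mu A)%E.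
Hypothesis L_add : forall A B, measurable A -> measurable B -> A `&` B = set0 ->
  L (A `|` B) = L A + L B.

(** A measure has to be nonnegative on all sets, while [L] is controlled on measurable ones only. *)
Definition dominated_extension (A : set T) : \bar R :=
  if `[< measurable A >] then (L A)%:E else 0%E.

Local Notation nu := dominated_extension.

Let nuE A : measurable A -> nu A = (L A)%:E.
Proof. by move=> mA; rewrite /dominated_extension; case: asboolP. Qed.

Let L0 : L set0 = 0.
Proof.
have [l0] := L_le measurable0; rewrite measure0 lee_fin => l1.
by apply/le_anti; rewrite l0 l1.
Qed.

Let nu0 : nu set0 = 0%E.
Proof. by rewrite nuE// L0. Qed.

Let nu_ge0 A : (0 <= nu A)%E.
Proof. by rewrite /dominated_extension; case: asboolP => // /L_le[]; rewrite lee_fin. Qed.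

Let nu_sigma_additive : semi_sigma_additive nu.
Proof.
move=> F mF tF mU; set U := \bigcup_i F i in mU *.
(* By finite additivity the partial sums miss L U by L (V m), the value on the tail of the union. It
   is at most mu (V m), which tends to 0 because V m decreases to the empty set. *)
pose V m := U `\` \bigcup_(i in `I_m) F i.
have mV m : measurable (V m).
  by apply: measurableD => //; apply: bigcup_measurable => i _.
have V0 : mu (V m) @[m --> \oo] --> 0%E.
  rewrite (_ : 0%E = mu (\bigcap_m V m)); last first.
    rewrite (_ : \bigcap_m V m = set0) ?measure0//.
    apply/seteqP; split => // x Vx; have [[i _ Fi] _] := Vx 0%N I.
    by have [_] := Vx i.+1 I; apply; exists i => /=.
  apply: nonincreasing_cvg_mu => //.
  - by rewrite ltey_eq fin_num_measure.
  - exact: bigcap_measurable.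
  - move=> i j ij; apply/subsetPset => x [Ux nx]; split => // -[k /= ki Fk].
    by apply: nx; exists k => //=; exact: leq_trans ki ij.
have VS m : L (V m) = L (F m) + L (V m.+1).
  rewrite -L_add//.
    congr L; apply/seteqP; split => [x [Ux nx]|x [Fx|[Ux nx]]].
    - have [Fx|Fx] := pselect (F m x); [by left|right; split => // -[k /=]].
      by rewrite ltnS leq_eqVlt => /predU1P[->//|km Fk]; apply: nx; exists k.
    - split; first by exists m.
      move=> [k /= km Fk]; move: (tF k m I I) => /(_ (ex_intro _ x (conj Fk Fx))) E.
      by move: km; rewrite E ltnn.
    - split => // -[k /= km Fk]; apply: nx; exists k => //=.
      exact: leq_trans km (leqnSn _).
  by apply/seteqP; split => // x [Fx [_]]; apply; exists m => /=.
have sumE m : (\sum_(0 <= i < m) nu (F i))%E = (L U - L (V m))%:E.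
  elim: m => [|m ih].
    rewrite big_nil (_ : V 0%N = U) ?subrr//; apply/seteqP; split => [x []//|x Ux].
    by split => // -[].
  by rewrite big_nat_recr//= ih nuE// VS -EFinD; congr EFin; ring.
have LV0 : L (V m) @[m --> \oo] --> 0.
  apply: (@squeeze_cvgr _ _ _ _ (cst 0) (fun m => fine (mu (V m)))).
  2: exact: cvg_cst.
  2: exact: fine_cvg V0.
  apply: nearW => m; have [-> /=] := L_le (mV m).
  by rewrite -lee_fin fineK// fin_num_measure.
have LUV : L U - L (V m) @[m --> \oo] --> L U.
  by rewrite -[X in _ --> X]subr0; apply: cvgB => //; exact: cvg_cst.
rewrite nuE//; apply: cvg_EFin; first by apply: nearW => m; rewrite sumE.
by under eq_fun do rewrite /= sumE /=.
Qed.

HB.instance Definition _ :=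
  isMeasure.Build _ _ _ nu nu0 nu_ge0 nu_sigma_additive.

Let nu_finite : fin_num_fun nu.
Proof. by move=> A mA; rewrite nuE. Qed.

HB.instance Definition _ := Measure_isFinite.Build _ _ _ nu nu_finite.

(** Domination by a finite measure upgrades finite additivity to countable additivity; absolute
    continuity then gives a density by Radon-Nikodym. *)
Lemma dominated_additive_density : exists f : T -> R,
  [/\ forall x, 0 <= f x, la.-integrable setT (EFin \o f) &
      forall A, measurable A -> L A = \int[la]_(x in A) f x].
Proof.
pose fnu : {finite_measure set T -> \bar R} := nu.
have dom : fnu `<< la.
  apply: null_dominates_trans mula; apply/null_content_dominatesP => A mA A0.
  rewrite /fnu /= nuE//; have [l0] := L_le mA; rewrite A0 lee_fin => l1.
  by congr EFin; apply/le_anti; rewrite l0 l1.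
pose f := Radon_Nikodym_SigmaFinite.f fnu la.
have f0 := Radon_Nikodym_SigmaFinite.f_ge0 dom.
have ffin := Radon_Nikodym_SigmaFinite.f_fin_num dom.
have fE : EFin \o (fine \o f) = f by apply/funext => x /=; rewrite fineK.
exists (fine \o f); split => [x||A mA].
- exact: fine_ge0.
- by rewrite fE; exact: Radon_Nikodym_SigmaFinite.f_integrable.
- rewrite /Rintegral; under eq_integral do rewrite -[(_ _)%:E]/((EFin \o _) _) fE.
  by rewrite -(Radon_Nikodym_SigmaFinite.f_integral dom mA) /fnu /= nuE.
Qed.

End dominated_additive.

(** Interchange of limits: the error of the approximation is uniform in k, so the limit of the
    approximating sequences may be taken first. *)
Lemma uniform_approx_cvg (R : realType) (A : nat -> R) (B : R) :
  (forall e, 0 < e -> exists (A' : nat -> R) (B' : R),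
    [/\ A' k @[k --> \oo] --> B', forall k, `|A k - A' k| <= e & `|B - B'| <= e]) ->
  A k @[k --> \oo] --> B.
Proof.
move=> AB; apply/cvgrPdist_le => e e0.
have e3 : 0 < e / 3 by rewrite divr_gt0.
have [A' [B' [A'B' AA' BB']]] := AB _ e3.
have /cvgrPdist_le /(_ _ e3) := A'B'; apply: filterS => k kB'.
have -> : B - A k = (B - B') + (B' - A' k) - (A k - A' k) by ring.
rewrite (le_trans (ler_normB _ _))//; have := AA' k.
by have := ler_normD (B - B') (B' - A' k); lra.
Qed.

(** Compactness of the segment gives a cluster point, and a cluster point of an ultrafilter is a
    limit. *)
Lemma ultra_cvg_bounded (R : realType) (U : set_system nat) (a : nat -> R) (C : R) :
  UltraFilter U -> (forall k, 0 <= a k <= C) -> exists l : R, a k @[k --> U] --> l.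
Proof.
move=> UU aC; have /(_ (a @ U)) := @segment_compact R 0 C.
case=> [|l [_ cl]]; first by apply: nearW => k /=; rewrite in_itv /= aC.
exists l => V lV; have [//|Vc] := in_ultra_setVsetC (a @^-1` V) UU.
by have [x [/=]] := cl (~` V) V Vc lV.
Qed.

(** Members of [U] meet every tail, so W m always contains an index beyond the previous choice. *)
Lemma ultra_subsequence (U : set_system nat) (W : nat -> set nat) :
  UltraFilter U -> \oo `<=` U -> (forall m, U (W m)) ->
  exists phi : nat -> nat, {homo phi : i j / (i < j)%N} /\ forall m, W m (phi m).
Proof.
move=> UU ooU UW.
have next (mN : nat * nat) : exists k, (mN.2 < k)%N /\ W mN.1 k.
  have UN : U [set k | (mN.2 < k)%N] by apply: ooU; exists mN.2.+1.
  by have [k [kN Wk]] := @filter_ex _ U _ _ (filterI UN (UW mN.1)); exists k.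
have [f fP] := choice next.
pose phi := fix phi m := if m is m'.+1 then f (m, phi m') else f (0%N, 0%N).
exists phi; split=> [|[|m]]; [|exact: (fP (0%N, 0%N)).2|exact: (fP (m.+1, phi m)).2].
by apply: homo_ltn => [|m]; [exact: ltn_trans|exact: (fP (m.+1, phi m)).1].
Qed.

Section dominated_additive_dist.
Context {d : measure_display} {T : measurableType d} {R : realType}.
Variable mu : {finite_measure set T -> \bar R}.

Definition dominated_additive (L : set T -> R) : Prop :=
  (forall A, measurable A -> 0 <= L A /\ ((L A)%:E <= mu A)%E) /\
  (forall A B, measurable A -> measurable B -> A `&` B = set0 ->
     L (A `|` B) = L A + L B).

Lemma dominated_additive_sub L A B : dominated_additive L -> measurable A -> measurable B ->
  B `<=` A -> L (A `\` B) = L A - L B.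
Proof.
move=> [_ Ladd] mA mB BA; apply/eqP; rewrite eq_sym subr_eq eq_sym -Ladd//.
- by rewrite setUC setDUK.
- exact: measurableD.
- by rewrite setDE -setIA setICl setI0.
Qed.

(** Equicontinuity with respect to the measure of the symmetric difference: the modulus is the same
    for all dominated [L], which lets limits in k pass through limits of sets. *)
Lemma dominated_additive_dist L A B : dominated_additive L ->
  measurable A -> measurable B ->
  `|L A - L B| <= fine (mu (A `\` B)) + fine (mu (B `\` A)).
Proof.
move=> dL mA mB; have [Lle Ladd] := dL.
have mAB := measurableD mA mB; have mBA := measurableD mB mA.
have mI := measurableI _ _ mA mB.
have EA : L (A `\` B) = L A - L (A `&` B).
  have <- : A `\` (A `&` B) = A `\` B by rewrite setDIr setDv set0U.
  by rewrite dominated_additive_sub//; exact: subIsetl.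
have EB : L (B `\` A) = L B - L (A `&` B).
  have <- : B `\` (A `&` B) = B `\` A by rewrite setDIr setDv setU0.
  by rewrite dominated_additive_sub//; exact: subIsetr.
have [a0 a1] := Lle _ mAB; have [b0 b1] := Lle _ mBA.
have {}a1 : L (A `\` B) <= fine (mu (A `\` B)) by rewrite -lee_fin fineK// fin_num_measure.
have {}b1 : L (B `\` A) <= fine (mu (B `\` A)) by rewrite -lee_fin fineK// fin_num_measure.
have -> : L A - L B = L (A `\` B) - L (B `\` A) by rewrite EA EB; ring.
by rewrite (le_trans (ler_normB _ _))// !ger0_norm// lerD.
Qed.

Lemma dominated_additive_restr E : measurable E ->
  dominated_additive (fun A => fine (mu (A `&` E))).
Proof.
move=> mE; split=> [A mA|A B mA mB AB].
  rewrite fine_ge0 ?measure_ge0// fineK; last by apply: fin_num_measure; exact: measurableI.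
  by split => //; apply: le_measure; rewrite ?inE//; exact: measurableI.
rewrite setIUl measureU//; [|exact: measurableI|exact: measurableI|].
  by rewrite fineD//; apply: fin_num_measure; exact: measurableI.
by rewrite setIACA AB set0I.
Qed.

Lemma dominated_additive_cvg (U : set_system nat) (F : nat -> set T -> R) L :
  ProperFilter U -> (forall k, dominated_additive (F k)) ->
  (forall A, measurable A -> F k A @[k --> U] --> L A) -> dominated_additive L.
Proof.
move=> PU dF FL; split=> [A mA|A B mA mB AB].
  have muA : mu A \is a fin_num by exact: fin_num_measure.
  split.
    by apply: (cvgr_to_ge (FL A mA)); apply: nearW => k; have [/(_ A mA)[]] := dF k.
  rewrite -(fineK muA) lee_fin; apply: (cvgr_to_le (FL A mA)); apply: nearW => k.
  by rewrite -lee_fin fineK//; have [/(_ A mA)[]] := dF k.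
have FLU := FL _ (measurableU _ _ mA mB).
apply: (cvg_unique (@Rhausdorff R) FLU).
rewrite (_ : (fun k => F k (A `|` B)) = (fun k => F k A + F k B)).
  by apply: cvgD; exact: FL.
by apply/funext => k; have [_ /(_ A B mA mB AB)] := dF k.
Qed.

End dominated_additive_dist.

Section weak_limit_sets.
Context {d : measure_display} {T : measurableType d} {R : realType}.
Variables (mu : {finite_measure set T -> \bar R}) (J : countType) (G : J -> set T).
Hypotheses (mG : forall l, measurable (G l)) (GT : exists l, G l = setT).
Hypothesis GI : forall l l', exists l'', G l'' = G l `&` G l'.
Hypothesis Gdense : forall B, measurable B -> exists B',
  [/\ <<s range G >> B', mu (B `\` B') = 0%E & mu (B' `\` B) = 0%E].

(** The sets on which convergence holds form a lambda-system: proper differences by additivity,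
    increasing unions by the common modulus of [dominated_additive_dist]. It therefore contains the
    generated sigma-algebra, and dominated functionals do not distinguish sets that differ by null
    sets. *)
Lemma cvg_dominated_additive (F : nat -> set T -> R) L :
  (forall k, dominated_additive mu (F k)) -> dominated_additive mu L ->
  (forall l, F k (G l) @[k --> \oo] --> L (G l)) ->
  forall A, measurable A -> F k A @[k --> \oo] --> L A.
Proof.
move=> dF dL FG.
have GmS B : <<s range G >> B -> measurable B.
  move=> sB; apply: (smallest_sub _ _ sB); first exact: sigma_algebra_measurable.
  by move=> _ [l _ <-].
pose H := [set B | measurable B /\ F k B @[k --> \oo] --> L B].
have sH : <<s range G >> `<=` H.
  apply: lambda_system_subset.
  - by move=> _ _ [l _ <-] [l' _ <-]; have [l'' <-] := GI l l'; exists l''.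
  - split => //.
    + by split => //; have [l <-] := GT; exact: FG.
    + move=> A B BA [mA FA] [mB FB]; split; first exact: measurableD.
      rewrite (dominated_additive_sub dL)//.
      rewrite (_ : (fun k => _) = (fun k => F k A - F k B)); first exact: cvgB.
      by apply/funext => k; exact: (dominated_additive_sub (dF k)).
    + move=> S ndS HS; have mS k : measurable (S k) by have [] := HS k.
      have mU : measurable (\bigcup_k S k) by exact: bigcupT_measurable.
      split => //; apply: uniform_approx_cvg => e e0.
      have muS : mu (S k) @[k --> \oo] --> (fine (mu (\bigcup_k S k)))%:E.
        by rewrite fineK ?fin_num_measure//; exact: nondecreasing_cvg_mu.
      have fmuS : fine (mu (S k)) @[k --> \oo] --> fine (mu (\bigcup_k S k)).
        exact: fine_cvg muS.
      have /cvgrPdist_le /(_ _ e0) [M _ /(_ M (leqnn M)) /= Me] := fmuS _.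
      have SU : S M `<=` \bigcup_k S k by move=> x SMx; exists M.
      have dist L' : dominated_additive mu L' -> `|L' (\bigcup_k S k) - L' (S M)| <= e.
        move=> dL'; apply: le_trans (dominated_additive_dist dL' mU (mS M)) _.
        rewrite (_ : S M `\` _ = set0) ?measure0 ?addr0; last by rewrite setD_eq0.
        rewrite measureD//; last by rewrite ltey_eq fin_num_measure.
        rewrite setIidr// fineB ?fin_num_measure//.
        exact: le_trans (ler_norm _) Me.
      exists (fun k => F k (S M)), (L (S M)); split; first by have [] := HS M.
        by move=> k; exact: dist.
      exact: dist.
  - by move=> _ [l _ <-]; split => //; exact: mG.
  - by [].
move=> B mB; have [B' [sB' BB' B'B]] := Gdense mB.
have [mB' FB'] := sH _ sB'.
have eqL L' : dominated_additive mu L' -> L' B = L' B'.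
  move=> dL'; apply/eqP; rewrite -subr_eq0 -normr_le0.
  by have := dominated_additive_dist dL' mB mB'; rewrite BB' B'B addr0.
rewrite (eqL L dL) (_ : (fun k => F k B) = (fun k => F k B'))//.
by apply/funext => k; exact: eqL.
Qed.

Lemma weak_limit_sets (la : {sigma_finite_measure set T -> \bar R})
    (I : countType) (E : nat -> I -> set T) :
  mu `<< la -> (forall k i, measurable (E k i)) ->
  exists (phi : nat -> nat) (f : I -> T -> R),
  [/\ {homo phi : i j / (i < j)%N}, forall i x, 0 <= f i x,
      forall i, la.-integrable setT (EFin \o f i) &
      forall i A, measurable A ->
        fine (mu (A `&` E (phi k) i)) @[k --> \oo] --> \int[la]_(x in A) f i x].
Proof.
move=> mula mE; have [U [UU ooU]] := @ultraFilterLemma _ \oo _.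
have lim_ex (iA : I * set T) : exists l : R, measurable iA.2 ->
    fine (mu (iA.2 `&` E k iA.1)) @[k --> U] --> l.
  case: iA => i A /=; have [mA|nA] := pselect (measurable A); last by exists 0.
  have [k|l lP] := @ultra_cvg_bounded R U
      (fun k => fine (mu (A `&` E k i))) (fine (mu setT)) UU; last by exists l.
  have [/(_ A mA)[-> le] _] := dominated_additive_restr mu (mE k i).
  rewrite -lee_fin [leRHS]fineK ?fin_num_measure//= (le_trans le)//.
  by apply: le_measure; rewrite ?inE.
have [L LP] := choice lim_ex.
have dL i : dominated_additive mu (fun A => L (i, A)).
  apply: (@dominated_additive_cvg _ _ _ mu U (fun k A => fine (mu (A `&` E k i)))).
  - by move=> k; exact: dominated_additive_restr.
  - by move=> A mA; exact: (LP (i, A) mA).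
have [f fP] := choice (fun i => dominated_additive_density mula (dL i).1 (dL i).2).
(* The indices k that are accurate to within 1 / (m + 1) for the pairs numbered 0 to m; as a finite
   intersection of members of [U], this set belongs to [U]. *)
pose W m := [set k | forall q : 'I_m.+1,
  if unpickle q is Some il then
    is_true (`|L (il.1, G il.2) - fine (mu (G il.2 `&` E k il.1))| <= m.+1%:R^-1)
  else True].
have [|phi [phi_nd phiW]] := @ultra_subsequence U W UU ooU.
  move=> m; apply: filter_forall => q; case: unpickle => [[i l]|]; last exact: filterT.
  have /cvgrPdist_le := LP (i, G l) (mG l); apply.
  by rewrite invr_gt0.
exists phi, f; split => // [i x|i|i A mA].
- by have [] := fP i.
- by have [] := fP i.
- have [_ _ fE] := fP i; rewrite -(fE A mA).
  apply: (@cvg_dominated_additive (fun k A => fine (mu (A `&` E (phi k) i)))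
    (fun A => L (i, A))) => //.
    by move=> k; exact: dominated_additive_restr.
  move=> l; apply/cvgrPdist_le => e e0.
  have [M _ Me] : \forall m \near \oo, m.+1%:R^-1 < e :> R.
    exact: near_infty_natSinv_lt (PosNum e0).
  (* From its own number onwards, a pair is among the requirements imposed at stage m. *)
  exists (maxn M (pickle (i, l))) => // m /=; rewrite geq_max => /andP[Mm ilm].
  have := phiW m (@Ordinal m.+1 (pickle (i, l)) ilm); rewrite /= pickleK /=.
  by move=> /le_trans; apply; exact/ltW/Me.
Qed.

End weak_limit_sets.

(** * Lebesgue measure: completeness, Borel hulls, finiteness on boxes *)

Section lebesgue_facts.
Context (R : realType) (n : nat).
Local Notation mu := (lebesgue R n).
Implicit Types (Omega : set 'rV[R]_n).

Lemma lebesgue_complete : measure_is_complete mu.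
Proof. exact: measure_is_complete_caratheodory. Qed.

Lemma lebesgue_sigma_finite : sigma_finite setT mu.
Proof.
exact: (completed_measure_extension_sigma_finite (sigma_finiteT (borel_lebesgue R n))).
Qed.

HB.instance Definition _ := Measure_isSigmaFinite.Build _ _ _
  (@completed_measure_extension _ _ _ (borel_lebesgue R n)) lebesgue_sigma_finite.

(** The measure of B is an infimum over countable Borel covers; intersecting covers with excess at
    most 1 / (k + 1) gives the hull. It shows that Lebesgue sets of finite measure are Borel up to
    null sets. *)
Lemma lebesgue_borel_hull (B : set (lebesgueType R n)) : (mu B < +oo)%E ->
  exists C : set 'rV[R]_n, [/\ measurable C, B `<=` C & mu C = mu B].
Proof.
move=> Boo; have Bfin : mu B \is a fin_num by rewrite ge0_fin_numE ?measure_ge0.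
have hull k : exists C : set 'rV[R]_n,
    [/\ measurable C, B `<=` C & (mu C <= mu B + k.+1%:R^-1%:E)%E].
  have k0 : 0 < k.+1%:R^-1 :> R by rewrite invr_gt0.
  have [_ /= [A [mA BA] <-] lA] := lb_ereal_inf_adherent k0 Bfin.
  have mU : measurable (\bigcup_i A i) by exact: bigcupT_measurable.
  exists (\bigcup_i A i); split => //; apply: le_trans (ltW lA).
  rewrite lebesgueE//; apply: (@measure_sigma_subadditive _ _ _ (borel_lebesgue R n)) => //.
have [C CP] := choice hull.
have mC : measurable (\bigcap_k C k) by apply: bigcapT_measurable => k; have [] := CP k.
exists (\bigcap_k C k); split => //.
  by move=> x Bx k _; have [_ /(_ x Bx)] := CP k.
apply/eqP; rewrite eq_le; apply/andP; split; last first.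
  by apply: le_mu_ext => x Bx k _; have [_ /(_ x Bx)] := CP k.
apply/lee_addgt0Pr => e e0.
have [k _ /(_ k (leqnn k)) ke] : \forall k \near \oo, k.+1%:R^-1 < e :> R.
  exact: near_infty_natSinv_lt (PosNum e0).
have [_ _ Ck] := CP k; apply: le_trans (le_trans Ck _).
  by apply: le_mu_ext => x; apply.
by rewrite leeD2l// lee_fin ltW.
Qed.

#[export] Instance lebesgue_ae_filter :
  @Filter 'rV[R]_n (nbhs (almost_everywhere (lebesgue R n))).
Proof. exact: (@ae_filter_ringOfSetsType _ _ _ (lebesgue R n)). Qed.

End lebesgue_facts.

Lemma measurable_rV_box (R : realType) (n : nat) (M : R) :
  measurable [set v : 'rV[R]_n | forall i, `|v ord0 i| <= M].
Proof.
rewrite (_ : mkset _ = \bigcap_(i : 'I_n) [set v : 'rV[R]_n | `|v ord0 i| <= M]).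
  apply: fin_bigcap_measurable => // i _.
  have : measurable_fun setT (fun v : 'rV[R]_n => `|v ord0 i|).
    apply: measurableT_comp => //; apply: continuous_measurable_mx.
    exact: coord_continuous.
  move=> /(_ measurableT `]-oo, M]%classic); rewrite setTI.
  rewrite (_ : _ @^-1` _ = [set v : 'rV[R]_n | `|v ord0 i| <= M]) => [|]; first by apply.
  by apply/seteqP; split => v /=; rewrite in_itv.
by apply/seteqP; split => [v vM i _|v vM i]; exact: vM.
Qed.

(** By induction on n: under [cons_rV] the box is the product of a segment and a box of one
    dimension less. *)
Lemma borel_lebesgue_box_lty (R : realType) (n : nat) (M : R) :
  (borel_lebesgue R n [set v : 'rV[R]_n | forall i, (`|v ord0 i| <= M)%R] < +oo)%E.
Proof.
elim: n => [|n ih].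
  rewrite /= /dirac indicE; exact: ltry.
have mbox k := @measurable_rV_box R k M.
rewrite /= /lebesgue_cons /pushforward.
rewrite (_ : _ @^-1` _ = `[- M, M]%classic `*` [set v : 'rV[R]_n | forall i, `|v ord0 i| <= M]).
  have fin : @lebesgue_measure R `[- M, M]%classic \is a fin_num.
    by rewrite lebesgue_measure_itv /=; case: ifP.
  by rewrite product_measure1E//; apply: lte_mul_pinfty.
apply/seteqP; split => [[x v] /= xvM|[x v] /= [xM vM] i].
  split.
    have := xvM 0; rewrite /cons_rV /= mxE; case: splitP => // j _.
    by rewrite !mxE !ord1 mulr1n in_itv /= ler_norml.
  move=> i; have := xvM (rshift 1 i); rewrite /cons_rV /= mxE.
  by case: splitP => [[[]]//|j /= /addnI /val_inj <-].
rewrite /cons_rV /= mxE; case: splitP => j _; last exact: vM.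
by rewrite mxE !ord1 mulr1n; move: xM; rewrite in_itv /= ler_norml.
Qed.

(** * Weak limits of subsets of a bounded open set *)

Section lebesgue_weak_limit.
Context (R : realType) (n : nat) (Omega : set 'rV[R]_n).
Hypotheses (openO : open Omega) (bndO : bounded_set Omega).
Local Notation T := (lebesgueType R n).
Local Notation mu := (lebesgue R n).

Lemma measurable_open_lebesgue : measurable (Omega : set T).
Proof. by apply: borel_lebesgue_measurable; exact: open_measurable_mx. Qed.

Lemma lebesgue_bounded_lty : (mu Omega < +oo)%E.
Proof.
have [M [Mr OM]] := bndO.
rewrite lebesgueE; last exact: open_measurable_mx.
have bM := borel_lebesgue_box_lty n (`|M| + 1); apply: le_lt_trans bM.
apply: le_measure; rewrite ?inE.
- exact: open_measurable_mx.
- exact: measurable_rV_box.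
- move=> v Ov i; apply: le_trans (OM (`|M| + 1) _ v Ov).
    by rewrite [leRHS]/Num.Def.normr /= mx_normrE; apply/bigmax_geP; right; exists (ord0, i).
  by have := ler_norm M; lra.
Qed.

Let mO := measurable_open_lebesgue.
Let muO : {finite_measure set T -> \bar R} := mfrestr mO lebesgue_bounded_lty.
Let muOE A : muO A = mu (A `&` Omega). Proof. by []. Qed.
Let la : {sigma_finite_measure set T -> \bar R} :=
  @completed_measure_extension _ _ _ (borel_lebesgue R n).

Lemma lebesgue_weak_limit (I : countType) (E : nat -> I -> set T) :
  (forall k i, measurable (E k i)) -> (forall k i, E k i `<=` Omega) ->
  exists (phi : nat -> nat) (f : I -> T -> R),
  [/\ {homo phi : i j / (i < j)%N}, forall i x, 0 <= f i x,
      forall i, mu.-integrable Omega (EFin \o f i) &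
      forall i (A : set T), measurable A -> A `<=` Omega ->
        fine (mu (A `&` E (phi k) i)) @[k --> \oo] --> \int[mu]_(x in A) f i x].
Proof.
move=> mE EO.
(* Finite intersections of rational balls, indexed by lists so that intersecting means
   concatenating: a countable pi-system that generates the Borel sets. *)
pose G (l : seq nat) : set T := [set v | forall i, i \in l -> @rational_ball R 1 n i v].
have Gcons i l : G (i :: l) = @rational_ball R 1 n i `&` G l.
  apply/seteqP; split => [v vG|v [vi vl] j].
    by split=> [|j jl]; apply: vG; rewrite inE ?eqxx// jl orbT.
  by rewrite inE => /predU1P[->//|]; exact: vl.
have GT : G [::] = setT by apply/seteqP; split.
have mG l : measurable (G l).
  elim: l => [|i l ih]; first by rewrite GT.
  rewrite Gcons; apply: measurableI => //; apply: borel_lebesgue_measurable.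
  exact: measurable_rational_ball.
have GI l l' : exists l'', G l'' = G l `&` G l'.
  exists (l ++ l'); elim: l => [|i l ih]; first by rewrite GT setTI.
  by rewrite cat_cons !Gcons ih setIA.
have Gborel (B : set 'rV[R]_n) : measurable B -> <<s range G >> B.
  apply: smallest_sub; first exact: smallest_sigma_algebra.
  move=> U oU; rewrite (open_rational_balls oU) bigcup_mkcond.
  have [G0 _ GU] := smallest_sigma_algebra setT (range G).
  apply: GU => i; case: ifPn => // _; apply: sub_sigma_algebra.
  by exists [:: i] => //; rewrite Gcons GT setIT.
(* Inside Omega, B is replaced by a Borel hull of its trace on Omega, which has finite measure. *)
have Gdense (B : set T) : measurable B -> exists B' : set T,
    [/\ <<s range G >> B', muO (B `\` B') = 0%E & muO (B' `\` B) = 0%E].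
  move=> mB; have mBO := measurableI _ _ mB mO.
  have BOoo : (mu (B `&` Omega) < +oo)%E.
    apply: le_lt_trans lebesgue_bounded_lty.
    by apply: le_measure; rewrite ?inE//; exact: mO.
  have [C [mC BC muC]] := lebesgue_borel_hull BOoo.
  have mC' : measurable (C : set T) by exact: borel_lebesgue_measurable.
  exists C; split; first exact: Gborel.
    rewrite muOE (_ : _ `&` _ = set0) ?measure0//.
    by apply/seteqP; split => // x [[Bx nC] Ox]; apply: nC; apply: BC.
  have C0 : mu (C `\` (B `&` Omega)) = 0%E.
    have Coo : (mu C < +oo)%E by rewrite muC.
    have -> : mu (C `\` (B `&` Omega)) = (mu C - mu (C `&` (B `&` Omega)))%E.
      exact: measureD.
    by rewrite setIidr// muC subee// ge0_fin_numE ?measure_ge0.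
  apply/eqP; rewrite -measure_le0 -C0.
  change (mu ((C `\` B) `&` Omega) <= mu (C `\` (B `&` Omega)))%E.
  apply: le_measure; rewrite ?inE; [|exact: measurableD|].
    by apply: measurableI => //; exact: measurableD.
  by move=> x [[Cx nB] Ox]; split => // -[].
have muOla : muO `<< la.
  apply/null_content_dominatesP => A mA A0; apply/eqP; rewrite -measure_le0 -[leRHS]A0.
  by apply: le_measure; rewrite ?inE//; exact: measurableI.
have [phi [f [phi_nd f0 jf fE]]] :=
  weak_limit_sets mG (ex_intro _ [::] GT) GI Gdense muOla mE.
exists phi, f; split => // [i|i A mA AO].
  by apply: integrableS (jf i) => //; exact: mO.
have := fE i A mA; apply: cvg_trans; apply: near_eq_cvg; apply: nearW => k /=.
rewrite muOE setIidl//.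
exact: subset_trans (@subIsetl _ _ _) AO.
Qed.

End lebesgue_weak_limit.

(** * From convergence on sets to convergence against bounded functions *)

Section weak_limit_fun.
Context {d : measure_display} {T : measurableType d} {R : realType}.
Variables (mu : {measure set T -> \bar R}) (D : set T).
Hypotheses (mD : measurable D) (muD : (mu D < +oo)%E).
Implicit Types (f g : T -> R).

Definition ess_bounded g : Prop :=
  exists C : R, {ae mu, forall x, D x -> `|g x| <= C}.

Lemma simple_approx g (C e : R) : measurable_fun D g -> 0 < e ->
  exists N (c : 'I_N -> R) (A : 'I_N -> set T),
  [/\ forall j, measurable (A j), forall j, A j `<=` D &
      forall x, D x -> `|g x| <= C ->
        `|g x - \sum_(j < N) c j * \1_(A j) x| <= e].
Proof.
move=> mg e0; pose q x := (g x + C) / e.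
(* The number of half-open intervals of length e, starting at - C, that cover [- C, C]; the
   successor is needed for the value C itself. *)
pose N := (Num.truncn (2 * C / e)).+1.
exists N, (fun j => j%:R * e - C),
  (fun j => D `&` g @^-1` `[j%:R * e - C, j.+1%:R * e - C[%classic).
split=> [j|j|x Dx gC]; [exact: mg|exact: subIsetl|].
have [gC1 gC2] : - C <= g x /\ g x <= C by move: gC; rewrite ler_norml => /andP[].
have q0 : 0 <= q x by rewrite divr_ge0 ?(ltW e0)//; lra.
have /andP[q1 q2] := truncn_itv q0.
have qN : (Num.truncn (q x) < N)%N.
  by rewrite ltnS; apply: le_truncn; rewrite ler_pM2r ?invr_gt0//; lra.
have qe : q x * e = g x + C by rewrite /q divfK// gt_eqF.
have inj (j : 'I_N) : (g @^-1` `[j%:R * e - C, j.+1%:R * e - C[%classic) x ->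
    j = Num.truncn (q x) :> nat.
  rewrite /= in_itv /= => /andP[j1 j2]; apply/esym/eqP.
  rewrite truncn_eq//; apply/andP; split.
    by rewrite -(ler_pM2r e0) qe; lra.
  by rewrite -(ltr_pM2r e0) qe; lra.
rewrite (bigD1 (Ordinal qN))//= indicE mem_set; last first.
  split => //; rewrite /= in_itv/=; move: q1 q2; rewrite -(ler_pM2r e0) -(ltr_pM2r e0) qe.
  by move=> ? ?; apply/andP; split; lra.
rewrite mulr1 big1 ?addr0 => [|j jq]; last first.
  rewrite indicE memNset ?mulr0// => -[_ /inj jE]; move/eqP: jq; apply.
  exact/val_inj.
move: q1 q2; rewrite -(ler_pM2r e0) -(ltr_pM2r e0) qe -natr1 => ? ?.
by rewrite ger0_norm; lra.
Qed.

Lemma integrable_ess_bounded f g : mu.-integrable D (EFin \o f) ->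
  measurable_fun D g -> ess_bounded g ->
  mu.-integrable D (EFin \o (fun x => f x * g x)).
Proof.
move=> jf mg [C gC].
have jCf := integrable_cstM mD C (integrable_norm jf).
apply: (ae_le_integrable mD _ jCf).
  by apply: measurable_funM => //; exact: integrable_measurable_fun jf.
by apply: filterS gC => x gC Dx; rewrite normrM mulrC ler_wpM2r// gC.
Qed.

Lemma integrable_indic_subset E : measurable E -> mu.-integrable D (EFin \o \1_E).
Proof.
move=> mE; apply: (bounded_integrable mD (C := 1)) => // x _.
by rewrite indicE; case: (_ \in _); rewrite ?normr1 ?normr0.
Qed.

Lemma Rintegral_indic_subset E : measurable E -> E `<=` D ->
  \int[mu]_(x in D) \1_E x = fine (mu E).
Proof. by move=> mE ED; rewrite /Rintegral integral_indic// setIidl. Qed.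

Lemma weak_limit_fun (E : nat -> set T) f g :
  (forall k, measurable (E k)) -> (forall k, E k `<=` D) ->
  mu.-integrable D (EFin \o f) ->
  (forall A, measurable A -> A `<=` D ->
     fine (mu (A `&` E k)) @[k --> \oo] --> \int[mu]_(x in A) f x) ->
  measurable_fun D g -> ess_bounded g ->
  \int[mu]_(x in D) (\1_(E k) x * g x) @[k --> \oo] -->
  \int[mu]_(x in D) (f x * g x).
Proof.
move=> mE ED jf Ef mg bg; have [C gC] := bg.
apply: uniform_approx_cvg => e e0.
(* [K] dominates the L^1 norms of f and of the indicator functions of all E k, so replacing g by a
   simple function within e / K costs at most e in every integral. *)
pose K := 1 + fine (mu D) + \int[mu]_(x in D) `|f x|.
have nf0 : 0 <= \int[mu]_(x in D) `|f x| by apply: Rintegral_ge0.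
have mD0 : 0 <= fine (mu D) by rewrite fine_ge0.
have K0 : 0 < K by rewrite /K; lra.
have [N [c [A [mA AD gA]]]] := simple_approx C mg (divr_gt0 e0 K0).
pose g' x := \sum_(j < N) c j * \1_(A j) x.
have e'K : e / K * K = e by rewrite divfK// gt_eqF.
have e'0 : 0 <= e / K by rewrite ltW// divr_gt0.
have prodE (h : T -> R) : mu.-integrable D (EFin \o h) ->
  [/\ mu.-integrable D (EFin \o (fun x => h x * g' x)),
      \int[mu]_(x in D) (h x * g' x) = \sum_(j < N) c j * \int[mu]_(x in A j) h x &
      `|\int[mu]_(x in D) (h x * g x) - \int[mu]_(x in D) (h x * g' x)| <=
        e / K * \int[mu]_(x in D) `|h x|].
  move=> jh.
  have hj j : mu.-integrable D (EFin \o (fun x => h x * \1_(A j) x)).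
    apply: integrable_ess_bounded => //.
    exists 1; apply: aeW => x _.
    by rewrite indicE; case: (_ \in _); rewrite ?normr1 ?normr0.
  have hjE j : \int[mu]_(x in D) (h x * \1_(A j) x) = \int[mu]_(x in A j) h x.
    rewrite -[in RHS](setIidr (AD j)) Rintegral_mkcondr; apply: eq_Rintegral => x _.
    by rewrite patchE indicE; case: ifPn => _; rewrite ?mulr1 ?mulr0.
  have g'E : (fun x => h x * g' x) = (fun x => \sum_(j < N) c j * (h x * \1_(A j) x)).
    by apply/funext => x; rewrite mulr_sumr; apply: eq_bigr => j _; ring.
  have jg' : mu.-integrable D (EFin \o (fun x => h x * g' x)).
    rewrite g'E (_ : _ \o _ = (fun x => \sum_(j < N) (c j * (h x * \1_(A j) x))%:E)%E).
      by apply: integrable_sum => // j _; exact: (integrable_cstM mD (c j) (hj j)).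
    by apply/funext => x /=; rewrite sumEFin.
  split => //.
    rewrite g'E Rintegral_sum// => [|j]; last exact: integrable_cstM.
    by apply: eq_bigr => j _; rewrite Rintegral_cstM// hjE.
  rewrite -Rintegral_cstM; [|exact: mD|exact: integrable_norm].
  apply: dist_Rintegral_le => //.
  - exact: integrable_ess_bounded.
  - exact/integrable_cstM/integrable_norm.
  - apply: filterS gC => x gC Dx; rewrite -mulrBr normrM mulrC ler_wpM2r//.
    by apply: gA => //; exact: gC.
have jE k := integrable_indic_subset (mE k).
exists (fun k => \int[mu]_(x in D) (\1_(E k) x * g' x)), (\int[mu]_(x in D) (f x * g' x)).
split.
- have [_ -> _] := prodE f jf.
  rewrite (_ : (fun k => _) = (fun k => \sum_(j < N) c j * fine (mu (A j `&` E k)))).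
    apply: cvg_big => [|j _]; first exact: add_continuous.
    by apply: cvgM; [exact: cvg_cst|exact: Ef].
  apply/funext => k; have [_ -> _] := prodE _ (jE k).
  apply: eq_bigr => j _; congr (_ * _).
  by rewrite /Rintegral integral_indic// setIC.
- move=> k; have [_ _] := prodE _ (jE k); move=> /le_trans; apply.
  rewrite -[leRHS]e'K ler_wpM2l//.
  rewrite (_ : \int[mu]_(x in D) `|_| = \int[mu]_(x in D) \1_(E k) x).
    rewrite Rintegral_indic_subset//.
    have : fine (mu (E k)) <= fine (mu D).
      apply: fine_le; rewrite ?ge0_fin_numE ?measure_ge0//.
        by apply: le_lt_trans muD; apply: le_measure; rewrite ?inE.
      by apply: le_measure; rewrite ?inE.
    by rewrite /K; lra.
  by apply: eq_Rintegral => x _; rewrite ger0_norm.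
- have [_ _] := prodE f jf; move=> /le_trans; apply.
  by rewrite -[leRHS]e'K ler_wpM2l// /K; lra.
Qed.

(** The upper limit of the sequence is measurable and agrees with [f] almost everywhere;
    completeness does the rest. *)
Lemma ae_cvg_measurable (h : nat -> T -> R) f : measure_is_complete mu ->
  (forall m, measurable_fun D (h m)) ->
  {ae mu, forall x, D x -> h m x @[m --> \oo] --> f x} -> measurable_fun D f.
Proof.
move=> cmu mh hf; apply/measurable_EFinP.
apply: (ae_measurable_fun cmu (f := fun x => limn_esup (fun m => (h m x)%:E))).
  apply: filterS hf => x hf Dx; rewrite is_cvg_limn_esupE.
    by apply/cvg_lim => //; apply: cvg_EFin; [exact: nearW|exact: hf].
  by apply/cvg_ex; exists (f x)%:E; apply: cvg_EFin; [exact: nearW|exact: hf].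
by apply: measurable_fun_limn_esup => m; exact/measurable_EFinP.
Qed.

End weak_limit_fun.

(** * The limiting family of measures *)

Section young_limit.
Context (R : realType) (n : nat) (Omega : set 'rV[R]_n).
Hypotheses (n0 : (0 < n)%N) (openO : open Omega) (bndO : bounded_set Omega).
Local Notation T := (lebesgueType R n).
Local Notation mu := (lebesgue R n).
Local Notation mcode := (bcode (@rational_ball R n n)).
Local Notation mcell := (bcell (@rational_ball R n n)).
Variable Y : nat -> T -> 'M[R]_n.
Hypothesis mY : forall k, measurable_fun (Omega : set T) (Y k).

Let mO := measurable_open_lebesgue openO.
Let Ooo := lebesgue_bounded_lty openO bndO.

Let E (k : nat) (u : seq bool) : set T := Omega `&` Y k @^-1` mcell u.

Let mE k u : measurable (E k u).
Proof. by apply: mY => //; apply: measurable_cell => i; exact: measurable_rational_ball. Qed.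

(** The sets E k u satisfy the analogue of each axiom of [cell_weights]: the empty code gives Omega,
    a cell is the disjoint union of its two children, empty cells give empty sets. These relations
    pass to the densities, and since there are countably many codes the exceptional null sets can be
    united. *)
Lemma young_limit_weights : exists (phi : nat -> nat) (f : seq bool -> T -> R),
  [/\ {homo phi : i j / (i < j)%N},
      {ae mu, forall x, Omega x -> @cell_weights R n (f ^~ x)},
      forall u, mu.-integrable Omega (EFin \o f u) &
      forall u (g : T -> R), measurable_fun (Omega : set T) g -> ess_bounded mu Omega g ->
        \int[mu]_(x in Omega) (\1_(E (phi k) u) x * g x) @[k --> \oo] -->
        \int[mu]_(x in Omega) (f u x * g x)].
Proof.
have EO k u : E k u `<=` Omega by exact: subIsetl.
have [phi [f [phi_nd f0 jf fE]]] := lebesgue_weak_limit openO bndO mE EO.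
exists phi, f; split => //; last first.
  move=> u g mg bg; apply: weak_limit_fun => //.
  by move=> A mA AO; exact: fE.
have fin_int u (A : set T) : measurable A -> A `<=` Omega ->
    (\int[mu]_(x in A) (f u x)%:E)%E = (\int[mu]_(x in A) f u x)%:E.
  move=> mA AO; rewrite fineK//; apply: (integrable_fin_num mA).
  exact: (integrableS mO mA AO (jf u)).
(* Identities between densities are read off from integrals over measurable subsets of Omega. *)
have ae_eqf u (h : T -> R) : mu.-integrable Omega (EFin \o h) ->
    (forall A : set T, measurable A -> A `<=` Omega ->
       \int[mu]_(x in A) f u x = \int[mu]_(x in A) h x) ->
    {ae mu, forall x, Omega x -> f u x = h x}.
  move=> jh fh.
  have := @integral_ae_eq _ _ _ mu Omega mO (EFin \o h) (EFin \o f u) (jf u) (measurable_int _ jh).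
  have H : forall A : set T, A `<=` Omega -> measurable A ->
      (\int[mu]_(x in A) (EFin \o f u) x = \int[mu]_(x in A) (EFin \o h) x)%E.
    move=> A AO mA; rewrite fin_int// fh// fineK//; apply: (integrable_fin_num mA).
    exact: (integrableS mO mA AO jh).
  by move=> /(_ H); apply: filterS => x fhx /fhx [].
have W1 : {ae mu, forall x, Omega x -> f [::] x = 1}.
  apply: (ae_eqf [::] (cst 1)).
    apply: (bounded_integrable mO (C := 1)) => // x _.
    by rewrite normr1.
  move=> A mA AO; rewrite Rintegral_cst//= mul1r.
  apply: (cvg_unique (@Rhausdorff R) (fE [::] A mA AO)).
  rewrite (_ : (fun k => _) = cst (fine (mu A))); first exact: cvg_cst.
  apply/funext => k; congr (fine (mu _)).
  by apply/seteqP; split => [x []//|x Ax]; split => //; split; [exact: AO|].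
have W2 : {ae mu, forall x, forall u, Omega x -> f u x = f (true :: u) x + f (false :: u) x}.
  apply: ae_forall_count => u.
  have jD : mu.-integrable Omega (EFin \o (fun x => f (true :: u) x + f (false :: u) x)).
    rewrite (_ : _ \o _ = (EFin \o f (true :: u)) \+ (EFin \o f (false :: u)))%E//.
    exact: integrableD.
  apply: (ae_eqf u _ jD) => A mA AO.
  rewrite RintegralD//; [|exact: (integrableS mO mA AO (jf _))..].
  apply: (cvg_unique (@Rhausdorff R) (fE u A mA AO)).
  rewrite (_ : (fun k => _) = (fun k => fine (mu (A `&` E (phi k) (true :: u))) +
      fine (mu (A `&` E (phi k) (false :: u))))).
    by apply: cvgD; exact: fE.
  apply/funext => k; have mAE b := measurableI _ _ mA (mE (phi k) (b :: u)).
  have AEfin b : mu (A `&` E (phi k) (b :: u)) \is a fin_num.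
    rewrite ge0_fin_numE ?measure_ge0//; apply: le_lt_trans Ooo.
    by apply: le_measure; rewrite ?inE// => x [/AO].
  rewrite -fineD//; congr fine.
  rewrite -[RHS]measureU//; first congr (mu _).
  - rewrite /E !cell_cons !preimage_setI -setIUr -setIUr -setIUr.
    by rewrite preimage_setC setUv setIT.
  - rewrite /E !cell_cons; apply/seteqP; split => // x.
    by move=> [[_ [_ [_ Bx]]] [_ [_ [_ /(_ Bx)]]]].
have W3 : {ae mu, forall x, forall u, Omega x -> mcell u = set0 -> f u x = 0}.
  apply: ae_forall_count => u.
  have [u0|u0] := pselect (mcell u = set0); last by apply: aeW => x _ /u0.
  have := ae_eqf u (cst 0); rewrite (_ : EFin \o _ = cst 0%E)//.
  move=> /(_ (integrable0 _ _)) H.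
  have ae0 : {ae mu, forall x, Omega x -> f u x = 0}.
    apply: H => A mA AO; rewrite Rintegral_cst//= mul0r.
    apply: (cvg_unique (@Rhausdorff R) (fE u A mA AO)).
    rewrite (_ : (fun k => _) = cst 0); first exact: cvg_cst.
    apply/funext => k; rewrite /E u0 preimage_set0 !setI0.
    by rewrite measure0.
  by apply: filterS ae0 => x fx Ox _; exact: fx.
apply: filterS3 W1 W2 W3 => x fx1 fx2 fx3 Ox; split => [|u|u|u u0].
- exact: fx1.
- exact: f0.
- exact: fx2.
- exact: fx3.
Qed.

Lemma young_limit : exists (phi : nat -> nat) (nu : 'rV[R]_n -> probability 'M[R]_n R),
  {homo phi : i j / (i < j)%N} /\
  forall w, test_fun w ->
    measurable_fun (Omega : set T) (fun x => \int[nu x]_s w s) /\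
    forall g : T -> R, measurable_fun (Omega : set T) g -> ess_bounded mu Omega g ->
      \int[mu]_(x in Omega) (w (Y (phi k) x) * g x) @[k --> \oo] -->
      \int[mu]_(x in Omega) (\int[nu x]_s w s * g x).
Proof.
have [phi [f [phi_nd fw jf fE]]] := young_limit_weights.
have nu_ex (x : 'rV[R]_n) : exists nu : probability 'M[R]_n R,
    @cell_weights R n (f ^~ x) ->
    forall (w : 'M[R]_n -> R) (e : R) (J : nat), test_fun w -> 0 < e ->
    (forall r s, mcode J r = mcode J s -> `|w r - w s| <= e) ->
    `|\int[nu]_s w s - \sum_(u : J.-tuple bool) w (cell_point u) * f u x| <= e.
  have [/(code_measure n0)[nu nuP]|nw] := pselect (@cell_weights R n (f ^~ x)).
    by exists nu => _.
  (* Where the weights are inconsistent any probability measure will do; inside Omega such x form a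
     null set. *)
  by exists point => /nw.
have [nu nuP] := choice nu_ex.
exists phi, nu; split; first exact: phi_nd.
move=> w tw.
pose W J x := \sum_(u : J.-tuple bool) w (cell_point u) * f u x.
have WE e J : 0 < e -> (forall r s, mcode J r = mcode J s -> `|w r - w s| <= e) ->
    {ae mu, forall x, Omega x -> `|\int[nu x]_s w s - W J x| <= e}.
  by move=> e0 osc; apply: filterS fw => x fx Ox; exact: nuP (fx Ox) _ _ _ tw e0 osc.
have mW J : measurable_fun (Omega : set T) (W J).
  apply: measurable_sum => u; apply: measurable_funM => //.
  exact: integrable_measurable_fun (jf u).
have mnu : measurable_fun (Omega : set T) (fun x => \int[nu x]_s w s).
  have e0 m : 0 < m.+1%:R^-1 :> R by rewrite invr_gt0.
  have [J JP] := choice (fun m => code_test_fun tw (e0 m)).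
  apply: (ae_cvg_measurable (@lebesgue_complete R n) (fun m => mW (J m))).
  have := ae_foralln (fun m => WE _ _ (e0 m) (JP m)).
  apply: filterS => x WJ Ox; apply/cvgrPdist_le => e e1.
  have [M _ Me] : \forall m \near \oo, m.+1%:R^-1 < e :> R.
    exact: near_infty_natSinv_lt (PosNum e1).
  by exists M => // m /Me /ltW; apply: le_trans; exact: WJ.
split; first exact: mnu.
move=> g mg bg.
have [C C0 wC] := test_fun_bounded tw.
have nuC x : `|\int[nu x]_s w s| <= C.
  have P1 : (nu x setT < +oo)%E by rewrite probability_setT ltry.
  have jw : (nu x).-integrable setT (EFin \o w).
    by apply: (bounded_integrable measurableT (C := C)) => //; exact: measurable_test_fun.
  apply: le_trans (le_normr_Rintegral measurableT jw) _.
  rewrite -[leRHS](Rintegral_prob_cst (nu x)); apply: ae_le_Rintegral => //.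
  - exact: integrable_norm.
  - exact: finite_measure_integrable_cst.
  - by apply: aeW => s _; exact: wC.
have jg : mu.-integrable Omega (EFin \o g).
  rewrite (_ : g = (fun x => 1 * g x)); last by apply/funext => x; rewrite mul1r.
  apply: (integrable_ess_bounded mO (f := cst 1)) => //.
  by apply: (bounded_integrable mO (C := 1)) => // x _; rewrite normr1.
have jbg (h : T -> R) : measurable_fun (Omega : set T) h -> (forall x, `|h x| <= C) ->
    mu.-integrable Omega (EFin \o (fun x => h x * g x)).
  move=> mh hC; apply: integrable_ess_bounded => //.
  exact: (bounded_integrable mO (C := C)).
have mwY k : measurable_fun (Omega : set T) (fun x => w (Y k x)).
  by apply: measurableT_comp (measurable_test_fun tw) _; exact: mY.
apply: uniform_approx_cvg => e e0.
pose K := 1 + \int[mu]_(x in Omega) `|g x|.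
have K0 : 0 < K by rewrite /K ltr_wpDr// Rintegral_ge0.
have e'0 : 0 < e / K by rewrite divr_gt0.
have e'K : e / K * \int[mu]_(x in Omega) `|g x| <= e.
  rewrite -[leRHS](@divfK _ K) ?gt_eqF// ler_wpM2l ?(ltW e'0)// /K; lra.
have [J JP] := code_test_fun tw e'0.
(* Both sides are replaced by finite sums over codes of length J, up to e / K: the values of w along
   the sequence by [V], its integrals against nu_x by [W]. Between [V] and [W] there remains the
   weak convergence of finitely many indicator functions. *)
pose V k x : R := \sum_(u : J.-tuple bool) w (cell_point u) * \1_(E (phi k) u) x.
have VE k x : Omega x -> V k x = w (cell_point (mcode J (Y (phi k) x))).
  move=> Ox; have sz : size (mcode J (Y (phi k) x)) == J by rewrite size_code.
  rewrite /V (bigD1 (Tuple sz))//= indicE mem_set/=; last first.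
    by split => //; exact: cell_code.
  rewrite mulr1 big1 ?addr0// => u uJ; rewrite indicE memNset ?mulr0// => -[_].
  rewrite /= /bcell /= size_tuple => uE; move/eqP: uJ; apply.
  by apply: val_inj => /=; rewrite uE.
have sumg (F : seq bool -> T -> R) :
    (forall u, mu.-integrable Omega (EFin \o (fun x => F u x * g x))) ->
    mu.-integrable Omega (EFin \o (fun x =>
      (\sum_(u : J.-tuple bool) w (cell_point u) * F u x) * g x)) /\
    \int[mu]_(x in Omega) ((\sum_(u : J.-tuple bool) w (cell_point u) * F u x) * g x) =
    \sum_(u : J.-tuple bool) w (cell_point u) * \int[mu]_(x in Omega) (F u x * g x).
  move=> jF.
  have FE : (fun x => (\sum_(u : J.-tuple bool) w (cell_point u) * F u x) * g x) =
      (fun x => \sum_(u : J.-tuple bool) w (cell_point u) * (F u x * g x)).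
    by apply/funext => x; rewrite mulr_suml; apply: eq_bigr => u _; rewrite mulrA.
  rewrite FE; split.
    rewrite (_ : _ \o _ = (fun x =>
      \sum_(u : J.-tuple bool) (w (cell_point u) * (F u x * g x))%:E)%E).
      by apply: integrable_sum => // u _; exact: (integrable_cstM mO _ (jF u)).
    by apply/funext => x /=; rewrite sumEFin.
  rewrite Rintegral_sum// => [|u]; last exact: integrable_cstM.
  by apply: eq_bigr => u _; rewrite Rintegral_cstM.
have jind k u : mu.-integrable Omega (EFin \o (fun x => \1_(E (phi k) u) x * g x)).
  apply: integrable_ess_bounded => //; apply: integrable_indic_subset => //.
have jfg u : mu.-integrable Omega (EFin \o (fun x => f u x * g x)).
  exact: integrable_ess_bounded.
exists (fun k => \int[mu]_(x in Omega) (V k x * g x)), (\int[mu]_(x in Omega) (W J x * g x)).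
split.
- have [_ ->] := sumg f jfg.
  rewrite (_ : (fun k => _) = (fun k => \sum_(u : J.-tuple bool)
      w (cell_point u) * \int[mu]_(x in Omega) (\1_(E (phi k) u) x * g x))).
    apply: cvg_big => [|u _]; first exact: add_continuous.
    by apply: cvgM; [exact: cvg_cst|exact: fE].
  by apply/funext => k; have [_ <-] := sumg (fun u => \1_(E (phi k) u)) (jind k).
- move=> k; apply: le_trans e'K; rewrite -Rintegral_cstM; [|exact: mO|exact: integrable_norm].
  apply: dist_Rintegral_le => //.
  + by apply: jbg => // x; exact: wC.
  + by have [] := sumg (fun u => \1_(E (phi k) u)) (jind k).
  + exact/integrable_cstM/integrable_norm.
  + apply: aeW => x Ox; rewrite VE// -mulrBl normrM ler_wpM2r//.
    by apply: JP; rewrite code_cell_point.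
- apply: le_trans e'K; rewrite -Rintegral_cstM; [|exact: mO|exact: integrable_norm].
  apply: dist_Rintegral_le => //.
  + exact: jbg.
  + by have [] := sumg f jfg.
  + exact/integrable_cstM/integrable_norm.
  + apply: filterS (WE _ _ e'0 JP) => x Wx Ox; rewrite -mulrBl normrM ler_wpM2r//.
    exact: Wx.
Qed.

End young_limit.

(** * From test functions to C_{p,-p} *)

Section posdet_integral.
Context {R : realType} {n : nat}.
Implicit Types (P : probability 'M[R]_n R) (v w : 'M[R]_n -> R) (s : 'M[R]_n).

Lemma integrable_test_fun P w : test_fun w -> P.-integrable setT (EFin \o w).
Proof.
move=> tw; have [C C0 wC] := test_fun_bounded tw.
apply: (bounded_integrable measurableT (C := C)) => //.
  exact: probability_lty.
exact: measurable_test_fun.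
Qed.

Lemma integral_test_fun P w : test_fun w ->
  (\int[P]_s (w s)%:E = (\int[P]_s w s)%:E)%E.
Proof.
move=> tw; rewrite fineK//; apply: (integrable_fin_num measurableT).
exact: integrable_test_fun.
Qed.

Lemma cutoff_posdet m v s : cutoff m s * posdet_part v s = cutoff m s * v s.
Proof. by rewrite /posdet_part /cutoff; case: ifP => //; rewrite !mul0r. Qed.

Lemma test_fun_cutoff m : test_fun (@cutoff R n m).
Proof.
have -> : cutoff m = (fun s : 'M[R]_n => cutoff m s * cst 1 s).
  by apply/funext => s; rewrite /= mulr1.
by apply: cutoff_test_fun => s _; exact: cst_continuous.
Qed.

Lemma posdet_part_ge0 v : (forall s, 0 < \det s -> 0 <= v s) ->
  forall s, 0 <= posdet_part v s.
Proof. by move=> v0 s; rewrite /posdet_part; case: ifP => // /v0. Qed.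

Lemma cutoff_posdet_cvg v s :
  cutoff m%:R s * v s @[m --> \oo] --> posdet_part v s.
Proof.
apply: cvg_near_cst; rewrite /posdet_part; case: ifPn => s0; last first.
  by apply: nearW => m; rewrite /cutoff (negPf s0) mul0r.
near=> m; rewrite cutoff_eq1 ?mul1r//; near: m; exact: nbhs_infty_ger.
Unshelve. all: by end_near. Qed.

Lemma integral_cutoff_cvg P v :
  (forall s, 0 < \det s -> v t @[t --> s] --> v s) ->
  (forall s, 0 < \det s -> 0 <= v s) ->
  (\int[P]_s (cutoff m%:R s * v s)%:E @[m --> \oo] -->
   \int[P]_s (posdet_part v s)%:E)%E.
Proof.
move=> cv v0.
have -> : (\int[P]_s (posdet_part v s)%:E =
    \int[P]_s limn (fun m => (cutoff m%:R s * v s)%:E))%E.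
  apply: eq_integral => s _; apply/esym/cvg_lim => //.
  by apply: cvg_EFin; [exact: nearW|exact: cutoff_posdet_cvg].
apply: cvg_monotone_convergence => //.
- by move=> m; apply/measurable_EFinP; apply: measurable_test_fun; exact: cutoff_test_fun.
- move=> m s _; rewrite lee_fin -cutoff_posdet mulr_ge0 ?cutoff_ge0//.
  exact: posdet_part_ge0.
- move=> s _ i j ij; rewrite lee_fin -(cutoff_posdet i%:R) -(cutoff_posdet j%:R).
  apply: ler_wpM2r; first exact: posdet_part_ge0.
  by apply: cutoff_nd; rewrite ler_nat.
Qed.

Lemma integral_inv_posdet P v : P (@invpos_mx R n) = 1%E ->
  (forall s, s \in unitmx -> v t @[t --> s] --> v s) ->
  (\int[P]_(s in @inv_mx R n) (v s)%:E = \int[P]_s (posdet_part v s)%:E)%E.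
Proof.
move=> P1 cv; have mi : measurable (@inv_mx R n).
  by apply: open_measurable_mx; exact: open_unitmx.
have mp : measurable (@invpos_mx R n).
  by apply: open_measurable_mx; exact: open_posdet.
have mv : measurable_fun (@inv_mx R n) v.
  by apply: open_continuous_measurable_mx; [exact: open_unitmx|exact: cv].
rewrite integral_mkcond; apply: ae_eq_integral => //.
- by apply/(measurable_restrictT _ mi)/measurable_EFinP.
- apply/measurable_EFinP; apply: measurable_posdet_part => s s0; apply: cv.
  exact: posdet_unitmx.
exists (~` @invpos_mx R n); split; first exact: measurableC.
  by transitivity (1 - P (@invpos_mx R n))%E; [exact: probability_setC|rewrite P1 subee].
move=> s /= ns s0; apply: ns => _; rewrite patchE mem_set; last exact: posdet_unitmx.
by rewrite /posdet_part s0.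
Qed.

Lemma integral_posdet1 P : (\int[P]_s (posdet_part (cst 1) s)%:E = P (@invpos_mx R n))%E.
Proof.
have mp : measurable (@invpos_mx R n).
  by apply: open_measurable_mx; exact: open_posdet.
rewrite -[in RHS](setIT (@invpos_mx R n)) -integral_indic//.
apply: eq_integral => s _; rewrite /posdet_part indicE.
by case: ifPn => [s0|s0]; [rewrite mem_set|rewrite memNset//; exact/negP].
Qed.

Lemma posdet_growth_ge0 p s : 0 <= posdet_part (@growth R n p) s.
Proof. by apply: posdet_part_ge0 => *; exact: growth_ge0. Qed.

(** On {det > 0} the error is (1 - cutoff) v, which lives where [inv_size] exceeds m, and there |v|
    is at most e times the growth. Off {det > 0} both sides vanish. *)
Lemma Cpp_cutoff p v (e : R) : (0 < n)%N -> Cpp p v -> 0 < e ->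
  exists m : nat, forall s, `|posdet_part v s - cutoff m%:R s * v s| <=
    e * posdet_part (growth p) s.
Proof.
move=> n0 vp e0; have [M Mv] := Cpp_small n0 vp e0.
exists (Num.bound M) => s; rewrite /posdet_part.
case: ifPn => s0; last by rewrite /cutoff (negPf s0) mul0r subrr normr0 mulr0.
have [sM|Ms] := leP (inv_size s) (Num.bound M)%:R.
  by rewrite cutoff_eq1// mul1r subrr normr0 mulr_ge0 ?growth_ge0// ltW.
have -> : v s - cutoff (Num.bound M)%:R s * v s =
    (1 - cutoff (Num.bound M)%:R s) * v s by ring.
have c0 := cutoff_ge0 (Num.bound M)%:R s; have c1 := cutoff_le1 (Num.bound M)%:R s.
rewrite normrM ger0_norm ?subr_ge0// (le_trans (_ : _ <= `|v s|))//.
  by rewrite ler_piMl//; lra.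
apply: Mv => //; apply: le_lt_trans Ms.
have [M0|M0] := leP 0 M; first exact/ltW/archi_boundP.
by rewrite (le_trans (ltW M0)).
Qed.

End posdet_integral.

Lemma integrable_fine (d : measure_display) (T : measurableType d) (R : realType)
    (mu : {measure set T -> \bar R}) (D : set T) (G : T -> \bar R) :
  measurable D -> mu.-integrable D G -> mu.-integrable D (EFin \o (fine \o G)).
Proof.
move=> mD jG; have mG := measurable_int _ jG; apply: le_integrable jG => //.
  apply/measurable_EFinP; apply: (measurable_comp measurableT) mG => //.
by move=> x _ /=; case: (G x) => [r||] //=; rewrite normr0 leey.
Qed.

(** * The norms of L^infty and L^p *)

Lemma LinftyP (R : realType) (n : nat) (Omega : set 'rV[R]_n) (g : 'rV[R]_n -> R) :
  Linfty Omega g <-> measurable_fun (Omega : set (lebesgueType R n)) g /\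
    ess_bounded (lebesgue R n) Omega g.
Proof.
split=> [[mg gOO]|[mg [C gC]]]; split => //.
  (* The norm with exponent +oo is an essential supremum only if the whole space has positive
     measure; otherwise every set is null and any bound holds. *)
  have [mu0|mu0] := ltP 0%E (lebesgue R n setT); last first.
    exists 0; exists setT; split => //.
    by apply/eqP; rewrite -measure_le0.
  move: gOO; rewrite unlock /= mu0; set f := abse \o _ => fC.
  exists (fine (ess_sup (lebesgue R n) f)).
  apply: filterS (ess_sup_ge (lebesgue R n) f) => x fx Ox.
  have fxE : f x = `|g x|%:E by rewrite /f /= patchE mem_set.
  rewrite -lee_fin -fxE fineK// fin_numE; apply/andP; split; last by rewrite lt_eqF.
  by apply/eqP => E; move: fx; rewrite E fxE leeNy_eq.
rewrite unlock /=; case: ifPn => [mu0|_]; last exact: ltry.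
apply: (@le_lt_trans _ _ (Num.max 0 C)%:E); last exact: ltry.
apply/ess_supP; apply: filterS gC => x gC /=.
rewrite patchE; case: ifPn => [/set_mem Ox|_].
  by rewrite /= lee_fin le_max (gC Ox) orbT.
by rewrite abse0 lee_fin le_max lexx.
Qed.

Lemma Lp_norm_powR (R : realType) (n : nat) (p : R) (Omega : set 'rV[R]_n)
    (Y : 'rV[R]_n -> 'M[R]_n) : 0 < p ->
  (Lp_norm p Omega Y `^ p =
   \int[lebesgue R n]_(x in Omega) (frobenius (Y x) `^ p)%:E)%E.
Proof.
move=> p0; rewrite /Lp_norm powR_Lnorm ?gt_eqF// [RHS]integral_mkcond.
apply: eq_integral => x _; rewrite !patchE; case: ifPn => _ /=.
  by rewrite ger0_norm// frobenius_ge0.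
by rewrite normr0 powR0// gt_eqF.
Qed.

Lemma Lp_norm_le (R : realType) (n : nat) (p : R) (Omega : set 'rV[R]_n)
    (Y : 'rV[R]_n -> 'M[R]_n) (C : R) : 0 < p -> (Lp_norm p Omega Y <= C%:E)%E ->
  (\int[lebesgue R n]_(x in Omega) (frobenius (Y x) `^ p)%:E <= (C `^ p)%:E)%E.
Proof.
move=> p0 YC; rewrite -Lp_norm_powR// -poweR_EFin.
have L0 : (0 <= Lp_norm p Omega Y)%E by exact: Lnorm_ge0.
apply: gt0_ler_poweR => //; first exact: ltW.
  by rewrite in_itv/= L0 leey.
by rewrite in_itv/= leey andbT (le_trans L0).
Qed.

Lemma Lp_norm_ge (R : realType) (n : nat) (p : R) (Omega : set 'rV[R]_n)
    (Y : 'rV[R]_n -> 'M[R]_n) (C : R) : 0 < p -> 0 <= C ->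
  (\int[lebesgue R n]_(x in Omega) (frobenius (Y x) `^ p)%:E <= C%:E)%E ->
  (Lp_norm p Omega Y <= (C `^ p^-1)%:E)%E.
Proof.
move=> p0 C0; rewrite -Lp_norm_powR// => YC.
have L0 : (0 <= Lp_norm p Omega Y)%E by exact: Lnorm_ge0.
have : ((Lp_norm p Omega Y `^ p) `^ p^-1 <= C%:E `^ p^-1)%E.
  apply: gt0_ler_poweR => //; first by rewrite invr_ge0 ltW.
    by rewrite in_itv/= leey poweR_ge0.
  by rewrite in_itv/= leey lee_fin C0.
by rewrite -poweRrM mulfV ?gt_eqF// poweRe1// poweR_EFin.
Qed.

Lemma integrable_test_fun_comp (R : realType) (n : nat) (Omega : set 'rV[R]_n)
    (Z : lebesgueType R n -> 'M[R]_n) (w : 'M[R]_n -> R) :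
  open Omega -> bounded_set Omega ->
  measurable_fun (Omega : set (lebesgueType R n)) Z -> test_fun w ->
  (lebesgue R n).-integrable Omega (EFin \o (fun x => w (Z x))).
Proof.
move=> openO bndO mZ tw; have [D D0 wD] := test_fun_bounded tw.
apply: (bounded_integrable (measurable_open_lebesgue openO) (C := D)).
- exact: lebesgue_bounded_lty.
- exact: measurableT_comp (measurable_test_fun tw) mZ.
- by move=> x _; exact: wD.
Qed.

(** * Functions of C_{p,-p} along the sequence and in the limit *)

Section Cpp_limit.
Context (R : realType) (n : nat) (p : R) (Omega : set 'rV[R]_n).
Hypotheses (n0 : (0 < n)%N) (p1 : 1 <= p).
Hypotheses (openO : open Omega) (bndO : bounded_set Omega).
Local Notation T := (lebesgueType R n).
Local Notation mu := (lebesgue R n).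
Variable nu : 'rV[R]_n -> probability 'M[R]_n R.
Hypothesis mnu : forall w : 'M[R]_n -> R, test_fun w ->
  measurable_fun (Omega : set T) (fun x => \int[nu x]_s w s).

Let mO := measurable_open_lebesgue openO.
Let Ooo := lebesgue_bounded_lty openO bndO.

Lemma measurable_integral_posdet (v : 'M[R]_n -> R) :
  (forall s : 'M[R]_n, 0 < \det s -> v t @[t --> s] --> v s) ->
  (forall s, 0 < \det s -> 0 <= v s) ->
  measurable_fun (Omega : set T) (fun x => \int[nu x]_s (posdet_part v s)%:E)%E.
Proof.
move=> cv v0.
apply: (emeasurable_fun_cvg (fun m (x : T) => \int[nu x]_s (cutoff m%:R s * v s)%:E)%E).
  move=> m; have tm := cutoff_test_fun m%:R cv.
  under eq_fun do rewrite (integral_test_fun _ tm).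
  exact/measurable_EFinP/mnu.
by move=> x _; exact: integral_cutoff_cvg.
Qed.

Hypothesis nu_growth : (\int[mu]_(x in Omega)
  \int[nu x]_s (posdet_part (@growth R n p) s)%:E < +oo)%E.

Let G (x : T) : \bar R := (\int[nu x]_s (posdet_part (@growth R n p) s)%:E)%E.

Let G0 x : (0 <= G x)%E.
Proof. by apply: integral_ge0 => s _; rewrite lee_fin posdet_growth_ge0. Qed.

Let jG : mu.-integrable Omega G.
Proof.
apply/integrableP; split.
  apply: measurable_integral_posdet => s s0; last exact: growth_ge0.
  exact/growth_cvg/posdet_unitmx.
by under eq_integral do rewrite gee0_abs//.
Qed.

Let Gfin : {ae mu, forall x, Omega x -> G x \is a fin_num}.
Proof. exact: integrable_ae jG. Qed.

Let jfG : mu.-integrable Omega (EFin \o (fine \o G)).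
Proof. exact: integrable_fine. Qed.

Lemma integrable_posdet_growth x : G x \is a fin_num ->
  (nu x).-integrable setT (EFin \o posdet_part (@growth R n p)).
Proof.
move=> Gx; apply/integrableP; split.
  apply/measurable_EFinP; apply: measurable_posdet_part => s s0.
  exact/growth_cvg/posdet_unitmx.
under eq_integral do rewrite gee0_abs ?lee_fin ?posdet_growth_ge0//.
by rewrite -ge0_fin_numE//; exact: G0.
Qed.

Section Cpp_function.
Variable v : 'M[R]_n -> R.
Hypothesis vp : Cpp p v.

Let tv m := cutoff_test_fun m (Cpp_cvg vp).

Let mpv := measurable_posdet_part (Cpp_cvg vp).

Lemma Cpp_approx e m x :
  (forall s, `|posdet_part v s - cutoff m%:R s * v s| <= e * posdet_part (growth p) s) ->
  G x \is a fin_num ->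
  (nu x).-integrable setT (EFin \o posdet_part v) /\
  `|\int[nu x]_s posdet_part v s - \int[nu x]_s (cutoff m%:R s * v s)| <= e * fine (G x).
Proof.
move=> vm Gx; have jg := integrable_posdet_growth Gx.
have jm := integrable_test_fun (nu x) (tv m%:R).
have jeg := integrable_cstM measurableT e jg.
have jv : (nu x).-integrable setT (EFin \o posdet_part v).
  have jh : (nu x).-integrable setT
      (EFin \o (fun s => `|cutoff m%:R s * v s| + e * posdet_part (growth p) s)).
    by apply: integrable_addr => //; exact: integrable_norm jm.
  apply: (ae_le_integrable measurableT _ jh) => //.
  apply: aeW => s _; rewrite -lerBlDl (le_trans _ (vm s))//.
  exact: lerB_dist.
split=> //; rewrite (_ : e * fine (G x) = \int[nu x]_s (e * posdet_part (growth p) s)).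
  by apply: dist_Rintegral_le => //; apply: aeW => s _; exact: vm.
by rewrite Rintegral_cstM.
Qed.

Let N (x : T) : R := \int[nu x]_s posdet_part v s.

Let N_ae e m :
  (forall s, `|posdet_part v s - cutoff m%:R s * v s| <= e * posdet_part (growth p) s) ->
  {ae mu, forall x, Omega x ->
    `|N x - \int[nu x]_s (cutoff m%:R s * v s)| <= e * fine (G x)}.
Proof. by move=> vm; apply: filterS Gfin => x Gx Ox; have [] := Cpp_approx vm (Gx Ox). Qed.

Let mN : measurable_fun (Omega : set T) N.
Proof.
have e0 m : 0 < m.+1%:R^-1 :> R by rewrite invr_gt0.
have [J JP] := choice (fun m => Cpp_cutoff n0 vp (e0 m)).
apply: (ae_cvg_measurable (@lebesgue_complete R n) (fun m => mnu (tv (J m)%:R))).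
have := ae_foralln (fun m => N_ae (JP m)).
apply: filterS => x NJ Ox; apply/cvgrPdist_le => e e1.
pose K := fine (G x) + 1; have K0 : 0 < K by rewrite ltr_wpDl// fine_ge0.
have [M _ Me] : \forall m \near \oo, m.+1%:R^-1 < e / K :> R.
  exact: near_infty_natSinv_lt (PosNum (divr_gt0 e1 K0)).
exists M => // m /Me /ltW mK; apply: le_trans (NJ m Ox) _.
rewrite -ler_pdivlMl; last exact: e0.
rewrite invrK; apply: (@le_trans _ _ K); first by rewrite /K lerDl.
move: mK; rewrite ler_pdivlMr// => mK.
by rewrite -ler_pdivrMl ?ltr0n// mulrC (le_trans _ mK)// mulrC.
Qed.

Let jN : mu.-integrable Omega (EFin \o N).
Proof.
have [m vm] := Cpp_cutoff n0 vp ltr01.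
have [C C0 wC] := test_fun_bounded (tv m%:R).
have jm : mu.-integrable Omega (EFin \o (fun x => C + fine (G x))).
  apply: integrable_addr => //; apply: (bounded_integrable mO (C := C)) => //= x _.
  by rewrite ger0_norm// ltW.
apply: (ae_le_integrable mO mN jm).
apply: filterS (N_ae vm) => x; rewrite mul1r => Nx Ox.
have NC : `|\int[nu x]_s (cutoff m%:R s * v s)| <= C.
  apply: le_trans (le_normr_Rintegral measurableT (integrable_test_fun (nu x) (tv m%:R))) _.
  rewrite -[leRHS](Rintegral_prob_cst (nu x)); apply: ae_le_Rintegral => //.
  - exact: integrable_norm (integrable_test_fun (nu x) (tv m%:R)).
  - apply: (bounded_integrable measurableT (C := C)) => //.
      exact: probability_lty.
    by move=> s _; rewrite ger0_norm// ltW.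
  - by apply: aeW => s _; exact: wC.
have := lerD NC (Nx Ox); apply: le_trans.
by rewrite -[in leLHS](subrK (\int[nu x]_s (cutoff m%:R s * v s)) (N x)) addrC ler_normD.
Qed.

Lemma integrable_Cpp_nu :
  mu.-integrable Omega (EFin \o (fun x => \int[nu x]_s posdet_part v s)).
Proof. exact: jN. Qed.

Variables (Y : nat -> 'rV[R]_n -> 'M[R]_n) (C : R).
Hypotheses (mY : forall k, measurable_fun (Omega : set T) (Y k))
  (gY : forall k, (\int[mu]_(x in Omega) (posdet_part (growth p) (Y k x))%:E <= C%:E)%E).
Hypothesis cvgY : forall (w : 'M[R]_n -> R) (g : T -> R), test_fun w ->
  measurable_fun (Omega : set T) g -> ess_bounded mu Omega g ->
  \int[mu]_(x in Omega) (w (Y k x) * g x) @[k --> \oo] -->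
  \int[mu]_(x in Omega) (\int[nu x]_s w s * g x).

Let jgY k : mu.-integrable Omega (EFin \o (fun x => posdet_part (growth p) (Y k x))).
Proof.
apply/integrableP; split.
  apply/measurable_EFinP; apply: measurableT_comp (mY k).
  apply: measurable_posdet_part => s s0; exact/growth_cvg/posdet_unitmx.
under eq_integral do rewrite gee0_abs ?lee_fin ?posdet_growth_ge0//.
by apply: le_lt_trans (gY k) _; rewrite ltry.
Qed.

Let jwY w k : test_fun w -> mu.-integrable Omega (EFin \o (fun x => w (Y k x))).
Proof. exact: integrable_test_fun_comp (mY k). Qed.

Lemma integrable_Cpp_seq k :
  mu.-integrable Omega (EFin \o (fun x => posdet_part v (Y k x))).
Proof.
have [m vm] := Cpp_cutoff n0 vp ltr01.
have jh : mu.-integrable Omega (EFin \o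
    (fun x => `|cutoff m%:R (Y k x) * v (Y k x)| + posdet_part (growth p) (Y k x))).
  by apply: integrable_addr => //; exact: integrable_norm (jwY k (tv m%:R)).
apply: (ae_le_integrable mO _ jh); first exact: measurableT_comp (mY k).
apply: aeW => x _; rewrite -lerBlDl; have := vm (Y k x); rewrite mul1r.
by apply: le_trans; exact: lerB_dist.
Qed.

(** Cutting v off costs at most d times the growth, whose integrals are bounded by C along the
    sequence and by [IG] in the limit; what remains is a test function. *)
Lemma cvg_Cpp (g : T -> R) : measurable_fun (Omega : set T) g -> ess_bounded mu Omega g ->
  \int[mu]_(x in Omega) (posdet_part v (Y k x) * g x) @[k --> \oo] -->
  \int[mu]_(x in Omega) (\int[nu x]_s posdet_part v s * g x).
Proof.
move=> mg bg; have [D gD] := bg.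
apply: uniform_approx_cvg => e e0.
pose IG := \int[mu]_(x in Omega) fine (G x).
have IG0 : 0 <= IG by apply: Rintegral_ge0 => x _; exact: fine_ge0.
(* [D] bounds g almost everywhere, so that d = e / K makes both errors, d |D| |C| and d |D| IG, at
   most e. *)
pose K := `|D| * (`|C| + IG) + 1.
have K0 : 0 < K by rewrite ltr_wpDl// mulr_ge0// addr_ge0.
have d0 := divr_gt0 e0 K0; set d := e / K in d0.
have dK : d * K = e by rewrite /d divfK// gt_eqF.
have [m vm] := Cpp_cutoff n0 vp d0.
exists (fun k => \int[mu]_(x in Omega) (cutoff m%:R (Y k x) * v (Y k x) * g x)).
exists (\int[mu]_(x in Omega) (\int[nu x]_s (cutoff m%:R s * v s) * g x)).
split; first exact: cvgY (tv m%:R) mg bg.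
- move=> k; have jd := integrable_cstM mO (d * `|D|) (jgY k).
  apply: (@le_trans _ _ (\int[mu]_(x in Omega) (d * `|D| * posdet_part (growth p) (Y k x)))).
    apply: dist_Rintegral_le => //.
    + by apply: integrable_ess_bounded => //; exact: integrable_Cpp_seq.
    + by apply: integrable_ess_bounded => //; exact: jwY (tv m%:R).
    + apply: filterS gD => x gD Ox; rewrite -mulrBl normrM [leRHS]mulrAC.
      apply: ler_pM => //.
      by rewrite (le_trans (gD Ox))// ler_norm.
  rewrite Rintegral_cstM// -dK -mulrA ler_wpM2l ?(ltW d0)//.
  have : \int[mu]_(x in Omega) posdet_part (growth p) (Y k x) <= `|C|.
    rewrite -lee_fin fineK; last by apply: (integrable_fin_num mO); exact: jgY.
    by rewrite (le_trans (gY k))// lee_fin ler_norm.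
  move=> /(ler_wpM2l (normr_ge0 D)) /le_trans; apply.
  by rewrite /K mulrDr; have := mulr_ge0 (normr_ge0 D) IG0; lra.
- have jd := integrable_cstM mO (d * `|D|) jfG.
  apply: (@le_trans _ _ (\int[mu]_(x in Omega) (d * `|D| * fine (G x)))).
    apply: dist_Rintegral_le => //.
    + exact: integrable_ess_bounded.
    + apply: integrable_ess_bounded => //.
      have [D' D'0 wD'] := test_fun_bounded (tv m%:R).
      apply: (ae_le_integrable mO (h := fun x => `|N x| + d * fine (G x))).
      * exact: mnu (tv m%:R).
      * apply: integrable_addr => //; first exact: integrable_norm.
        exact: (integrable_cstM mO d jfG).
      * apply: filterS (N_ae vm) => x Nx Ox; rewrite -lerBlDl.
        by rewrite (le_trans _ (Nx Ox))// distrC lerB_dist.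
    + apply: filterS2 gD (N_ae vm) => x gD Nx Ox; rewrite -mulrBl normrM [leRHS]mulrAC.
      apply: ler_pM => //; first exact: Nx.
      by rewrite (le_trans (gD Ox))// ler_norm.
  rewrite Rintegral_cstM// -dK -mulrA ler_wpM2l ?(ltW d0)//.
  rewrite /K mulrDr -/IG; have := mulr_ge0 (normr_ge0 D) (normr_ge0 C); lra.
Qed.

End Cpp_function.

End Cpp_limit.

(** * The limit formula and generation in the sense of C_p *)

Section young_conclusion.
Context (R : realType) (n : nat) (p : R) (Omega : set 'rV[R]_n).
Hypotheses (n0 : (0 < n)%N) (p1 : 1 <= p).
Hypotheses (openO : open Omega) (bndO : bounded_set Omega).
Local Notation T := (lebesgueType R n).
Local Notation mu := (lebesgue R n).

Let mO := measurable_open_lebesgue openO.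
Let Ooo := lebesgue_bounded_lty openO bndO.

(** Passage from real-valued integrals of good representatives to the extended-valued ones of
    [weak_L1_cvg]. The functions f and h are identified almost everywhere only, and their
    measurability rests on completeness of Lebesgue measure. *)
Lemma weak_L1_cvg_ae (F : nat -> T -> R) (H : T -> R)
    (f : nat -> 'rV[R]_n -> \bar R) (h : 'rV[R]_n -> \bar R) :
  (forall k, mu.-integrable Omega (EFin \o F k)) -> mu.-integrable Omega (EFin \o H) ->
  (forall k, {ae mu, forall x, Omega x -> f k x = (F k x)%:E}) ->
  {ae mu, forall x, Omega x -> h x = (H x)%:E} ->
  (forall g : T -> R, measurable_fun (Omega : set T) g -> ess_bounded mu Omega g ->
     \int[mu]_(x in Omega) (F k x * g x) @[k --> \oo] -->
     \int[mu]_(x in Omega) (H x * g x)) ->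
  weak_L1_cvg Omega f h.
Proof.
move=> jF jH fF hH FH.
have mfun (a : T -> \bar R) (A : T -> R) : mu.-integrable Omega (EFin \o A) ->
    {ae mu, forall x, Omega x -> a x = (A x)%:E} -> measurable_fun (Omega : set T) a.
  move=> jA aA; apply: (ae_measurable_fun (@lebesgue_complete R n) (f := EFin \o A)).
    by apply: filterS aA => x aA Ox; rewrite aA.
  exact: measurable_int jA.
have jfun (a : T -> \bar R) (A : T -> R) : mu.-integrable Omega (EFin \o A) ->
    {ae mu, forall x, Omega x -> a x = (A x)%:E} -> mu.-integrable Omega a.
  move=> jA aA; have ma := mfun _ _ jA aA; apply/integrableP; split => //.
  have /integrableP[mA] := jA; apply: le_lt_trans.
  have abs0 (b : T -> \bar R) (x : T) : Omega x -> (0 <= `|b x|)%E by move=> _.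
  have mabs (b : T -> \bar R) : measurable_fun (Omega : set T) b ->
      measurable_fun (Omega : set T) (fun x => `|b x|%E).
    exact: measurableT_comp.
  apply: (ae_ge0_le_integral mO (abs0 a) (mabs _ ma) (abs0 _) (mabs _ mA)).
  by apply: filterS aA => x aA Ox; rewrite aA.
have ifun (a : T -> \bar R) (A : T -> R) (g : T -> R) : mu.-integrable Omega (EFin \o A) ->
    {ae mu, forall x, Omega x -> a x = (A x)%:E} ->
    measurable_fun (Omega : set T) g -> ess_bounded mu Omega g ->
    (\int[mu]_(x in Omega) (a x * (g x)%:E) = (\int[mu]_(x in Omega) (A x * g x))%:E)%E.
  move=> jA aA mg bg; have jAg := integrable_ess_bounded mO jA mg bg.
  rewrite fineK; last by apply: (integrable_fin_num mO); exact: jAg.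
  have aAg : {ae mu, forall x, Omega x -> (a x * (g x)%:E)%E = (A x * g x)%:E}.
    by apply: filterS aA => x aA Ox; rewrite aA// EFinM.
  exact: (ae_eq_integral _ _ mO (mfun _ _ jAg aAg) (measurable_int _ jAg) aAg).
split=> [k||g /LinftyP[mg bg]].
- exact: jfun (jF k) (fF k).
- exact: jfun jH hH.
- rewrite (ifun _ _ _ jH hH mg bg).
  apply: cvg_EFin; first by apply: nearW => k; rewrite (ifun _ _ _ (jF k) (fF k) mg bg).
  by under eq_fun do rewrite /= (ifun _ _ _ (jF _) (fF _) mg bg) /=; exact: FH.
Qed.

Variables (nu : 'rV[R]_n -> probability 'M[R]_n R) (Y : nat -> 'rV[R]_n -> 'M[R]_n) (C : R).
Hypothesis mnu : forall w : 'M[R]_n -> R, test_fun w ->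
  measurable_fun (Omega : set T) (fun x => \int[nu x]_s w s).
Hypothesis nu_growth : (\int[mu]_(x in Omega)
  \int[nu x]_s (posdet_part (@growth R n p) s)%:E < +oo)%E.
Hypothesis nu_pos : {ae mu, forall x, Omega x -> nu x (@invpos_mx R n) = 1%E}.
Hypotheses (mY : forall k, measurable_fun (Omega : set T) (Y k))
  (dY : forall k, det_pos_ae Omega (Y k))
  (gY : forall k, (\int[mu]_(x in Omega) (posdet_part (growth p) (Y k x))%:E <= C%:E)%E).
Hypothesis cvgY : forall (w : 'M[R]_n -> R) (g : T -> R), test_fun w ->
  measurable_fun (Omega : set T) g -> ess_bounded mu Omega g ->
  \int[mu]_(x in Omega) (w (Y k x) * g x) @[k --> \oo] -->
  \int[mu]_(x in Omega) (\int[nu x]_s w s * g x).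

Lemma nu_good : {ae mu, forall x, Omega x -> nu x (@invpos_mx R n) = 1%E /\
  (\int[nu x]_s (posdet_part (@growth R n p) s)%:E)%E \is a fin_num}.
Proof.
have jG : mu.-integrable Omega
    (fun x => \int[nu x]_s (posdet_part (@growth R n p) s)%:E)%E.
  apply/integrableP; split.
    apply: measurable_integral_posdet => // s s0; last exact: growth_ge0.
    exact/growth_cvg/posdet_unitmx.
  have G0 x : (0 <= \int[nu x]_s (posdet_part (@growth R n p) s)%:E)%E.
    by apply: integral_ge0 => s _; rewrite lee_fin posdet_growth_ge0.
  by under eq_integral do rewrite (gee0_abs (G0 _)).
have := integrable_ae mO jG; move: nu_pos; apply: filterS2 => x nx Gx Ox.
by split; [exact: nx|exact: Gx].
Qed.

(** [h] is left free because the limit is needed in two forms, as an integral over the invertible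
    matrices and as one over all matrices; both reduce to {det > 0} when nu_x is carried by that
    set. *)
Lemma Cpp_weak_cvg v (h : 'rV[R]_n -> \bar R) : Cpp p v ->
  (forall x, nu x (@invpos_mx R n) = 1%E ->
     h x = \int[nu x]_s (posdet_part v s)%:E)%E ->
  weak_L1_cvg Omega (fun k x => (v (Y k x))%:E) h.
Proof.
move=> vp hE; have tv := Cpp_cutoff n0 vp ltr01.
apply: (weak_L1_cvg_ae (F := fun k x => posdet_part v (Y k x))
    (H := fun x => \int[nu x]_s posdet_part v s)).
- by move=> k; exact: (integrable_Cpp_seq n0 openO bndO vp mY gY k).
- exact: (integrable_Cpp_nu n0 openO bndO mnu nu_growth vp).
- by move=> k; apply: filterS (dY k) => x dYx Ox; rewrite /posdet_part dYx.
- apply: filterS nu_good => x nx Ox; have [n1 Gx] := nx Ox.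
  rewrite hE// fineK//; apply: (integrable_fin_num measurableT).
  by have [m vm] := tv; have [] := Cpp_approx n0 vp vm Gx.
- by move=> g mg bg; exact: (cvg_Cpp n0 openO bndO mnu nu_growth vp mY gY cvgY mg bg).
Qed.

Lemma limit_formula_test_fun : limit_formula p Omega Y nu.
Proof.
move=> g v gO vp; have cv := vp.1.
have [|_ _] := @Cpp_weak_cvg v (fun x => \int[nu x]_(s in @inv_mx R n) (v s)%:E)%E vp.
  move=> x nx; apply: integral_inv_posdet => // s s0.
  move: cv; rewrite continuous_open_subspace; last exact: open_unitmx.
  by apply; rewrite inE.
exact.
Qed.

Lemma generates_test_fun : generates p Omega Y nu.
Proof.
move=> v vC; have cv := vC.1; apply: Cpp_weak_cvg; first exact: Cp_Cpp.
move=> x nx; have mp : measurable (@invpos_mx R n).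
  by apply: open_measurable_mx; exact: open_posdet.
apply: ae_eq_integral => //.
- by apply/measurable_EFinP; exact: continuous_measurable_mx.
- by apply/measurable_EFinP; apply: measurable_posdet_part => s _; exact: cv.
exists (~` @invpos_mx R n); split; first exact: measurableC.
  by transitivity (1 - nu x (@invpos_mx R n))%E; [exact: probability_setC|rewrite nx subee].
by move=> s /= ns s0; apply: ns => _; rewrite /posdet_part s0.
Qed.

Lemma C0_Cp (v : 'M[R]_n -> R) : C0 v -> Cp p v.
Proof.
move=> [cv /cvg_at_infinityP v0]; split => //; apply/cvg_at_infinityP => e e0.
have [M Me] := v0 e e0; exists (`|M| + 1) => s _ sM.
have s1 : 1 <= frobenius s by apply: ltW; have := normr_ge0 M; lra.
have sp : 1 <= frobenius s `^ p.
  apply: (le_trans s1); rewrite -{1}(powRr1 (frobenius_ge0 s)).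
  exact: (ler_powR s1 p1).
rewrite normrM normfV (ger0_norm (powR_ge0 _ _)) ltr_pdivrMr ?(lt_le_trans ltr01)//.
apply: (lt_le_trans (Me s I _)); first by have := ler_norm M; lra.
by rewrite ler_peMr// ltW.
Qed.

Lemma young_measure_test_fun : young_measure Omega nu.
Proof.
move=> v vC; have [_ jh _] := generates_test_fun (C0_Cp vC).
exact: measurable_int jh.
Qed.

End young_conclusion.

(** * Bounds on the limiting family *)

Section young_pos.
Context (R : realType) (n : nat) (p : R) (Omega : set 'rV[R]_n).
Hypotheses (n0 : (0 < n)%N) (p1 : 1 <= p).
Hypotheses (openO : open Omega) (bndO : bounded_set Omega).
Local Notation T := (lebesgueType R n).
Local Notation mu := (lebesgue R n).

Let mO := measurable_open_lebesgue openO.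
Let Ooo := lebesgue_bounded_lty openO bndO.
Let p0 : 0 < p. Proof. exact: lt_le_trans p1. Qed.

Lemma measurable_frobenius_powR (Z : T -> 'M[R]_n) : measurable_fun (Omega : set T) Z ->
  measurable_fun (Omega : set T) (fun x => (frobenius (Z x) `^ p)%:E).
Proof.
move=> mZ; apply/measurable_EFinP; apply: (measurableT_comp (measurable_powR p)).
apply: measurableT_comp mZ; apply: continuous_measurable_mx.
exact: frobenius_continuous.
Qed.

Lemma integral_growth_le (Y : T -> 'M[R]_n) (C D : R) :
  measurable_fun (Omega : set T) Y ->
  measurable_fun (Omega : set T) (fun x => invmx (Y x)) ->
  (Lp_norm p Omega Y <= C%:E)%E -> (Lp_norm p Omega (fun x => invmx (Y x)) <= D%:E)%E ->
  (\int[mu]_(x in Omega) (posdet_part (growth p) (Y x))%:E <= (C `^ p + D `^ p)%:E)%E.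
Proof.
move=> mY miY YC YD.
have mf (Z : T -> 'M[R]_n) := @measurable_frobenius_powR Z.
have f0 (Z : T -> 'M[R]_n) x : Omega x -> (0 <= (frobenius (Z x) `^ p)%:E)%E.
  by move=> _; rewrite lee_fin powR_ge0.
have split_int := ge0_integralD mu mO (f0 Y) (mf _ mY) (f0 _) (mf _ miY).
have := leeD (Lp_norm_le p0 YC) (Lp_norm_le p0 YD).
rewrite -split_int -EFinD; apply: le_trans; apply: ge0_le_integral.
- exact: mO.
- by move=> x _; rewrite lee_fin posdet_growth_ge0.
- apply/measurable_EFinP; apply: measurableT_comp mY.
  by apply: measurable_posdet_part => s s0; exact/growth_cvg/posdet_unitmx.
- by apply: emeasurable_funD; exact: mf.
- move=> x _; rewrite -EFinD lee_fin /posdet_part; case: ifP => _.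
    exact: lexx.
  exact: growth_ge0.
Qed.

Variables (nu : 'rV[R]_n -> probability 'M[R]_n R) (Y : nat -> 'rV[R]_n -> 'M[R]_n) (C : R).
Hypothesis mnu : forall w : 'M[R]_n -> R, test_fun w ->
  measurable_fun (Omega : set T) (fun x => \int[nu x]_s w s).
Hypotheses (mY : forall k, measurable_fun (Omega : set T) (Y k))
  (dY : forall k, det_pos_ae Omega (Y k))
  (gY : forall k, (\int[mu]_(x in Omega) (posdet_part (growth p) (Y k x))%:E <= C%:E)%E).
Hypothesis cvgY : forall (w : 'M[R]_n -> R) (g : T -> R), test_fun w ->
  measurable_fun (Omega : set T) g -> ess_bounded mu Omega g ->
  \int[mu]_(x in Omega) (w (Y k x) * g x) @[k --> \oo] -->
  \int[mu]_(x in Omega) (\int[nu x]_s w s * g x).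

Lemma cvg_test_fun1 (w : 'M[R]_n -> R) : test_fun w ->
  \int[mu]_(x in Omega) w (Y k x) @[k --> \oo] -->
  \int[mu]_(x in Omega) (\int[nu x]_s w s).
Proof.
move=> tw; have b1 : ess_bounded mu Omega (cst 1).
  by exists 1; apply: aeW => x _; rewrite normr1.
have m1 : measurable_fun (Omega : set T) (cst 1 : T -> R) by [].
have := cvgY tw m1 b1.
have E (f : T -> R) : \int[mu]_(x in Omega) (f x * cst 1 x) = \int[mu]_(x in Omega) f x.
  by apply: eq_Rintegral => x _; rewrite /= mulr1.
by rewrite E; under eq_fun do rewrite E.
Qed.

Let jwY w k : test_fun w -> mu.-integrable Omega (EFin \o (fun x => w (Y k x))).
Proof. exact: integrable_test_fun_comp (mY k). Qed.

Let jgY k : mu.-integrable Omega (EFin \o (fun x => posdet_part (growth p) (Y k x))).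
Proof.
apply/integrableP; split.
  apply/measurable_EFinP; apply: measurableT_comp (mY k).
  apply: measurable_posdet_part => s s0; exact/growth_cvg/posdet_unitmx.
under eq_integral do rewrite gee0_abs ?lee_fin ?posdet_growth_ge0//.
by apply: le_lt_trans (gY k) _; rewrite ltry.
Qed.

Let igY k : \int[mu]_(x in Omega) posdet_part (growth p) (Y k x) <= C.
Proof.
rewrite -lee_fin fineK; first exact: gY.
by apply: (integrable_fin_num mO); exact: jgY.
Qed.

Lemma integrable_nu_test_fun w : test_fun w ->
  mu.-integrable Omega (EFin \o (fun x => \int[nu x]_s w s)).
Proof.
move=> tw; have [D D0 wD] := test_fun_bounded tw.
apply: (bounded_integrable mO (C := D)); [exact: Ooo|exact: mnu|].
move=> x _; apply: le_trans (le_normr_Rintegral measurableT (integrable_test_fun (nu x) tw)) _.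
rewrite -[leRHS](Rintegral_prob_cst (nu x)); apply: ae_le_Rintegral => //.
- exact: integrable_norm (integrable_test_fun (nu x) tw).
- apply: (bounded_integrable measurableT (C := D)) => //; first exact: probability_lty.
  by move=> s _; rewrite ger0_norm// ltW.
- by apply: aeW => s _; exact: wD.
Qed.

(** Multiplied by a cutoff, the growth is a test function, so its bound passes to the limit in k.
    The cutoff is then removed by monotone convergence, once under nu_x and once under the integral
    over Omega. *)
Lemma nu_growth_le : (\int[mu]_(x in Omega)
  \int[nu x]_s (posdet_part (@growth R n p) s)%:E <= C%:E)%E.
Proof.
have cg (s : 'M[R]_n) : 0 < \det s -> growth p t @[t --> s] --> growth p s.
  by move=> s0; exact/growth_cvg/posdet_unitmx.
pose w m (s : 'M[R]_n) : R := cutoff m%:R s * growth p s.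
have tw m : test_fun (w m) by exact: cutoff_test_fun.
have w0 m s : 0 <= w m s by rewrite mulr_ge0 ?cutoff_ge0 ?growth_ge0.
have nw0 m x : 0 <= \int[nu x]_s w m s by apply: Rintegral_ge0 => s _; exact: w0.
have -> : (\int[mu]_(x in Omega) \int[nu x]_s (posdet_part (@growth R n p) s)%:E =
    \int[mu]_(x in Omega) limn (fun m => (\int[nu x]_s w m s)%:E))%E.
  apply: eq_integral => x _; apply/esym/cvg_lim => //.
  under eq_fun do rewrite -(integral_test_fun _ (tw _)).
  by apply: integral_cutoff_cvg => // s _; exact: growth_ge0.
pose W m (x : T) : \bar R := (\int[nu x]_s w m s)%:E.
have mW m : measurable_fun (Omega : set T) (W m).
  by apply/measurable_EFinP; exact: mnu.
have W0 m x : Omega x -> (0 <= W m x)%E by move=> _; rewrite lee_fin.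
have ndW x : Omega x -> {homo W ^~ x : i j / (i <= j)%N >-> (i <= j)%E}.
  move=> _ i j ij; rewrite lee_fin; apply: ae_le_Rintegral.
  - exact: measurableT.
  - exact: integrable_test_fun.
  - exact: integrable_test_fun.
  - apply: aeW => s _; apply: ler_wpM2r; first exact: growth_ge0.
    by apply: cutoff_nd; rewrite ler_nat.
rewrite (monotone_convergence mu mO mW W0 ndW); apply: lime_le.
  apply: ereal_nondecreasing_is_cvgn => i j ij.
  by apply: (ge0_le_integral mu mO (W0 i) (mW i) (mW j)) => x Ox; exact: ndW.
apply: nearW => m; have jm := integrable_nu_test_fun (tw m).
rewrite -[leLHS]fineK; last exact: (integrable_fin_num mO jm).
rewrite lee_fin; apply: (cvgr_to_le (cvg_test_fun1 (tw m))).
apply: nearW => k; apply: le_trans (igY k); apply: ae_le_Rintegral.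
- exact: mO.
- exact: jwY.
- exact: jgY.
- apply: aeW => x _; rewrite /w -cutoff_posdet ler_piMl ?cutoff_le1//.
  exact: posdet_growth_ge0.
Qed.

Let jcst (c : R) : mu.-integrable Omega (EFin \o cst c).
Proof.
by apply: (bounded_integrable mO (C := `|c|)); [exact: Ooo|exact: measurable_cst|].
Qed.

Let c1 (s : 'M[R]_n) : 0 < \det s -> (cst 1 : 'M[R]_n -> R) t @[t --> s] --> (1 : R).
Proof. by move=> _; exact: cst_continuous. Qed.

(** Markov's inequality, uniformly in k: where the cutoff at level m + 1 is below 1, one has m + 1 <
    [inv_size] <= 2 + growth. *)
Lemma integral_cutoff_ge k m : fine (mu Omega) - (2 * fine (mu Omega) + C) / m.+1%:R <=
  \int[mu]_(x in Omega) cutoff m.+1%:R (Y k x).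
Proof.
have jc := jwY k (test_fun_cutoff m.+1%:R).
have I (c : R) : \int[mu]_(x in Omega) c = c * fine (mu Omega).
  exact: Rintegral_cst.
have j2 : mu.-integrable Omega (EFin \o (fun x => 2 + posdet_part (growth p) (Y k x))).
  exact: (integrable_addr mO (jcst 2) (jgY k)).
have : \int[mu]_(x in Omega) (1 - cutoff m.+1%:R (Y k x)) <=
    (2 * fine (mu Omega) + C) / m.+1%:R.
  apply: (@le_trans _ _ (\int[mu]_(x in Omega) (m.+1%:R^-1 *
      (2 + posdet_part (growth p) (Y k x))))).
    apply: ae_le_Rintegral; [exact: mO| |exact: integrable_cstM|].
      exact: (integrableB mO (jcst 1) jc).
    apply: filterS (dY k) => x dYx Ox; rewrite /posdet_part (dYx Ox).
    rewrite mulrC ler_pdivlMr ?ltr0n//.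
    have g0 := growth_ge0 p (Y k x); have c01 := cutoff_ge0 m.+1%:R (Y k x).
    have [le|lt] := leP (inv_size (Y k x)) m.+1%:R.
      rewrite cutoff_eq1; [|exact: dYx|exact: le].
      by rewrite subrr mul0r; lra.
    have := inv_size_le_growth (Y k x) p1; have : (0 : R) <= m.+1%:R by [].
    by move=> m0 ig; rewrite mulrBl mul1r; have := mulr_ge0 c01 m0; lra.
  rewrite (Rintegral_cstM mO _ j2) mulrC ler_pM2r ?invr_gt0//.
  rewrite (RintegralD mO (jcst 2) (jgY k)) I lerD2l; exact: igY.
by rewrite (RintegralB mO (jcst 1) jc) I mul1r lerBlDl lerBlDr.
Qed.

(** Letting first k and then m tend to infinity in [integral_cutoff_ge], the function sending x to
    the nu_x-measure of {det > 0} has integral at least the measure of Omega. Being at most 1, it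
    equals 1 almost everywhere. *)
Lemma nu_invpos : {ae mu, forall x, Omega x -> nu x (@invpos_mx R n) = 1%E}.
Proof.
have mp : measurable (@invpos_mx R n).
  by apply: open_measurable_mx; exact: open_posdet.
pose P (x : T) : R := fine (nu x (@invpos_mx R n)).
have nuP x : nu x (@invpos_mx R n) = (P x)%:E by rewrite fineK// fin_num_measure.
have P1 x : P x <= 1 by rewrite -lee_fin -nuP probability_le1.
have P0 x : 0 <= P x by rewrite fine_ge0.
have mP : measurable_fun (Omega : set T) P.
  apply/measurable_EFinP; rewrite (_ : EFin \o P =
    (fun x => \int[nu x]_s (posdet_part (cst 1) s)%:E)%E).
    exact: measurable_integral_posdet.
  by apply/funext => x; rewrite integral_posdet1 nuP.
have jP : mu.-integrable Omega (EFin \o P).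
  apply: (bounded_integrable mO (C := 1)); [exact: Ooo|exact: mP|].
  by move=> x _; rewrite ger0_norm.
have I1 : \int[mu]_(x in Omega) 1 = fine (mu Omega).
  by rewrite -[RHS]mul1r; exact: Rintegral_cst.
pose K := 2 * fine (mu Omega) + C.
have lower m : fine (mu Omega) - K / m.+1%:R <= \int[mu]_(x in Omega) P x.
  have tc := @test_fun_cutoff R n m.+1%:R.
  apply: (@le_trans _ _ (\int[mu]_(x in Omega) (\int[nu x]_s cutoff m.+1%:R s))).
    apply: (cvgr_to_ge (cvg_test_fun1 tc)); apply: nearW => k; exact: integral_cutoff_ge.
  apply: ae_le_Rintegral; [exact: mO|exact: integrable_nu_test_fun|exact: jP|].
  apply: aeW => x _; rewrite -lee_fin -nuP -(integral_test_fun _ tc) -integral_posdet1.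
  have f0 (s : 'M[R]_n) : setT s -> (0 <= (cutoff m.+1%:R s)%:E :> \bar R)%E.
    by move=> _; rewrite lee_fin cutoff_ge0.
  have mf : measurable_fun [set: 'M[R]_n] (fun s => (cutoff m.+1%:R s)%:E : \bar R).
    by apply/measurable_EFinP; exact: measurable_test_fun.
  have mg : measurable_fun [set: 'M[R]_n] (fun s => (posdet_part (cst 1) s)%:E : \bar R).
    by apply/measurable_EFinP; exact: measurable_posdet_part.
  apply: (ge0_le_integral (nu x) measurableT f0 mf mg) => s _.
  rewrite lee_fin /posdet_part; case: ifPn => s0; first exact: cutoff_le1.
  by rewrite /cutoff (negPf s0).
have IP : fine (mu Omega) <= \int[mu]_(x in Omega) P x.
  have K0 : 0 <= K.
    apply: addr_ge0; first by rewrite mulr_ge0// fine_ge0.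
    apply: le_trans (igY 0%N); apply: Rintegral_ge0 => x _.
    exact: posdet_growth_ge0.
  apply/ler_addgt0Pr => e e0; have K1 : 0 < K + 1 by lra.
  have [M _ /(_ M (leqnn M)) /= Me] : \forall m \near \oo, m.+1%:R^-1 < e / (K + 1) :> R.
    exact: near_infty_natSinv_lt (PosNum (divr_gt0 e0 K1)).
  have := lower M; rewrite lerBlDr => /le_trans; apply; rewrite lerD2l.
  apply: (@le_trans _ _ (K * (e / (K + 1)))); first by rewrite ler_wpM2l// ltW.
  by rewrite mulrCA ler_piMr ?(ltW e0)// ler_pdivrMr// mul1r; lra.
have j1P : mu.-integrable Omega (EFin \o (fun x => 1 - P x)).
  exact: (integrableB mO (jcst 1) jP).
have I0 : (\int[mu]_(x in Omega) `|(1 - P x)%:E| = 0)%E.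
  under eq_integral do rewrite gee0_abs ?lee_fin ?subr_ge0//.
  rewrite -[LHS]fineK; last exact: (integrable_fin_num mO j1P).
  congr EFin; apply/le_anti/andP; split; last first.
    by apply: Rintegral_ge0 => x _; rewrite subr_ge0.
  have := RintegralB mO (jcst 1) jP; rewrite /Rintegral /= => ->.
  by rewrite -/(Rintegral _ _ _) I1 subr_le0.
have /(ae_eq_integral_abs mu mO (measurable_int _ j1P)) := I0.
apply: filterS => x Px Ox; rewrite nuP; congr EFin; apply/esym/eqP.
by rewrite -subr_eq0; have /= [] := Px Ox => ->.
Qed.

End young_pos.

(** * Compactness of sequences bounded together with their inverses *)

Section generation.
Context (R : realType) (n : nat) (p : R) (Omega : set 'rV[R]_n).
Hypotheses (n0 : (0 < n)%N) (p1 : 1 <= p).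
Hypotheses (openO : open Omega) (bndO : bounded_set Omega).
Local Notation T := (lebesgueType R n).
Local Notation mu := (lebesgue R n).

Let mO := measurable_open_lebesgue openO.
Let Ooo := lebesgue_bounded_lty openO bndO.
Let p0 : 0 < p. Proof. exact: lt_le_trans p1. Qed.

(** Matches the integral in the definition of [Ypp] with the one over {det > 0}. The inner integrals
    agree for almost every x, and measurability of the first is inherited by completeness. *)
Lemma integral_growth_inv (nu : 'rV[R]_n -> probability 'M[R]_n R) :
  (forall w : 'M[R]_n -> R, test_fun w ->
    measurable_fun (Omega : set T) (fun x => \int[nu x]_s w s)) ->
  {ae mu, forall x, Omega x -> nu x (@invpos_mx R n) = 1%E} ->
  (\int[mu]_(x in Omega) \int[nu x]_(s in @inv_mx R n) (growth p s)%:E =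
   \int[mu]_(x in Omega) \int[nu x]_s (posdet_part (@growth R n p) s)%:E)%E.
Proof.
move=> mnu nu_pos.
have mG : measurable_fun (Omega : set T)
    (fun x => \int[nu x]_s (posdet_part (@growth R n p) s)%:E)%E.
  apply: (measurable_integral_posdet mnu) => s s0; last exact: growth_ge0.
  exact/growth_cvg/posdet_unitmx.
have aeG : {ae mu, forall x, Omega x ->
    (\int[nu x]_(s in @inv_mx R n) (growth p s)%:E =
     \int[nu x]_s (posdet_part (@growth R n p) s)%:E)%E}.
  apply: filterS nu_pos => x nx Ox; apply: integral_inv_posdet; first exact: nx.
  by move=> s s0; exact: growth_cvg.
have mI : measurable_fun (Omega : set T)
    (fun x => \int[nu x]_(s in @inv_mx R n) (growth p s)%:E)%E.
  apply: (ae_measurable_fun (@lebesgue_complete R n)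
    (f := fun x => \int[nu x]_s (posdet_part (@growth R n p) s)%:E)%E); last exact: mG.
  by apply: filterS aeG => x aeGx Ox; apply/esym; exact: aeGx.
exact: (ae_eq_integral _ _ mO mI mG aeG).
Qed.

Lemma young_compactness (Y : nat -> 'rV[R]_n -> 'M[R]_n) : bounded_in_Lp p Omega Y ->
  bounded_in_Lp p Omega (fun k x => invmx (Y k x)) ->
  (forall k, det_pos_ae Omega (Y k)) ->
  exists (phi : nat -> nat) (nu : 'rV[R]_n -> probability 'M[R]_n R),
    [/\ {homo phi : i j / (i < j)%N}, Ypp_plus p Omega nu &
        limit_formula p Omega (fun k => Y (phi k)) nu].
Proof.
move=> [LY [C YC]] [LiY [D YD]] dY; have mY k := (LY k).1.
have [phi [nu [phi_nd nuP]]] := young_limit n0 openO bndO mY.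
exists phi, nu; pose Z k := Y (phi k).
have mnu w : test_fun w ->
    measurable_fun (Omega : set T) (fun x => \int[nu x]_s w s).
  by move=> /nuP[].
have cvgZ (w : 'M[R]_n -> R) (g : T -> R) : test_fun w ->
    measurable_fun (Omega : set T) g -> ess_bounded mu Omega g ->
    \int[mu]_(x in Omega) (w (Z k x) * g x) @[k --> \oo] -->
    \int[mu]_(x in Omega) (\int[nu x]_s w s * g x).
  by move=> /nuP[_]; apply.
have mZ k : measurable_fun (Omega : set T) (Z k) by exact: mY.
have dZ k : det_pos_ae Omega (Z k) by exact: dY.
have gZ k : (\int[mu]_(x in Omega) (posdet_part (growth p) (Z k x))%:E <=
    (C `^ p + D `^ p)%:E)%E.
  exact: (integral_growth_le n0 p1 openO (mY _) (LiY _).1 (YC _) (YD _)).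
have nug := nu_growth_le n0 openO bndO mnu mZ gZ cvgZ.
have nup := nu_invpos n0 p1 openO bndO mnu mZ dZ gZ cvgZ.
have nug_lty := le_lt_trans nug (ltry _).
split => //; last exact: (limit_formula_test_fun n0 openO bndO mnu nug_lty nup mZ dZ gZ cvgZ).
split => //; split.
- split; first exact: (young_measure_test_fun n0 p1 openO bndO mnu nug_lty nup mZ dZ gZ cvgZ).
  exists Z; split; last first.
    exact: (generates_test_fun n0 p1 openO bndO mnu nug_lty nup mZ dZ gZ cvgZ).
  by split=> [k|]; [exact: LY|exists C => k; exact: YC].
- by rewrite -[X in (X < _)%E]/(\int[mu]_(x in Omega) _)%E (integral_growth_inv mnu nup).
- apply: filterS nup => x nx Ox; apply/eqP; rewrite eq_le probability_le1/=; last first.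
    by apply: open_measurable_mx; exact: open_unitmx.
  rewrite -(nx Ox); apply: le_measure; rewrite ?inE.
  + by apply: open_measurable_mx; exact: open_posdet.
  + by apply: open_measurable_mx; exact: open_unitmx.
  + by move=> s; exact: posdet_unitmx.
Qed.

End generation.

(** * Recovery sequences *)

Section truncation.
Context {R : realType} {n : nat}.
Implicit Types (s : 'M[R]_n) (m p : R).

(** At the threshold 1/2 both alternatives are controlled by test functions: a matrix that is kept
    has growth at most twice cutoff times growth, and one that is replaced has 1 < 2 (1 -
    cutoff). *)
Definition truncate m s : 'M[R]_n := if 2^-1 <= cutoff m s then s else 1%:M.

Lemma truncate_det m s : 0 < \det (truncate m s).
Proof.
rewrite /truncate; case: ifPn => [s2|_]; last by rewrite det1.
apply: (proj1 (cutoff_neq0 (m := m) _)).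
by apply: lt0r_neq0; apply: lt_le_trans s2; rewrite invr_gt0.
Qed.

Lemma growth_truncate p m s :
  growth p (truncate m s) <= 2 * (cutoff m s * growth p s) + growth p (1%:M : 'M[R]_n).
Proof.
have g1 := growth_ge0 p (1%:M : 'M[R]_n); have gs := growth_ge0 p s.
have c0 := cutoff_ge0 m s; have cg := mulr_ge0 c0 gs.
rewrite /truncate; case: ifPn => [s2|_]; last lra.
by have : 2^-1 * growth p s <= cutoff m s * growth p s; [exact: ler_wpM2r|lra].
Qed.

(** The two values differ by at most 2 C, and only where 1 - cutoff exceeds 1/2; hence the factor 4.
    The function w enters through its bound alone. *)
Lemma truncate_diff m s (w : 'M[R]_n -> R) (C : R) : (forall t, `|w t| <= C) ->
  `|w (truncate m s) - w s| <= 4 * C * (1 - cutoff m s).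
Proof.
move=> wC; have C0 : 0 <= C by apply: le_trans (wC 0).
have c1 := cutoff_le1 m s; rewrite /truncate; case: ifPn => [s2|].
  by rewrite subrr normr0 mulr_ge0 ?mulr_ge0// subr_ge0.
rewrite -ltNge => s2; apply: (le_trans (ler_normB _ _)).
have := wC 1%:M; have := wC s.
have : C * 2^-1 <= C * (1 - cutoff m s) by apply: ler_wpM2l => //; lra.
by rewrite -mulrA; lra.
Qed.

Let measurable_keep m : measurable_fun setT (fun s => 2^-1 <= cutoff m s).
Proof.
apply: measurable_fun_ler; first exact: measurable_cst.
exact: measurable_test_fun (test_fun_cutoff m).
Qed.

Lemma measurable_truncate m : measurable_fun setT (truncate m).
Proof.
apply: measurable_fun_ifT; [exact: measurable_keep|exact: measurable_id|].
exact: measurable_cst.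
Qed.

(** The entries of the inverse are continuous on {det > 0}, and every matrix that [truncate] keeps
    lies there; this is the reason for [posdet_part]. *)
Lemma measurable_invmx_truncate m : measurable_fun setT (fun s => invmx (truncate m s)).
Proof.
apply/measurable_fun_mxP => // i j; rewrite (_ : (fun _ => _) = fun s =>
  if 2^-1 <= cutoff m s then posdet_part (fun t => invmx t i j) s else (1%:M : 'M[R]_n) i j).
  apply: measurable_fun_ifT; [exact: measurable_keep| |exact: measurable_cst].
  apply: measurable_posdet_part => s s0.
  exact: (@cvg_comp _ _ _ (@invmx R n) (fun t : 'M[R]_n => t i j) _ _ _
    (invmx_continuous_at (posdet_unitmx s0)) (@coord_continuous R n n i j _)).
apply/funext => s; have := truncate_det m s; rewrite /truncate; case: ifP => _.
  by rewrite /posdet_part => ->.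
by rewrite invmx1.
Qed.

End truncation.

Section young_truncation.
Context (R : realType) (n : nat) (p : R) (Omega : set 'rV[R]_n).
Hypotheses (n0 : (0 < n)%N) (p1 : 1 <= p).
Hypotheses (openO : open Omega) (bndO : bounded_set Omega).
Local Notation T := (lebesgueType R n).
Local Notation mu := (lebesgue R n).

Let mO := measurable_open_lebesgue openO.
Let Ooo := lebesgue_bounded_lty openO bndO.
Let p0 : 0 < p. Proof. exact: lt_le_trans p1. Qed.

Lemma Lp_of_growth (C : R) (Y : nat -> 'rV[R]_n -> 'M[R]_n) : 0 <= C ->
  (forall k, measurable_fun (Omega : set T) (Y k)) ->
  (forall k, measurable_fun (Omega : set T) (fun x => invmx (Y k x))) ->
  (forall k, \int[mu]_(x in Omega) (growth p (Y k x))%:E <= C%:E)%E ->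
  bounded_in_Lp p Omega Y /\ bounded_in_Lp p Omega (fun k x => invmx (Y k x)).
Proof.
move=> C0 mY miY gY.
have mf (Z : T -> 'M[R]_n) := @measurable_frobenius_powR R n p Omega Z.
have f0 (Z : T -> 'M[R]_n) x : Omega x -> (0 <= (frobenius (Z x) `^ p)%:E)%E.
  by move=> _; rewrite lee_fin powR_ge0.
have mg k : measurable_fun (Omega : set T) (fun x => (growth p (Y k x))%:E).
  exact: (emeasurable_funD (mf _ (mY k)) (mf _ (miY k))).
have bnd (Z : nat -> 'rV[R]_n -> 'M[R]_n) :
    (forall k, measurable_fun (Omega : set T) (Z k)) ->
    (forall k x, frobenius (Z k x) `^ p <= growth p (Y k x)) -> bounded_in_Lp p Omega Z.
  move=> mZ ZY.
  have ZC k : (Lp_norm p Omega (Z k) <= (C `^ p^-1)%:E)%E.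
    apply: (Lp_norm_ge p0 C0); apply: le_trans (gY k).
    apply: (ge0_le_integral mu mO (f0 (Z k)) (mf _ (mZ k)) (mg k)) => x _.
    by rewrite lee_fin.
  split; last by exists (C `^ p^-1).
  by move=> k; split; [exact: mZ|exact: le_lt_trans (ZC k) (ltry _)].
by split; apply: bnd => // k x; rewrite ?lerDl ?lerDr powR_ge0.
Qed.


Variables (nu : 'rV[R]_n -> probability 'M[R]_n R) (Y : nat -> 'rV[R]_n -> 'M[R]_n).
Hypothesis mnu : forall w : 'M[R]_n -> R, test_fun w ->
  measurable_fun (Omega : set T) (fun x => \int[nu x]_s w s).
Hypothesis nu_growth : (\int[mu]_(x in Omega)
  \int[nu x]_s (posdet_part (@growth R n p) s)%:E < +oo)%E.
Hypothesis nu_pos : {ae mu, forall x, Omega x -> nu x (@invpos_mx R n) = 1%E}.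
Hypotheses (mY : forall k, measurable_fun (Omega : set T) (Y k)).
Hypothesis cvgY : forall (w : 'M[R]_n -> R) (g : T -> R), test_fun w ->
  measurable_fun (Omega : set T) g -> ess_bounded mu Omega g ->
  \int[mu]_(x in Omega) (w (Y k x) * g x) @[k --> \oo] -->
  \int[mu]_(x in Omega) (\int[nu x]_s w s * g x).

Let jcst (c : R) : mu.-integrable Omega (EFin \o cst c).
Proof.
by apply: (bounded_integrable mO (C := `|c|)); [exact: Ooo|exact: measurable_cst|].
Qed.

Let Icst (c : R) : \int[mu]_(x in Omega) c = c * fine (mu Omega).
Proof. exact: Rintegral_cst. Qed.

Let jwY w k : test_fun w -> mu.-integrable Omega (EFin \o (fun x => w (Y k x))).
Proof. exact: integrable_test_fun_comp (mY k). Qed.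

(** Dominated convergence: for almost every x the measure nu_x is carried by {det > 0}, to whose
    indicator function the cutoffs increase. *)
Lemma integral_cutoff_cvg_mu :
  \int[mu]_(x in Omega) (\int[nu x]_s cutoff m%:R s) @[m --> \oo] --> fine (mu Omega).
Proof.
pose f m (x : T) : \bar R := (\int[nu x]_s cutoff m%:R s)%:E.
have mf m : measurable_fun (Omega : set T) (f m).
  by apply/measurable_EFinP; exact: mnu (test_fun_cutoff m%:R).
have ff : {ae mu, forall x, Omega x -> f ^~ x @ \oo --> (cst 1%E : T -> \bar R) x}.
  apply: filterS nu_pos => x nx Ox; rewrite /f /= -(nx Ox) -integral_posdet1.
  have := @integral_cutoff_cvg R n (nu x) (cst 1).
  have c1 (s : 'M[R]_n) : 0 < \det s -> (cst 1 : 'M[R]_n -> R) t @[t --> s] --> (1 : R).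
    by move=> _; exact: cst_continuous.
  have -> : (fun m => \int[nu x]_s (cutoff m%:R s * cst 1 s)%:E)%E = f ^~ x.
    apply/funext => m; rewrite /f -(integral_test_fun _ (test_fun_cutoff _)).
    by apply: eq_integral => s _; rewrite /= mulr1.
  by apply=> // s _; exact: ler01.
have f1 : {ae mu, forall x m, Omega x -> (`|f m x| <= (EFin \o cst (1%R : R)) x)%E}.
  apply: aeW => x m _; rewrite /f /= lee_fin.
  rewrite ger0_norm; last by apply: Rintegral_ge0 => s _; exact: cutoff_ge0.
  rewrite -[leRHS](Rintegral_prob_cst (nu x)); apply: ae_le_Rintegral.
  - exact: measurableT.
  - exact: integrable_test_fun (test_fun_cutoff _).
  - apply: (bounded_integrable measurableT (C := 1)).
    + exact: probability_lty.
    + exact: measurable_cst.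
    + by move=> s _; rewrite normr1.
  - by apply: aeW => s _; exact: cutoff_le1.
have [_ _] := dominated_convergence mO mf (measurable_cst _) ff (jcst 1) f1.
rewrite integral_cst// mul1e => fcvg.
apply: fine_cvg; rewrite fineK//.
by rewrite ge0_fin_numE// Ooo.
Qed.

Let G := fine (\int[mu]_(x in Omega) \int[nu x]_s (posdet_part (@growth R n p) s)%:E)%E.

Lemma integral_cutoff_growth_le m :
  \int[mu]_(x in Omega) (\int[nu x]_s (cutoff m s * growth p s)) <= G.
Proof.
have cg (s : 'M[R]_n) : 0 < \det s -> growth p t @[t --> s] --> growth p s.
  by move=> s0; exact/growth_cvg/posdet_unitmx.
have tw := cutoff_test_fun m cg; pose w (s : 'M[R]_n) := cutoff m s * growth p s.
have w0 (s : 'M[R]_n) : setT s -> (0 <= (w s)%:E)%E.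
  by move=> _; rewrite lee_fin mulr_ge0 ?cutoff_ge0 ?growth_ge0.
have jw := integrable_nu_test_fun openO bndO mnu tw.
rewrite -lee_fin [leRHS]fineK; last first.
  rewrite ge0_fin_numE; [exact: nu_growth|apply: integral_ge0 => x _].
  by apply: integral_ge0 => s _; rewrite lee_fin posdet_growth_ge0.
rewrite [leLHS]fineK; last exact: (integrable_fin_num mO jw).
have W0 (x : T) : Omega x -> (0 <= (\int[nu x]_s w s)%:E)%E.
  by move=> _; rewrite lee_fin; apply: Rintegral_ge0 => s _; rewrite -lee_fin w0.
have mG : measurable_fun (Omega : set T)
    (fun x => \int[nu x]_s (posdet_part (@growth R n p) s)%:E)%E.
  by apply: (measurable_integral_posdet mnu) => s s0; [exact: cg|exact: growth_ge0].
apply: (ge0_le_integral mu mO W0 (measurable_int _ jw) mG) => x _.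
rewrite /= -(integral_test_fun _ tw).
have mw : measurable_fun [set: 'M[R]_n] (fun s => (w s)%:E).
  by apply/measurable_EFinP; exact: measurable_test_fun tw.
have mg : measurable_fun [set: 'M[R]_n] (fun s => (posdet_part (@growth R n p) s)%:E).
  by apply/measurable_EFinP; exact: measurable_posdet_part cg.
apply: (ge0_le_integral (nu x) measurableT w0 mw mg) => s _.
by rewrite lee_fin /w -cutoff_posdet ler_piMl ?cutoff_le1// posdet_growth_ge0.
Qed.

(** For fixed m both integrands are test functions, so the last two conditions hold for all large k,
    with slack 1 and 1 / (m + 1). The condition m <= k makes the chosen indices tend to infinity. *)
Lemma exists_good_index m : exists k : nat, [/\ (m <= k)%N,
  \int[mu]_(x in Omega) (cutoff m%:R (Y k x) * growth p (Y k x)) <= G + 1 &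
  \int[mu]_(x in Omega) (\int[nu x]_s cutoff m%:R s) - m.+1%:R^-1 <=
    \int[mu]_(x in Omega) cutoff m%:R (Y k x)].
Proof.
have cg (s : 'M[R]_n) : 0 < \det s -> growth p t @[t --> s] --> growth p s.
  by move=> s0; exact/growth_cvg/posdet_unitmx.
have near1 : \forall k \near \oo,
    \int[mu]_(x in Omega) (cutoff m%:R (Y k x) * growth p (Y k x)) <= G + 1.
  have := cvg_test_fun1 cvgY (cutoff_test_fun m%:R cg).
  move=> /cvgrPdist_le /(_ _ ltr01); apply: filterS => k.
  by rewrite ler_norml => /andP[+ _]; have := integral_cutoff_growth_le m%:R; lra.
have m0 : 0 < m.+1%:R^-1 :> R by rewrite invr_gt0.
have near2 : \forall k \near \oo,
    \int[mu]_(x in Omega) (\int[nu x]_s cutoff m%:R s) - m.+1%:R^-1 <=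
    \int[mu]_(x in Omega) cutoff m%:R (Y k x).
  have := cvg_test_fun1 cvgY (test_fun_cutoff m%:R).
  move=> /cvgrPdist_le /(_ _ m0); apply: filterS => k.
  by rewrite ler_norml => /andP[_]; rewrite lerBlDl lerBlDr.
have [N _ NP] := filterI (nbhs_infty_ge m) (filterI near1 near2).
by have [? [? ?]] := NP N (leqnn N); exists N.
Qed.

(** One choice of indices serves all w and g, since the effect of truncation is estimated by the
    bound of w, the bound of g and the integral of 1 - cutoff. *)
Lemma young_recovery : exists Z : nat -> 'rV[R]_n -> 'M[R]_n,
  [/\ bounded_in_Lp p Omega Z, bounded_in_Lp p Omega (fun k x => invmx (Z k x)),
      forall k, det_pos_ae Omega (Z k) & limit_formula p Omega Z nu].
Proof.
have /choice[k kP] := exists_good_index.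
pose Z m x := truncate m%:R (Y (k m) x).
have mZ m : measurable_fun (Omega : set T) (Z m).
  exact: measurableT_comp (measurable_truncate _) (mY _).
have miZ m : measurable_fun (Omega : set T) (fun x => invmx (Z m x)).
  exact: measurableT_comp (measurable_invmx_truncate _) (mY _).
have dZ m : det_pos_ae Omega (Z m) by apply: aeW => x _; exact: truncate_det.
(* From [growth_truncate]: G + 1 bounds the integral of cutoff times growth, and the identity matrix
   contributes at most its growth on all of Omega. *)
pose C : R := 2 * (G + 1) + growth p (1%:M : 'M[R]_n) * fine (mu Omega).
have cg (s : 'M[R]_n) : 0 < \det s -> growth p t @[t --> s] --> growth p s.
  by move=> s0; exact/growth_cvg/posdet_unitmx.
have gZ m : (\int[mu]_(x in Omega) (posdet_part (growth p) (Z m x))%:E <= C%:E)%E.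
  have [_ wC _] := kP m; pose h (x : T) := cutoff m%:R (Y (k m) x) * growth p (Y (k m) x).
  have jh : mu.-integrable Omega (EFin \o h) by exact: jwY (cutoff_test_fun m%:R cg).
  have j2h := integrable_cstM mO 2 jh.
  have jH := integrable_addr mO j2h (jcst (growth p (1%:M : 'M[R]_n))).
  have g0 (x : T) : Omega x -> (0 <= (posdet_part (growth p) (Z m x))%:E)%E.
    by move=> _; rewrite lee_fin posdet_growth_ge0.
  have mg : measurable_fun (Omega : set T) (fun x => (posdet_part (growth p) (Z m x))%:E).
    apply/measurable_EFinP; apply: measurableT_comp (mZ m).
    exact: measurable_posdet_part cg.
  have le1 : (\int[mu]_(x in Omega) (posdet_part (growth p) (Z m x))%:E <=
      \int[mu]_(x in Omega) (2 * h x + growth p (1%:M : 'M[R]_n))%:E)%E.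
    apply: (ge0_le_integral mu mO g0 mg (measurable_int _ jH)) => x _.
    by rewrite lee_fin /posdet_part truncate_det growth_truncate.
  apply: (le_trans le1); rewrite -[leLHS]fineK; last exact: (integrable_fin_num mO jH).
  rewrite lee_fin -[leLHS]/(Rintegral _ _ _) (RintegralD mO j2h (jcst _)).
  rewrite (Rintegral_cstM mO _ jh) Icst lerD2r ler_pM2l//; exact: wC.
have C0 : 0 <= C.
  rewrite -lee_fin; apply: le_trans (gZ 0%N); apply: integral_ge0 => x _.
  by rewrite lee_fin posdet_growth_ge0.
have cvgZ (w : 'M[R]_n -> R) (g : T -> R) : test_fun w ->
    measurable_fun (Omega : set T) g -> ess_bounded mu Omega g ->
    \int[mu]_(x in Omega) (w (Z m x) * g x) @[m --> \oo] -->
    \int[mu]_(x in Omega) (\int[nu x]_s w s * g x).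
  move=> tw mg bg; have [D gD] := bg; have [W W0 wW] := test_fun_bounded tw.
  pose L := \int[mu]_(x in Omega) (\int[nu x]_s w s * g x).
  pose A m := \int[mu]_(x in Omega) (w (Z m x) * g x).
  pose A' m := \int[mu]_(x in Omega) (w (Y (k m) x) * g x).
  pose K := 4 * W * `|D|.
  (* A bound for the integral of 1 - cutoff along the chosen sequence: the mass that nu leaves
     outside the cutoff, plus the slack allowed in the choice of k m. *)
  pose b m := fine (mu Omega) - \int[mu]_(x in Omega) (\int[nu x]_s cutoff m%:R s) +
    m.+1%:R^-1.
  have kinf : k m @[m --> \oo] --> \oo.
    apply/cvgnyPge => N; exists N => // m /= Nm; apply: leq_trans Nm _.
    by have [] := kP m.
  have A'L : A' m @[m --> \oo] --> L by exact: cvg_comp kinf (cvgY tw mg bg).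
  have b0 : b m @[m --> \oo] --> 0.
    rewrite -[X in _ --> X](addr0 0); apply: cvgD; last exact: cvg_harmonic.
    rewrite -(subrr (fine (mu Omega))).
    exact: cvgB (cvg_cst _) integral_cutoff_cvg_mu.
  have AA' m : `|A m - A' m| <= K * b m.
    have [_ _ cm] := kP m.
    have jc := jwY (k m) (test_fun_cutoff m%:R).
    have j1c : mu.-integrable Omega (EFin \o (fun x => 1 - cutoff m%:R (Y (k m) x))).
      exact: (integrableB mO (jcst 1) jc).
    have jZ := integrable_test_fun_comp openO bndO (mZ m) tw.
    have jZg := integrable_ess_bounded mO jZ mg bg.
    have jYg := integrable_ess_bounded mO (jwY (k m) tw) mg bg.
    have K0 : 0 <= K by rewrite /K !mulr_ge0// ltW.
    apply: (le_trans (dist_Rintegral_le mO jZg jYg (integrable_cstM mO K j1c) _)).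
      apply: filterS gD => x gDx Ox; rewrite -mulrBl normrM /K.
      rewrite [leRHS]mulrAC; apply: ler_pM => //; first exact: truncate_diff.
      exact: le_trans (gDx Ox) (ler_norm _).
    rewrite (Rintegral_cstM mO _ j1c) ler_wpM2l//.
    rewrite (RintegralB mO (jcst 1) jc) Icst mul1r /b -addrA lerD2l.
    by rewrite lerNl opprD opprK.
  have Kb : K * b m @[m --> \oo] --> 0.
    by rewrite -[X in _ --> X](mulr0 K); exact: cvgM (cvg_cst _) b0.
  have NKb : - (K * b m) @[m --> \oo] --> 0 by rewrite -oppr0; exact: cvgN Kb.
  have AA'0 : A m - A' m @[m --> \oo] --> 0.
    apply: (squeeze_cvgr _ NKb Kb); apply: nearW => m; rewrite -ler_norml.
    exact: AA'.
  have -> : (fun m => \int[mu]_(x in Omega) (w (Z m x) * g x)) =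
      (fun m => A' m + (A m - A' m)) by apply/funext => m; rewrite addrC subrK.
  by rewrite -[X in _ --> X]addr0; exact: cvgD A'L AA'0.
have growthZ m : (\int[mu]_(x in Omega) (growth p (Z m x))%:E <= C%:E)%E.
  apply: le_trans (gZ m).
  by under [leRHS]eq_integral do rewrite /posdet_part truncate_det.
have [bZ biZ] := Lp_of_growth C0 mZ miZ growthZ.
exists Z; split; [exact: bZ|exact: biZ|exact: dZ|].
exact: (limit_formula_test_fun n0 openO bndO mnu nu_growth nu_pos mZ dZ gZ cvgZ).
Qed.

End young_truncation.

(** * Generating sequences on test functions, and the two directions *)

(** Test functions lie in C_p, so generation gives convergence of extended-valued integrals; the
    limit is finite, and the real-valued integrals converge with them. *)
Lemma generates_cvg_test_fun (R : realType) (n : nat) (p : R) (Omega : set 'rV[R]_n)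
    (Y : nat -> 'rV[R]_n -> 'M[R]_n) (nu : 'rV[R]_n -> probability 'M[R]_n R)
    (w : 'M[R]_n -> R) :
  1 <= p -> open Omega -> generates p Omega Y nu -> test_fun w ->
  (lebesgue R n).-integrable Omega (EFin \o (fun x => \int[nu x]_s w s)) /\
  forall g : lebesgueType R n -> R, measurable_fun (Omega : set (lebesgueType R n)) g ->
    ess_bounded (lebesgue R n) Omega g ->
    \int[lebesgue R n]_(x in Omega) (w (Y k x) * g x) @[k --> \oo] -->
    \int[lebesgue R n]_(x in Omega) (\int[nu x]_s w s * g x).
Proof.
move=> p1 openO gen tw; have [_ + cvgw] := gen w (test_fun_Cp p1 tw).
under [X in (_.-integrable _ X)]eq_fun do rewrite (integral_test_fun _ tw).
move=> jw; split=> [|g mg bg]; first exact: jw.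
have gO : Linfty Omega g by apply/LinftyP.
have := cvgw g gO; under [X in _ --> X -> _]eq_integral do rewrite (integral_test_fun _ tw).
have jwg := integrable_ess_bounded (measurable_open_lebesgue openO) jw mg bg.
move=> cvgg; apply: fine_cvg; rewrite fineK; first exact: cvgg.
exact: (integrable_fin_num (measurable_open_lebesgue openO) jwg).
Qed.

Theorem theorem2p2 (R : realType) (n : nat) (p : R) (Omega : set 'rV[R]_n) :
  (0 < n)%N -> 1 <= p -> open Omega -> bounded_set Omega ->
  (forall Y : nat -> 'rV[R]_n -> 'M[R]_n,
     bounded_in_Lp p Omega Y ->
     bounded_in_Lp p Omega (fun k x => invmx (Y k x)) ->
     (forall k, det_pos_ae Omega (Y k)) ->
     exists (phi : nat -> nat) (nu : 'rV[R]_n -> probability 'M[R]_n R),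
       [/\ {homo phi : i j / (i < j)%N},
           Ypp_plus p Omega nu &
           limit_formula p Omega (fun k => Y (phi k)) nu]) /\
  (forall nu : 'rV[R]_n -> probability 'M[R]_n R,
     Ypp_plus p Omega nu ->
     exists Y : nat -> 'rV[R]_n -> 'M[R]_n,
       [/\ bounded_in_Lp p Omega Y,
           bounded_in_Lp p Omega (fun k x => invmx (Y k x)),
           forall k, det_pos_ae Omega (Y k) &
           limit_formula p Omega Y nu]).
Proof.
move=> n0 p1 openO bndO; split=> [Y bY biY dY|nu].
  exact: (young_compactness n0 p1 openO bndO bY biY dY).
move=> [[[_ [Y [[LY _] gen]]] nug _] nup].
have mnu w : test_fun w ->
    measurable_fun (Omega : set (lebesgueType R n)) (fun x => \int[nu x]_s w s).
  by move=> /(generates_cvg_test_fun p1 openO gen)[/measurable_int/measurable_EFinP].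
apply: (young_recovery n0 p1 openO bndO mnu _ nup (fun k => (LY k).1)).
  by move: nug; rewrite (integral_growth_inv p n0 openO mnu nup).
by move=> w g tw; have [_] := generates_cvg_test_fun p1 openO gen tw; apply.
Qed.
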